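(* Let $p$ be a prime, let $K=\overline{\mathbb{F}}_p(t)$, and let $v=\mathrm{ord}_\infty$ be the valuation on $K$ given by order of vanishing at infinity, i.e. $v(a/b)=\deg(a)-\deg(b)$ for nonzero $a,b\in\overline{\mathbb{F}}_p[t]$. Let $\phi\in K(z)$ be a non-isotrivial rational map of degree $d\geq 2$, and assume that $\gamma\in\mathbb{P}^1(K)$ is not a post-critical point for $\phi$. Then there exists $M$ such that for all $m\geq M$ and all $\alpha\in\phi^{-m}(\gamma)\setminus\mathbb{P}^1(K)$ (preimages taken in $\mathbb{P}^1(\overline{K})$) we have \[E_v(\alpha)\leq \lceil d^m/2\rceil+1.\]
   Context: A rational map $\phi$ defined over a function field $K/k(t)$ is isotrivial if there is a change of coordinates on $\mathbb{P}^1(\overline{K})$ (a degree-one rational map $\mu$ over $\overline{K}$) such that $\mu\circ\phi\circ\mu^{-1}$ has coefficients in $\overline{k}$; otherwise it is non-isotrivial. For an algebraically closed field $L$, $\varphi\in L(z)$ and $\alpha\in\mathbb{P}^1(L)$, the ramification index $e_\varphi(\alpha)$ is the integer $e\geq1$ such that, after degree-one changes of coordinates $\sigma,\theta$ with $\theta(0)=\alpha$ and $\sigma\circ\varphi\circ\theta(0)=0$, one has $\sigma\circ\varphi\circ\theta(z)=z^e g(z)$ with $g(0)\neq0$; $\alpha$ is a critical point if $e_\varphi(\alpha)>1$. A point $\gamma$ is post-critical for $\phi$ if $\gamma=\phi^n(c)$ for some critical point $c$ of $\phi$ (over $\overline{K}$) and some $n\geq1$. The height of $r=a/b\in K$ with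 $a,b\in\overline{\mathbb{F}}_p[t]$ coprime is $h(r)=\max\{\deg a,\deg b\}$. For $\alpha\in\overline{K}\setminus K$, the diophantine approximation exponent is \[E_v(\alpha)=\max_{w\mid v}\ \limsup_{r\in K,\ h(r)\to\infty}\frac{w(\alpha-r)}{h(r)},\] where $w$ ranges over the (inequivalent) valuations of $K(\alpha)$ restricting to $v$ on $K$.
   Formalization: The valuation v is taken as the order of vanishing at infinity, v(a/b) = deg(b) − deg(a); the printed formula deg(a) − deg(b) has the opposite sign and is not a valuation (t + (1−t) = 1 violates the ultrametric inequality). *)

(* Defs.v *)
From HB Require Import structures.
From mathcomp Require Import all_boot all_order all_algebra.
From mathcomp Require Import all_classical all_reals all_analysis.

Set Implicit Arguments.
Unset Strict Implicit.
Unset Printing Implicit Defensive.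

Import Order.TTheory GRing.Theory Num.Theory.

Local Open Scope classical_set_scope.
Local Open Scope ring_scope.

(* [P1 F] is the projective line over F, with [None] the point at infinity. *)
Notation P1 F := (option F).

(* [ratfun F] is the field of rational functions F(z) (or F(t)). *)
Notation ratfun F := {fraction {poly F}}.

Section RationalFunctions.
Variable F : fieldType.
Implicit Types phi psi : ratfun F.

Definition ratX : ratfun F := tofrac 'X.

(* [repr phi] is a ratio of polynomials that need not be in lowest terms;
   [ratnum phi] and [ratden phi] are coprime, [ratden phi] is nonzero and
   phi = ratnum phi / ratden phi. *)
Definition ratnum phi : {poly F} :=
  let r := frac (repr phi) in r.1 %/ gcdp r.1 r.2.

Definition ratden phi : {poly F} :=
  let r := frac (repr phi) in r.2 %/ gcdp r.1 r.2.

(* The maximum of the degrees of the numerator and the denominator: the degree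
   of a rational map, and also the height of an element of F(t). *)
Definition ratdeg phi : nat := (maxn (size (ratnum phi)) (size (ratden phi))).-1.

(* Action on P^1(F). At infinity one compares the coefficients in degree
   [ratdeg phi]. As numerator and denominator are coprime, [a] and [b] below
   never vanish together. *)
Definition rateval phi (x : P1 F) : P1 F :=
  let a := if x is Some u then (ratnum phi).[u] else (ratnum phi)`_(ratdeg phi) in
  let b := if x is Some u then (ratden phi).[u] else (ratden phi)`_(ratdeg phi) in
  if b == 0 then None else Some (a / b).

(* Composition phi(psi(z)), computed in the field F(z). It is meaningful for
   nonconstant psi (otherwise the denominator may vanish), the only case in
   which it is used. *)
Definition ratcomp phi psi : ratfun F :=
  let lift (q : {poly F}) := map_poly (fun c : F => tofrac c%:P : ratfun F) q in
  (lift (ratnum phi)).[psi] / (lift (ratden phi)).[psi].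

(* g(0) <> 0 is understood to say that g is regular and nonzero at 0. *)
Definition is_ramification_index phi (a : P1 F) (e : nat) : Prop :=
  (1 <= e)%N /\
  exists sigma theta : ratfun F,
    let f := ratcomp sigma (ratcomp phi theta) in
    [/\ ratdeg sigma = 1%N, ratdeg theta = 1%N,
        rateval theta (Some 0) = a, rateval f (Some 0) = Some 0 &
        exists g : ratfun F, f = ratX ^+ e * g /\
          exists2 c : F, c != 0 & rateval g (Some 0) = Some c].

Definition critical_point phi (a : P1 F) : Prop :=
  exists2 e, (1 < e)%N & is_ramification_index phi a e.

Definition post_critical phi (a : P1 F) : Prop :=
  exists c n, [/\ critical_point phi c, (1 <= n)%N & a = iter n (rateval phi) c].

End RationalFunctions.

(* Extension of scalars F(z) -> L(z) along a field embedding F -> L. *)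
Definition ratmap (F L : fieldType) (iota : {rmorphism F -> L})
    (phi : ratfun F) : ratfun L :=
  tofrac (map_poly iota (ratnum phi)) / tofrac (map_poly iota (ratden phi)).

(* Here k is a field of constants embedded in L by [c]; the elements of L
   algebraic over k form the algebraic closure of k in L. *)
Definition isotrivial (k L : fieldType) (c : k -> L) (phi : ratfun L) : Prop :=
  exists mu nu : ratfun L,
    [/\ ratdeg mu = 1%N,
        ratcomp mu nu = ratX L, ratcomp nu mu = ratX L &
        exists f g : {poly L},
          [/\ g != 0,
              forall i, algebraicOver c f`_i, forall i, algebraicOver c g`_i &
              ratcomp mu (ratcomp phi nu) = tofrac f / tofrac g]].

(* The order of vanishing at infinity of a nonzero r = a/b in k(t) is
   deg b - deg a; the value at 0 is junk. *)
Definition ord_infty (k : fieldType) (r : ratfun k) : int :=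
  (size (ratden r))%:Z - (size (ratnum r))%:Z.

Section Approximation.
Variables (R : realType) (k L : fieldType) (iota : {rmorphism ratfun k -> L}).

(* The subfield K(a) of L, for K = k(t). *)
Definition adjoin (a : L) : set L :=
  [set x | exists P Q : {poly ratfun k},
     (map_poly iota Q).[a] != 0 /\
     x = (map_poly iota P).[a] / (map_poly iota Q).[a]].

(* w is a valuation on the subfield D of L whose restriction to k(t) is the
   valuation at infinity. Only the values of w at nonzero elements of D
   matter. *)
Definition valuation_above_infty (D : set L) (w : L -> R) : Prop :=
  [/\ forall x y, D x -> D y -> x != 0 -> y != 0 -> w (x * y) = w x + w y,
      forall x y, D x -> D y -> x != 0 -> y != 0 -> x + y != 0 ->
        Num.min (w x) (w y) <= w (x + y) &
      forall r : ratfun k, r != 0 -> w (iota r) = (ord_infty r)%:~R].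

Definition height_infty : set_system (ratfun k) :=
  filter_from [set: nat] (fun N => [set r : ratfun k | (N <= ratdeg r)%N]).

(* The limit superior as the height tends to infinity; the library's limf_esup,
   which requires the domain to be a filteredType, has the same body. *)
Definition height_limsup (f : ratfun k -> \bar R) : \bar R :=
  ereal_inf [set ereal_sup (f @` V) | V in height_infty].

(* The supremum is over finitely many limits superior, because finitely many
   valuations of K(a) extend the valuation of K at infinity. *)
Definition approx_exponent (a : L) : \bar R :=
  ereal_sup [set height_limsup
      (fun r : ratfun k => (w (a - iota r) / (ratdeg r)%:R)%:E)
    | w in valuation_above_infty (adjoin a)].

End Approximation.

(* Main.v *)
Require Import Defs.
From HB Require Import structures.
From mathcomp Require Import all_boot all_order all_algebra all_field.
From mathcomp Require Import all_classical all_reals all_analysis.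
From mathcomp Require Import generic_quotient ring lra zify.

(** Suppose that E_v(alpha) exceeds ceil(d^m/2) + 1. Liouville's inequality gives
    d^m < 2 [K(alpha) : K]. A dimension count provides, for every q = p^e,
    polynomials A and B over k[t] of degree at most [K(alpha) : K]/2 in z, and of
    degree O(q) in t, with A(alpha) alpha^q = B(alpha). Two good approximations
    r1, r2 of alpha with q h(r1) close to h(r2) then satisfy A(r2) r1^q = B(r2), and
    comparing heights shows that B/A has degree one after cancellation. So
    alpha^q = R_0(alpha) for some Moebius transformation R_0 over K.

    As alpha has large degree over K, this relation can be transported along its
    orbit: phi^i(alpha)^q = R_i(phi^i(alpha)), and R_(i+1) o phi = phi^(q) o R_i as
    rational functions for i < 4, where phi^(q) has the q-th powers of the
    coefficients of phi. In other words phi intertwines the bijections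
    g_i = R_i^-1 o Frob_q of the projective line, which therefore permute the branch
    points of phi (finite in number and not zero, phi being separable because gamma is
    not post-critical) and their preimages. If these are at least three points, powers
    of the g_i are Frobenius maps in a suitable coordinate, and phi is defined over a
    finite field there. If they are two, phi is conjugate to z^d or z^-d; if there is
    only one, phi is conjugate to a polynomial with constant derivative, and Lang's
    theorem for the affine group applies. In all cases phi is isotrivial. *)

Set Implicit Arguments.
Unset Strict Implicit.
Unset Printing Implicit Defensive.

Import Order.TTheory GRing.Theory Num.Theory.

Local Open Scope classical_set_scope.
Local Open Scope ring_scope.

(** * Homogeneous evaluation *)

(** Since alpha^q - r1^q = (alpha - r1)^q, a q-th power multiplies the quality of an approximation
    by q at no cost; this replaces the vanishing to high order in Thue's method. Put a =
    floor([K(alpha) : K]/2) and let q h(r1) be close to h(r2). If w(alpha - r) >= kappa h(r) for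
    both approximations, then A(r2) r1^q - B(r2) has valuation about kappa h(r2), while its
    denominator has degree about (a + 1) h(r2). So kappa > a + 1 forces it to vanish; as
    [K(alpha) : K] <= d^m, this is the origin of ceil(d^m/2) + 1.

    On the dynamical side the obstacle is that the g_i differ from one another: no single map
    commutes with phi, and a finite set stable under some of them loses one index whenever it is
    pulled back along phi. Two pullbacks of the branch points must remain stable under two
    consecutive g_i, which is why the relation is transported four times. Each transport needs
    [K(x) : K] to be large in comparison with d, and for the last one this requires three further
    levels of the orbit; hence m >= 7. *)

Section HomogeneousEvaluation.

(* The degree-n homogenization of p at (x : y); coefficients of p beyond degree n
   are dropped. *)
Definition hev (A : comNzRingType) n (p : {poly A}) (x y : A) : A :=
  \sum_(i < n.+1) p`_i * x ^+ i * y ^+ (n - i).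

Lemma hev_x1 (A : comNzRingType) n (p : {poly A}) x :
  (size p <= n.+1)%N -> hev n p x 1 = p.[x].
Proof.
move=> sp; rewrite (horner_coef_wide _ sp); apply: eq_bigr => i _.
by rewrite expr1n mulr1.
Qed.

Lemma hev_x0 (A : comNzRingType) n (p : {poly A}) x :
  hev n p x 0 = p`_n * x ^+ n.
Proof.
rewrite /hev big_ord_recr /= subnn expr0 mulr1 big1 ?add0r // => i _.
by rewrite expr0n subn_eq0 leqNgt ltn_ord mulr0.
Qed.

Lemma hev_map (A B : comNzRingType) (f : {rmorphism A -> B}) n p x y :
  f (hev n p x y) = hev n (map_poly f p) (f x) (f y).
Proof.
rewrite rmorph_sum; apply: eq_bigr => i _.
by rewrite coef_map !rmorphM !rmorphXn.
Qed.

Lemma hev_scale (A : comNzRingType) n (p : {poly A}) c x y :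
  hev n p (c * x) (c * y) = c ^+ n * hev n p x y.
Proof.
rewrite /hev mulr_sumr; apply: eq_bigr => i _.
rewrite -[in c ^+ n](@subnK i n) ?leq_ord // exprD !exprMn; ring.
Qed.

Lemma hevZ (A : comNzRingType) n (p : {poly A}) c x y :
  hev n (c *: p) x y = c * hev n p x y.
Proof. by rewrite mulr_sumr; apply: eq_bigr => i _; rewrite coefZ !mulrA. Qed.

Lemma hevD (A : comNzRingType) n (p q : {poly A}) x y :
  hev n (p + q) x y = hev n p x y + hev n q x y.
Proof. by rewrite -big_split; apply: eq_bigr => i _; rewrite coefD !mulrDl. Qed.

Lemma hev0 (A : comNzRingType) n (x y : A) : hev n 0 x y = 0.
Proof. by rewrite -[X in hev n X](scale0r 0) hevZ mul0r. Qed.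

Lemma hev_frac (F : fieldType) n (p : {poly F}) x y :
  (size p <= n.+1)%N -> y != 0 -> hev n p x y = y ^+ n * p.[x / y].
Proof.
move=> sp y0; by rewrite -(hev_x1 _ sp) -hev_scale mulr1 mulrC divfK.
Qed.

Lemma hevM_field (F : fieldType) n m (p q : {poly F}) x y :
  (size p <= n.+1)%N -> (size q <= m.+1)%N ->
  hev (n + m) (p * q) x y = hev n p x y * hev m q x y.
Proof.
move=> sp sq; have [-> | y0] := eqVneq y 0.
  rewrite !hev_x0 exprD mulrACA; congr (_ * _).
  rewrite coefM (bigD1 (inord n)) //= inordK ?ltnS ?leq_addr // addKn.
  rewrite big1 ?addr0 // => i /eqP ni; have [lt|ge] := ltnP i n.
    rewrite (nth_default _ (_ : size q <= _)%N) ?mulr0 //.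
    by apply: leq_trans sq _; lia.
  rewrite (nth_default _ (_ : size p <= _)%N) ?mul0r //.
  apply: leq_trans sp _; rewrite ltn_neqAle ge andbT; apply/eqP => e; apply: ni.
  by apply/val_inj; rewrite /= inordK ?ltnS ?leq_addr.
have spq : (size (p * q)%R <= (n + m).+1)%N.
  by apply: leq_trans (size_polyMleq _ _) _; lia.
by rewrite !hev_frac // hornerM exprD mulrACA.
Qed.

Lemma hevM (A : idomainType) n m (p q : {poly A}) x y :
  (size p <= n.+1)%N -> (size q <= m.+1)%N ->
  hev (n + m) (p * q) x y = hev n p x y * hev m q x y.
Proof.
move=> sp sq; apply/eqP; rewrite -tofrac_eq; apply/eqP.
rewrite rmorphM !hev_map rmorphM hevM_field //; apply: leq_trans (size_poly _ _) _ => //.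
Qed.

(** The polynomial q^n a(p/q), that is, the numerator of a composite before any cancellation.
    Homogenizing over the ring {poly F} avoids divisions and also covers q = 0. *)
Definition hcomp (F : fieldType) n (a p q : {poly F}) : {poly F} :=
  hev n (map_poly polyC a) p q.

Lemma hcomp_horner (F : fieldType) n (a p q : {poly F}) x :
  (hcomp n a p q).[x] = hev n a p.[x] q.[x].
Proof.
rewrite /hcomp -/(horner_eval x _) hev_map -map_poly_comp.
by rewrite (eq_map_poly (g := id)) ?map_poly_id // => c /=; rewrite /horner_eval hornerC.
Qed.

Lemma map_hcomp (F M : fieldType) (f : {rmorphism F -> M}) n (a p q : {poly F}) :
  map_poly f (hcomp n a p q) = hcomp n (map_poly f a) (map_poly f p) (map_poly f q).
Proof.
rewrite /hcomp hev_map; congr hev; rewrite -!map_poly_comp.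
by apply: eq_map_poly => c /=; rewrite map_polyC.
Qed.

Lemma hcomp_horner_frac (F : fieldType) n (a p q : {poly F}) x :
  (size a <= n.+1)%N -> q.[x] != 0 ->
  (hcomp n a p q).[x] = q.[x] ^+ n * a.[p.[x] / q.[x]].
Proof. by move=> sa qx; rewrite hcomp_horner hev_frac. Qed.

Lemma hcompM (F : fieldType) n m (a b p q : {poly F}) :
  (size a <= n.+1)%N -> (size b <= m.+1)%N ->
  hcomp (n + m) (a * b) p q = hcomp n a p q * hcomp m b p q.
Proof.
by move=> sa sb; rewrite /hcomp rmorphM hevM // (leq_trans (size_poly _ _)).
Qed.

Lemma hcompE (F : fieldType) n (a p q : {poly F}) :
  hcomp n a p q = \sum_(i < n.+1) a`_i *: (p ^+ i * q ^+ (n - i)).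
Proof.
by apply: eq_bigr => i _; rewrite coef_map /= -mulrA mul_polyC.
Qed.

Lemma size_exp_bound (F : fieldType) d (p : {poly F}) i :
  (size p <= d.+1)%N -> (size (p ^+ i)%R <= (i * d).+1)%N.
Proof.
move=> sp; apply: leq_trans (size_poly_exp_leq _ _) _.
by rewrite ltnS mulnC leq_mul //; lia.
Qed.

Lemma size_term (F : fieldType) n d i (p q : {poly F}) :
  (size p <= d.+1)%N -> (size q <= d.+1)%N -> (i <= n)%N ->
  (size (p ^+ i * q ^+ (n - i))%R <= (n * d).+1)%N.
Proof.
move=> sp sq le_in; apply: leq_trans (size_polyMleq _ _) _.
have := size_exp_bound i sp; have := size_exp_bound (n - i) sq.
have -> : (n * d = i * d + (n - i) * d)%N by rewrite -mulnDl subnKC.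
lia.
Qed.

Lemma size_hcomp (F : fieldType) n d (a p q : {poly F}) :
  (size p <= d.+1)%N -> (size q <= d.+1)%N ->
  (size (hcomp n a p q) <= (n * d).+1)%N.
Proof.
move=> sp sq; rewrite hcompE; apply: (leq_trans (size_sum _ _ _)).
apply/bigmax_leqP => i _; apply: leq_trans (size_scale_leq _ _) _.
by apply: size_term => //; exact: leq_ord.
Qed.

Lemma hevX (F : fieldType) i d (p : {poly F}) x y :
  (size p <= d.+1)%N -> hev (i * d) (p ^+ i) x y = hev d p x y ^+ i.
Proof.
move=> sp; elim: i => [|i IH].
  by rewrite mul0n /hev big_ord1 !expr0 coef1 !mulr1.
by rewrite mulSn !exprS hevM ?IH // size_exp_bound.
Qed.

Lemma hev_hcomp (F : fieldType) n d (a p q : {poly F}) x y :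
  (size p <= d.+1)%N -> (size q <= d.+1)%N ->
  hev (n * d) (hcomp n a p q) x y = hev n a (hev d p x y) (hev d q x y).
Proof.
move=> sp sq; rewrite hcompE [in RHS]/hev.
have -> (I : finType) (f : I -> {poly F}) N :
    hev N (\sum_i f i) x y = \sum_i hev N (f i) x y.
  exact: (big_morph (fun p => hev N p x y) (fun u v => hevD _ u v x y) (hev0 N x y)).
apply: eq_bigr => i _; rewrite hevZ -mulrA; congr (_ * _).
have -> : (n * d = i * d + (n - i) * d)%N by rewrite -mulnDl subnKC ?leq_ord.
by rewrite hevM ?size_exp_bound // !hevX.
Qed.

End HomogeneousEvaluation.

(** * Rational maps of the projective line *)

Section ProjectiveLine.
Variable F : fieldType.
Implicit Types p q : {poly F}.

Definition pt x : F * F := if x is Some u then (u, 1) else (1, 0).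

(* The point (a : b); the value at (0, 0) is junk. *)
Definition tp (a b : F) : option F := if b == 0 then None else Some (a / b).

Definition pmap n p q x : option F :=
  tp (hev n p (pt x).1 (pt x).2) (hev n q (pt x).1 (pt x).2).

(** As forms of degree n, p and q have no common zero, infinity included. In this form the condition
    passes to composites at once ([hcop_comp]); over an algebraically closed field it yields
    coprimality, and over any field it pins the degree down to n ([hcop_size]). *)
Definition hcop n p q : Prop :=
  [/\ (size p <= n.+1)%N, (size q <= n.+1)%N &
      forall x y : F, hev n p x y = 0 -> hev n q x y = 0 -> x = 0 /\ y = 0].

Lemma pt_neq0 x : ~ ((pt x).1 = 0 /\ (pt x).2 = 0).
Proof. by case: x => [u|] /= [] => [_|] /eqP; rewrite oner_eq0. Qed.

Lemma tp_scale c a b : c != 0 -> tp (c * a) (c * b) = tp a b.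
Proof.
move=> c0; rewrite /tp mulf_eq0 (negPf c0) /=; case: eqP => // _.
by rewrite -mulf_div divff // mul1r.
Qed.

Lemma tp_pt x : tp (pt x).1 (pt x).2 = x.
Proof. by case: x => [u|] /=; rewrite /tp ?eqxx // oner_eq0 divr1. Qed.

Lemma pt_tp a b : ~ (a = 0 /\ b = 0) ->
  exists2 c, c != 0 & a = c * (pt (tp a b)).1 /\ b = c * (pt (tp a b)).2.
Proof.
move=> ab0; rewrite /tp; case: (eqVneq b 0) => [b0|b0] /=.
  exists a; last by rewrite mulr1 mulr0 b0.
  by apply/eqP => a0; apply: ab0.
by exists b => //; rewrite mulr1 mulrC divfK.
Qed.

Lemma tp_eq a b c e : ~ (a = 0 /\ b = 0) -> ~ (c = 0 /\ e = 0) ->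
  tp a b = tp c e -> a * e = c * b.
Proof.
move=> /pt_tp [u _ +] /pt_tp [v _ +] E.
rewrite E; move: (pt _).1 (pt _).2 => w z [ea eb] [ec ee]; rewrite ea eb ec ee; ring.
Qed.

Lemma det_pt x y : x != y ->
  (pt x).1 * (pt y).2 - (pt x).2 * (pt y).1 != 0.
Proof.
case: x y => [u|] [v|] //= ne; rewrite ?mulr1 ?mul1r ?mulr0 ?mul0r ?subr0 ?sub0r //.
- by rewrite subr_eq0; apply: contraNneq ne => ->.
- by rewrite oppr_eq0 oner_eq0.
- by rewrite oner_eq0.
Qed.

Lemma hcop_pt n p q x : hcop n p q ->
  ~ (hev n p (pt x).1 (pt x).2 = 0 /\ hev n q (pt x).1 (pt x).2 = 0).
Proof. by case=> _ _ h [e1 e2]; apply: (@pt_neq0 x); apply: h. Qed.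

Lemma pmap_tp n p q a b : ~ (a = 0 /\ b = 0) ->
  pmap n p q (tp a b) = tp (hev n p a b) (hev n q a b).
Proof.
move=> /pt_tp [c c0]; move: (tp a b) => x [-> ->]; rewrite !hev_scale.
by rewrite tp_scale // expf_neq0.
Qed.

Lemma pmap_comp n d a b p q x : hcop d p q ->
  pmap n a b (pmap d p q x) = pmap (n * d) (hcomp n a p q) (hcomp n b p q) x.
Proof.
move=> h; rewrite {2}/pmap pmap_tp; last exact: hcop_pt h.
by case: h => sp sq _; rewrite /pmap !hev_hcomp.
Qed.

Lemma hcop_comp n d a b p q : hcop n a b -> hcop d p q ->
  hcop (n * d) (hcomp n a p q) (hcomp n b p q).
Proof.
move=> [sa sb hab] [sp sq hpq]; split; try exact: size_hcomp.
by move=> x y; rewrite !hev_hcomp // => e1 e2; have [] := hab _ _ e1 e2; exact: hpq.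
Qed.

Lemma hcop_coef n p q : hcop n p q -> p`_n != 0 \/ q`_n != 0.
Proof.
case=> _ _ /(_ 1 0); rewrite !hev_x0 !expr1n !mulr1 => h.
case: (eqVneq p`_n 0) => [e1|]; last by left.
case: (eqVneq q`_n 0) => [e2|]; last by right.
by case: (h e1 e2) => /eqP; rewrite oner_eq0.
Qed.

Lemma hcop_size n p q : hcop n p q -> maxn (size p) (size q) = n.+1.
Proof.
move=> h; have [sp sq _] := h; apply/eqP; rewrite eqn_leq geq_max sp sq /= leq_max.
case: (hcop_coef h) => c0.
  by rewrite ltnNge (contra_neqN _ c0) // => /(nth_default 0).
by rewrite orbC ltnNge (contra_neqN _ c0) // => /(nth_default 0).
Qed.

Lemma coprime_hcop n p q :
  coprimep p q -> maxn (size p) (size q) = n.+1 -> hcop n p q.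
Proof.
move=> cop sz.
have sp : (size p <= n.+1)%N by rewrite -sz leq_maxl.
have sq : (size q <= n.+1)%N by rewrite -sz leq_maxr.
split=> // x y; case: (eqVneq y 0) => [->|y0].
  rewrite !hev_x0 => /eqP; rewrite mulf_eq0 expf_eq0 => h1 /eqP.
  rewrite mulf_eq0 expf_eq0 => h2; split=> //; apply/eqP.
  case: (eqVneq x 0) => // x0; move: h1 h2; rewrite (negPf x0) !andbF !orbF.
  move=> /eqP p0 /eqP q0; move: sz; rewrite /maxn; case: ifP => _ e.
    move: q0 => /eqP; rewrite -[n]/n.+1.-1 -e -/(lead_coef q) lead_coef_eq0 => /eqP q0.
    by move: e; rewrite q0 size_poly0.
  move: p0 => /eqP; rewrite -[n]/n.+1.-1 -e -/(lead_coef p) lead_coef_eq0 => /eqP p0.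
  by move: e; rewrite p0 size_poly0.
rewrite !hev_frac // => /eqP; rewrite mulf_eq0 expf_eq0 (negPf y0) andbF /= => rp.
move=> /eqP; rewrite mulf_eq0 expf_eq0 (negPf y0) andbF /= => rq.
by have := coprimep_root cop rp; rewrite (eqP rq) eqxx.
Qed.

Definition lin (a b : F) : {poly F} := a *: 'X + b%:P.

Lemma size_lin a b : (size (lin a b) <= 2)%N.
Proof.
apply: leq_trans (size_polyD _ _) _; rewrite geq_max.
rewrite (leq_trans (size_scale_leq _ _)) ?size_polyX //.
by rewrite (leq_trans (size_polyC_leq1 _)).
Qed.

Lemma coef_lin a b : ((lin a b)`_0 = b) * ((lin a b)`_1 = a).
Proof. by rewrite !coefD !coefZ !coefX !coefC /= mulr0 mulr1 add0r addr0. Qed.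

Lemma hev_lin a b x y : hev 1 (lin a b) x y = a * x + b * y.
Proof.
by rewrite /hev big_ord_recl big_ord1 /= !coef_lin !expr0 !expr1 !mulr1 addrC.
Qed.

Lemma linE p : (size p <= 2)%N -> p = lin p`_1 p`_0.
Proof.
move=> sp; apply/polyP => -[|[|i]]; rewrite ?coef_lin //.
have sl := size_lin p`_1 p`_0.
by rewrite (nth_default _ (leq_trans sp _)) // (nth_default _ (leq_trans sl _)).
Qed.

Lemma hcop_lin a b c e : hcop 1 (lin a b) (lin c e) <-> a * e - b * c != 0.
Proof.
split=> [[_ _ h]|d0]; last first.
  split; try exact: size_lin.
  move=> x y; rewrite !hev_lin => e1 e2.
  have hx : (a * e - b * c) * x = 0.
    have -> : (a * e - b * c) * x = e * (a * x + b * y) - b * (c * x + e * y) by ring.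
    by rewrite e1 e2 !mulr0 subr0.
  have hy : (a * e - b * c) * y = 0.
    have -> : (a * e - b * c) * y = a * (c * x + e * y) - c * (a * x + b * y) by ring.
    by rewrite e1 e2 !mulr0 subr0.
  move: hx hy => /eqP + /eqP; rewrite !mulf_eq0 (negPf d0) /=.
  by move=> /eqP -> /eqP ->.
apply/eqP => d0.
have d1 : a * e = b * c by apply/eqP; rewrite -subr_eq0 d0.
have [] := h e (- c).
- by rewrite hev_lin mulrN d1 subrr.
- by rewrite hev_lin mulrN [c * e]mulrC subrr.
move=> e0 /eqP; rewrite oppr_eq0 => /eqP c0; rewrite {}e0 {}c0 in h.
have [] := h b (- a).
- by rewrite hev_lin mulrN [b * a]mulrC subrr.
- by rewrite hev_lin !mul0r addr0.
move=> b0 /eqP; rewrite oppr_eq0 => /eqP a0; rewrite {}b0 {}a0 in h.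
by have [] := h 1 1; rewrite ?hev_lin ?mul0r ?addr0 // => /eqP; rewrite oner_eq0.
Qed.

(** Rational maps are handled as functions on points, so that they compose with Frobenius maps in
    the ordinary sense; over an algebraically closed field [pmap_eq] and [hcop_eq] recover the
    coefficients up to a common scalar. *)
Definition is_rat n (f : option F -> option F) : Prop :=
  exists p q, hcop n p q /\ f =1 pmap n p q.

Lemma is_rat_comp n d f g :
  is_rat n f -> is_rat d g -> is_rat (n * d) (f \o g).
Proof.
move=> [a [b [hab ef]]] [p [q [hpq eg]]].
exists (hcomp n a p q), (hcomp n b p q); split; first exact: hcop_comp.
by move=> x; rewrite /= ef eg pmap_comp.
Qed.

Lemma is_rat_ext n f g : f =1 g -> is_rat n g -> is_rat n f.
Proof. by move=> e [a [b [h eg]]]; exists a, b; split=> // x; rewrite e eg. Qed.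

Definition mob a b c e : option F -> option F := pmap 1 (lin a b) (lin c e).

Lemma mobE a b c e x :
  mob a b c e x = tp (a * (pt x).1 + b * (pt x).2) (c * (pt x).1 + e * (pt x).2).
Proof. by rewrite /mob /pmap !hev_lin. Qed.

Lemma mob_is_rat a b c e : a * e - b * c != 0 -> is_rat 1 (mob a b c e).
Proof. by move=> /hcop_lin h; exists (lin a b), (lin c e). Qed.

Lemma is_ratP f : is_rat 1 f ->
  exists a b c e, a * e - b * c != 0 /\ f =1 mob a b c e.
Proof.
move=> [p [q [h ef]]]; have [sp sq _] := h; exists p`_1, p`_0, q`_1, q`_0.
rewrite (linE sp) (linE sq) in h ef; split=> //; exact/hcop_lin.
Qed.

Lemma mob_tp a b c e u v : ~ (u = 0 /\ v = 0) ->
  mob a b c e (tp u v) = tp (a * u + b * v) (c * u + e * v).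
Proof. by move=> uv; rewrite /mob pmap_tp // !hev_lin. Qed.

Lemma mobK a b c e : a * e - b * c != 0 -> cancel (mob a b c e) (mob e (- b) (- c) a).
Proof.
move=> d0 x; have /hcop_lin h := d0.
rewrite {2}/mob /pmap mob_tp; last exact: hcop_pt h.
rewrite !hev_lin -[RHS]tp_pt -[RHS](@tp_scale (a * e - b * c)) //.
by congr tp; ring.
Qed.

Lemma is_rat_inv f : is_rat 1 f ->
  exists g, [/\ is_rat 1 g, cancel f g & cancel g f].
Proof.
move=> /is_ratP [a [b [c [e [d0 ef]]]]]; exists (mob e (- b) (- c) a).
have d1 : e * a - - b * - c != 0 by rewrite mulrNN mulrC.
split; first exact: mob_is_rat.
  by move=> x; rewrite ef mobK.
by move=> x; rewrite ef -{2}(mobK d1 x) !opprK.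
Qed.

Lemma is_rat_id : is_rat 1 id.
Proof.
apply: (@is_rat_ext _ _ (mob 1 0 0 1)).
  by move=> x; rewrite mobE !mul1r !mul0r addr0 add0r tp_pt.
by apply: mob_is_rat; rewrite mulr1 mulr0 subr0 oner_eq0.
Qed.

Lemma mob_three x0 x1 xi : x0 != x1 -> x0 != xi -> x1 != xi ->
  exists f, [/\ is_rat 1 f, f (Some 0) = x0, f (Some 1) = x1 & f None = xi].
Proof.
move=> n01 n0i n1i; have ni0 : xi != x0 by rewrite eq_sym.
have n10 : x1 != x0 by rewrite eq_sym.
have ni1 : xi != x1 by rewrite eq_sym.
have := det_pt n10; have := det_pt ni1; have := det_pt ni0.
move eA: (_ - _ :> F) => A; move eB: (_ - _ :> F) => B; move eC: (_ - _ :> F) => C.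
move=> A0 B0 C0.
(* Cramer's rule for the determinants A = (xi, x0), B = (xi, x1), C = (x1, x0): A x1 = C xi + B x0.
   With the columns scaled by C and B, the point 1 therefore goes to x1. *)
exists (mob (C * (pt xi).1) (B * (pt x0).1) (C * (pt xi).2) (B * (pt x0).2)).
split.
- apply: mob_is_rat.
  suff -> : C * (pt xi).1 * (B * (pt x0).2) - B * (pt x0).1 * (C * (pt xi).2) = C * B * A.
    by rewrite !mulf_neq0.
  rewrite -eA; ring.
- by rewrite mobE /= !mulr0 !add0r !mulr1 tp_scale // tp_pt.
- rewrite mobE /= !mulr1 -[RHS]tp_pt -[RHS](@tp_scale A) //.
  by rewrite -eA -eB -eC; congr tp; ring.
- by rewrite mobE /= !mulr0 !addr0 !mulr1 tp_scale // tp_pt.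
Qed.

Lemma mob_fix f : is_rat 1 f -> f (Some 0) = Some 0 -> f (Some 1) = Some 1 ->
  f None = None -> f =1 id.
Proof.
move=> /is_ratP [a [b [c [e [d0 ef]]]]]; rewrite !ef !mobE /=.
rewrite !mulr0 !mulr1 !add0r !addr0 /tp.
case: (eqVneq e 0) => // e0 [] /eqP; rewrite mulf_eq0 invr_eq0 (negPf e0) orbF => /eqP b0.
case: (eqVneq (c + e) 0) => // ce0 [] ; case: (eqVneq c 0) => // c0 + _.
rewrite b0 c0 add0r addr0 => ae.
have {}ae : a = e by rewrite -[LHS](divfK e0) ae mul1r.
move=> x; rewrite ef mobE b0 c0 ae !mul0r addr0 add0r.
by rewrite tp_scale // tp_pt.
Qed.

End ProjectiveLine.

Section ClosedProjectiveLine.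
Variable L : closedFieldType.
Implicit Types (p q : {poly L}).

Lemma closed_root p : (1 < size p)%N -> exists x, root p x.
Proof. by move=> sp; apply/closed_rootP; rewrite neq_ltn sp orbT. Qed.

Lemma poly_vanish p : (forall x, p.[x] = 0) -> p = 0.
Proof.
move=> h; apply/eqP/negPn/negP => /closed_nonrootP [x].
by rewrite /root h eqxx.
Qed.

Lemma hcop_coprime n p q : hcop n p q -> coprimep p q.
Proof.
move=> [sp sq h]; rewrite /coprimep eqn_leq andbC lt0n size_poly_eq0 gcdp_eq0.
have nn : ~~ ((p == 0) && (q == 0)).
  apply/negP => /andP [/eqP p0 /eqP q0]; have := h 1 1.
  by rewrite p0 q0 !hev0 => -[] // /eqP; rewrite oner_eq0.
rewrite nn /= leqNgt; apply/negP => /closed_root [x].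
rewrite root_gcd => /andP [rp rq]; have := h x 1.
by rewrite !hev_x1 // (eqP rp) (eqP rq) => -[] // _ /eqP; rewrite oner_eq0.
Qed.

Lemma hcop_eq n m p q p' q' : hcop n p q -> hcop m p' q' -> p * q' = p' * q ->
  n = m /\ exists2 c, c != 0 & p' = c *: p /\ q' = c *: q.
Proof.
move=> h h' e; have cop := hcop_coprime h; have cop' := hcop_coprime h'.
suff [c c0 [ep eq]] : exists2 c, c != 0 & p' = c *: p /\ q' = c *: q.
  split; last by exists c.
  apply/eqP; rewrite -eqSS -(hcop_size h) -(hcop_size h') ep eq.
  by rewrite !size_scale.
have dp : p %= p'.
  rewrite /eqp -(Gauss_dvdpl _ cop) -e dvdp_mulr //=.
  by rewrite -(Gauss_dvdpl _ cop') e dvdp_mulr.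
have [p0 | p0] := eqVneq p 0.
  move: dp e cop cop'; rewrite p0 => /eqp_size; rewrite size_poly0 => /esym/eqP.
  rewrite size_poly_eq0 => /eqP -> _; rewrite !coprime0p.
  rewrite -!size_poly_eq1 => /eqP s1 /eqP s2.
  have e1 := size1_polyC (eq_leq s1); have e2 := size1_polyC (eq_leq s2).
  have q0 : q`_0 != 0 by apply: contra_eq_neq s1 => z; rewrite e1 z size_poly0.
  have q0' : q'`_0 != 0 by apply: contra_eq_neq s2 => z; rewrite e2 z size_poly0.
  exists (q'`_0 / q`_0); first by rewrite mulf_neq0 // invr_eq0.
  by rewrite scaler0 e1 e2 -mul_polyC -polyCM !coefC /= divfK.
rewrite eqp_sym in dp; have /eqpf_eq [c c0 ep] := dp.
exists c => //; split=> //; apply: (mulfI p0); rewrite e ep; by rewrite -scalerAl scalerAr.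
Qed.

Lemma pmap_eq n m p q p' q' : hcop n p q -> hcop m p' q' ->
  pmap n p q =1 pmap m p' q' -> p * q' = p' * q.
Proof.
move=> h h' e; apply/eqP; rewrite -subr_eq0; apply/eqP/poly_vanish => x.
have [sp sq _] := h; have [sp' sq' _] := h'.
have /tp_eq := e (Some x) => /(_ (hcop_pt h) (hcop_pt h')) /=.
by rewrite !hev_x1 // hornerD hornerN !hornerM => ->; rewrite subrr.
Qed.

End ClosedProjectiveLine.

(** * Frobenius-like bijections *)

Section FrobeniusPower.
Variables (A : comNzRingType) (p : nat) (pA : p \in [pchar A]) (e : nat).

(* The unused proof of p \in [pchar A] lets frp be a canonical ring morphism. *)
Definition frp of p \in [pchar A] := fun x : A => x ^+ (p ^ e).

Local Notation sigma := (frp pA).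

Lemma frp_is_nmod_morphism : nmod_morphism sigma.
Proof.
split=> [|x y]; rewrite /frp.
  by rewrite expr0n expn_eq0 eqn0Ngt prime_gt0 // (pcharf_prime pA).
apply: exprDn_pchar; apply/pnatP; first by rewrite expn_gt0 prime_gt0 // (pcharf_prime pA).
move=> r rp; rewrite Euclid_dvdX // => /andP [+ _].
by rewrite (dvdn_prime2 rp (pcharf_prime pA)) => /eqP ->.
Qed.

Lemma frp_is_monoid_morphism : monoid_morphism sigma.
Proof. by split=> [|x y]; rewrite /frp ?expr1n ?exprMn. Qed.

HB.instance Definition _ := GRing.isNmodMorphism.Build A A sigma frp_is_nmod_morphism.
HB.instance Definition _ := GRing.isMonoidMorphism.Build A A sigma frp_is_monoid_morphism.

End FrobeniusPower.

Arguments frp {A p} e pA.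

Section FrobeniusLike.
Variables (L : closedFieldType) (p : nat) (pL : p \in [pchar L]).
Local Notation sg e := (frp e pL).

Definition Fr e (x : option L) : option L := omap (sg e) x.

Lemma FrD e1 e2 x : Fr (e1 + e2) x = Fr e1 (Fr e2 x).
Proof. by case: x => //= u; rewrite /frp expnD mulnC exprM. Qed.

Lemma Fr0 x : Fr 0 x = x.
Proof. by case: x => //= u; rewrite /frp expn0 expr1. Qed.

Lemma Fr_tp e a b : Fr e (tp a b) = tp (sg e a) (sg e b).
Proof. by rewrite /tp fmorph_eq0; case: eqP => //= _; rewrite fmorph_div. Qed.

Lemma Fr_pmap e n a b x :
  Fr e (pmap n a b x) = pmap n (map_poly (sg e) a) (map_poly (sg e) b) (Fr e x).
Proof.
rewrite /pmap Fr_tp !hev_map.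
by case: x => [u|] /=; rewrite ?rmorph1 ?rmorph0.
Qed.

Lemma Fr_inj e : injective (Fr e).
Proof. by move=> [x|] [y|] //= [] /fmorph_inj ->. Qed.

Lemma Fr_surj e y : exists x, y = Fr e x.
Proof.
case: y => [y|]; last by exists None.
have q0 : (0 < p ^ e)%N by rewrite expn_gt0 prime_gt0 // (pcharf_prime pL).
have [|x] := @closed_root L ('X^(p ^ e) - y%:P); first by rewrite size_XnsubC.
rewrite /root hornerD hornerXn hornerN hornerC subr_eq0 => /eqP ex.
by exists (Some x); rewrite /= /frp ex.
Qed.

Lemma hcop_map_frp e n a b : hcop n a b ->
  hcop n (map_poly (sg e) a) (map_poly (sg e) b).
Proof.
move=> h; apply: coprime_hcop; first by rewrite coprimep_map (hcop_coprime h).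
by rewrite !size_map_poly (hcop_size h).
Qed.

Lemma is_rat_Fr e n f : is_rat n f ->
  exists2 f', is_rat n f' & forall x, Fr e (f x) = f' (Fr e x).
Proof.
move=> [a [b [h ef]]].
exists (pmap n (map_poly (sg e) a) (map_poly (sg e) b)).
  by exists (map_poly (sg e) a), (map_poly (sg e) b); split=> //; exact: hcop_map_frp.
by move=> x; rewrite ef Fr_pmap.
Qed.

Definition is_frob e (g : option L -> option L) : Prop :=
  exists2 f, is_rat 1 f & forall x, g x = f (Fr e x).

Lemma is_frob_inj e g : is_frob e g -> injective g.
Proof.
move=> [f /is_rat_inv [f' [_ fK _]] eg] x y.
by rewrite !eg => /(can_inj fK) /Fr_inj.
Qed.

Lemma is_frob_surj e g y : is_frob e g -> exists x, y = g x.
Proof.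
move=> [f /is_rat_inv [f' [_ _ fK]] eg]; have [x ex] := Fr_surj e (f' y).
by exists x; rewrite eg -ex fK.
Qed.

Lemma is_frob_comp e1 e2 g1 g2 :
  is_frob e1 g1 -> is_frob e2 g2 -> is_frob (e1 + e2) (g1 \o g2).
Proof.
move=> [f1 r1 E1] [f2 r2 E2]; have [f' r' E'] := is_rat_Fr e1 r2.
exists (f1 \o f'); first by rewrite -[1%N]/(1 * 1)%N; exact: is_rat_comp.
by move=> x; rewrite /= E1 E2 E' -FrD.
Qed.

Lemma is_frob_rat f : is_rat 1 f -> is_frob 0 f.
Proof. by move=> h; exists f => // x; rewrite Fr0. Qed.

Lemma is_frob_conj e g f f' :
  is_rat 1 f -> is_rat 1 f' -> is_frob e g -> is_frob e (f \o g \o f').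
Proof.
move=> r r' h; have -> : e = (0 + e + 0)%N by rewrite addn0.
apply: is_frob_comp (is_frob_rat r'); exact: is_frob_comp (is_frob_rat r) h.
Qed.

Lemma is_frob_iter e g n : is_frob e g -> is_frob (n * e) (iter n g).
Proof.
move=> h; elim: n => [|n IH]; first by apply: is_frob_rat; exact: is_rat_id.
by rewrite mulSn; apply: (is_frob_comp h).
Qed.

Lemma is_frob_fix e g : is_frob e g -> g (Some 0) = Some 0 -> g (Some 1) = Some 1 ->
  g None = None -> g =1 Fr e.
Proof.
move=> [f rf ef]; rewrite !ef /= rmorph0 rmorph1 => f0 f1 fi x.
by rewrite ef (mob_fix rf).
Qed.

Variables (k : closedFieldType) (kap : {rmorphism k -> L}).

(** Every finite subfield of L lies in the image of k. This is what turns commutation with a power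
    of Frobenius into constancy of the coefficients. *)
Definition constants_exhausted : Prop :=
  forall x n, (0 < n)%N -> sg n x = x -> exists c, x = kap c.

Hypothesis fixed_const : constants_exhausted.

Lemma poly_const (a : {poly L}) : (forall i, exists c, a`_i = kap c) ->
  exists a0, a = map_poly kap a0.
Proof.
move=> h; have [c ec] := fin_all_exists (fun i : 'I_(size a) => h i).
exists (\poly_(i < size a) oapp c 0 (insub i)); apply/polyP => i.
rewrite coef_map coef_poly; case: ltnP => lt; first by rewrite insubT /= -ec.
by rewrite [LHS]nth_default //= raddf0.
Qed.

Lemma commute_Fr d f e : (0 < e)%N -> is_rat d f ->
  (forall x, f (Fr e x) = Fr e (f x)) ->
  exists a b, hcop d (map_poly kap a) (map_poly kap b) /\
    f =1 pmap d (map_poly kap a) (map_poly kap b).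
Proof.
move=> e0 [a [b [h ef]]] com.
have h' := hcop_map_frp e h.
have E : pmap d a b =1 pmap d (map_poly (sg e) a) (map_poly (sg e) b).
  move=> y; have [x ->] := Fr_surj e y.
  by rewrite -Fr_pmap -!ef com.
have [_ [c c0 [ea eb]]] := hcop_eq h h' (pmap_eq h h' E).
have ca i : sg e a`_i = c * a`_i by rewrite -coefZ -ea coef_map.
have cb i : sg e b`_i = c * b`_i by rewrite -coefZ -eb coef_map.
(* One of the two coefficients in degree d is nonzero; dividing all coefficients by it removes the
   common factor [c] and makes them fixed by Frobenius. *)
have [u u0 fu] : exists2 u, u != 0 & sg e u = c * u.
  by case: (hcop_coef h) => n0; [exists a`_d | exists b`_d].
have E' x : sg e x = c * x -> exists c0, u^-1 * x = kap c0.
  move=> ex; apply: (fixed_const e0); rewrite rmorphM fmorphV /= ex fu invfM mulrACA mulVf //.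
  by rewrite mul1r.
have [a0 ea0] : exists a0, u^-1 *: a = map_poly kap a0.
  by apply: poly_const => i; rewrite coefZ; apply: E'.
have [b0 eb0] : exists b0, u^-1 *: b = map_poly kap b0.
  by apply: poly_const => i; rewrite coefZ; apply: E'.
have ui : u^-1 != 0 by rewrite invr_eq0.
exists a0, b0; rewrite -ea0 -eb0; split; last first.
  by move=> x; rewrite ef /pmap !hevZ tp_scale.
split; rewrite ?size_scale //; try by case: h.
by move=> x y; rewrite !hevZ => /eqP; rewrite mulf_eq0 (negPf ui) /= => /eqP h1
  /eqP; rewrite mulf_eq0 (negPf ui) /= => /eqP h2; case: h => _ _; apply.
Qed.

Definition constant_conj d (f : option L -> option L) : Prop :=
  exists u v a b, [/\ is_rat 1 u, is_rat 1 v, cancel u v, cancel v u &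
    hcop d (map_poly kap a) (map_poly kap b) /\
    forall x, v (f (u x)) = pmap d (map_poly kap a) (map_poly kap b) x].

Lemma constant_conj_conj d f u v : is_rat 1 u -> is_rat 1 v ->
  cancel u v -> cancel v u -> constant_conj d (v \o f \o u) -> constant_conj d f.
Proof.
move=> ru rv uK vK [u' [v' [a [b [ru' rv' uK' vK' [h e]]]]]].
exists (u \o u'), (v' \o v), a, b; split.
- by rewrite -[1%N]/(1 * 1)%N; exact: is_rat_comp.
- by rewrite -[1%N]/(1 * 1)%N; exact: is_rat_comp.
- by move=> x; rewrite /= uK uK'.
- by move=> x; rewrite /= vK' vK.
- by split=> // x; rewrite -e.
Qed.

(** An injective self-map of a finite set is a permutation, of finite order. The free multiplier [m]
    allows two such maps to be trivialized by the same exponent. *)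
Lemma iter_fixes (T : choiceType) (S : seq T) (g : T -> T) : injective g ->
  (forall x, x \in S -> g x \in S) ->
  exists2 n, (0 < n)%N & forall m x, x \in S -> iter (m * n) g x = x.
Proof.
move=> gI gS; pose G (x : seq_sub S) : seq_sub S := SeqSub (gS _ (ssvalP x)).
have GI : injective G by move=> x y /(congr1 val) /= /gI /val_inj.
have itG n x : val (iter n G x) = iter n g (val x).
  by elim: n => //= n ->.
exists (\prod_(x : seq_sub S) fingraph.order G x)%N.
  by rewrite prodn_gt0 // => x; exact: fingraph.order_gt0.
move=> m x xS; pose y := SeqSub xS.
have fixm j : iter (j * fingraph.order G y) G y = y.
  elim: j => // j IH; by rewrite mulSn iterD IH iter_order.
rewrite (bigD1 y) //= [X in (m * X)%N]mulnC mulnA.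
by rewrite -[x]/(val y) -itG fixm.
Qed.

(* Some power of g1 and of g2 fixes c0, c1 and ci, and so is the same power of
   Frobenius in the coordinate sending them to 0, 1 and infinity; f commutes with it. *)
Lemma three_point_rigidity d f g1 g2 e (S : seq (option L)) c0 c1 ci :
  (0 < e)%N -> is_rat d f -> is_frob e g1 -> is_frob e g2 ->
  (forall x, f (g1 x) = g2 (f x)) ->
  (forall x, x \in S -> g1 x \in S) -> (forall x, x \in S -> g2 x \in S) ->
  c0 \in S -> c1 \in S -> ci \in S -> c0 != c1 -> c0 != ci -> c1 != ci ->
  constant_conj d f.
Proof.
move=> e0 rf F1 F2 com S1 S2 s0 s1 si n01 n0i n1i.
have [u [ru u0 u1 ui]] := mob_three n01 n0i n1i.
have [v [rv uK vK]] := is_rat_inv ru.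
have [n1 n1_gt0 fix1] := iter_fixes (is_frob_inj F1) S1.
have [n2 n2_gt0 fix2] := iter_fixes (is_frob_inj F2) S2.
pose N := (n2 * n1)%N.
have comN n x : f (iter n g1 x) = iter n g2 (f x).
  by elim: n => //= n IH; rewrite com IH.
apply: (constant_conj_conj ru rv uK vK).
pose h g := v \o iter N g \o u.
have hFr g : is_frob e g -> (forall x, x \in S -> iter N g x = x) -> h g =1 Fr (N * e).
  move=> F fx; apply: is_frob_fix.
  - by apply: is_frob_conj => //; exact: is_frob_iter.
  - by rewrite /h /= u0 fx // -u0 uK.
  - by rewrite /h /= u1 fx // -u1 uK.
  - by rewrite /h /= ui fx // -ui uK.
have h1 := hFr _ F1 (fix1 n2).
have h2 : h g2 =1 Fr (N * e).
  by apply: hFr => //; rewrite /N mulnC; exact: fix2.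
have Ne : (0 < N * e)%N by rewrite !muln_gt0 n1_gt0 n2_gt0.
have rf' : is_rat d (v \o f \o u).
  rewrite -[d]mul1n -[(1 * d)%N]muln1.
  by apply: is_rat_comp => //; apply: is_rat_comp.
have [|a [b [hab E]]] := commute_Fr Ne rf'.
  by move=> x; rewrite -h1 -h2 /h /= !vK !comN.
exists id, id, a, b; split=> //; exact: is_rat_id.
Qed.

End FrobeniusLike.

(** * Fibres and branch points *)

Section Fibres.
Variable L : closedFieldType.

Lemma hev_comb n c1 c2 (a b : {poly L}) x y :
  hev n (c1 *: a - c2 *: b) x y = c1 * hev n a x y - c2 * hev n b x y.
Proof. by rewrite -scaleNr hevD !hevZ mulNr. Qed.

Definition roots_seq (q : {poly L}) : seq L := sval (closed_field_poly_normal q).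

Lemma roots_seqE (q : {poly L}) : q = lead_coef q *: \prod_(z <- roots_seq q) ('X - z%:P).
Proof. exact: (svalP (closed_field_poly_normal q)). Qed.

Lemma mem_roots_seq (q : {poly L}) x : q != 0 -> (x \in roots_seq q) = root q x.
Proof.
move=> q0; rewrite {2}(roots_seqE q) rootZ ?lead_coef_eq0 //.
by rewrite root_prod_XsubC.
Qed.

Lemma size_roots_seq (q : {poly L}) : q != 0 -> size q = (size (roots_seq q)).+1.
Proof.
by move=> q0; rewrite {1}(roots_seqE q) size_scale ?lead_coef_eq0 // size_prod_XsubC.
Qed.

Lemma separable_roots_seq (q : {poly L}) : q != 0 -> uniq (roots_seq q) = coprimep q q^`().
Proof.
move=> q0; have l0 : lead_coef q != 0 by rewrite lead_coef_eq0.
have E := roots_seqE q; move: (roots_seq q) E => r E.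
rewrite -separable_prod_XsubC unlock [in RHS]E derivZ.
by rewrite coprimepZl // coprimepZr.
Qed.

Variables (d : nat) (a b : {poly L}).
Hypotheses (d_gt0 : (0 < d)%N) (hab : hcop d a b).
Let f := pmap d a b.

Definition fibre_poly v : {poly L} := (pt v).2 *: a - (pt v).1 *: b.

Lemma hev_fibre v x : (hev d (fibre_poly v) (pt x).1 (pt x).2 == 0) = (f x == v).
Proof.
have nz := hcop_pt (x := x) hab; rewrite hev_comb /f /pmap.
move: (hev d a _ _) (hev d b _ _) nz => X Y nz; apply/eqP/eqP.
  have [c c0] := pt_tp nz; move: (tp X Y) => w [-> ->] e.
  apply/eqP; case: eqVneq => // /det_pt; rewrite -(inj_eq (mulfI c0)) mulr0.
  by case/eqP; rewrite -[RHS]e; ring.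
have [c c0] := pt_tp nz; move: (tp X Y) => w [-> ->] ->; ring.
Qed.

Lemma size_fibre v : (size (fibre_poly v) <= d.+1)%N.
Proof.
have [sa sb _] := hab; rewrite /fibre_poly -scaleNr.
apply: leq_trans (size_polyD _ _) _; rewrite geq_max.
by rewrite !(leq_trans (size_scale_leq _ _)).
Qed.

Lemma fibre_poly_neq0 v : fibre_poly v != 0.
Proof.
apply/eqP => e; have cop := hcop_coprime hab; have sz := hcop_size hab.
have fv x : f x = v by apply/eqP; rewrite -hev_fibre e hev0.
have /eqP f0 := fv None; have fa x := fv (Some x).
case: (leqP (size b) 1) => sb.
  have eb := size1_polyC sb; have sa : (1 < size a)%N.
    have : (1 < maxn (size a) (size b))%N by rewrite sz ltnS.
    by rewrite leq_max (ltnNge 1 (size b)) sb orbF.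
  have : b`_d = 0 by rewrite nth_default //; apply: leq_trans sb _.
  have := fv None; rewrite /f /pmap /= !hev_x0 !expr1n !mulr1 => + b0.
  rewrite b0 /tp eqxx => ev; have := fa 0; rewrite -ev /f /pmap /= /tp.
  case: eqP => // eb0 _; move: eb0; rewrite hev_x1; last by case: hab.
  rewrite eb hornerC => b00; move: cop; rewrite eb b00 coprimep0 /=.
  by rewrite -size_poly_eq1 => /eqP sa1; rewrite sa1 in sa.
have [x rx] := closed_root sb; have := fa x; rewrite /f /pmap /= !hev_x1; try by case: hab.
rewrite (eqP rx) /tp eqxx => ev.
have [y ry] : exists y, ~~ root b y by apply/closed_nonrootP; rewrite -size_poly_gt0 ltnW.
have := fa y; rewrite -ev /f /pmap /= !hev_x1; try by case: hab.
by rewrite /tp -/(root b y) (negPf ry).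
Qed.

(** A form of degree d vanishes at (1 : 0) exactly when its dehomogenization has degree below d;
    this is the test for [None]. Points are listed without multiplicity. *)
Definition fibre v : seq (option L) :=
  (if (size (fibre_poly v) <= d)%N then [:: None] else [::]) ++
  map Some (undup (roots_seq (fibre_poly v))).

Lemma mem_fibre v x : (x \in fibre v) = (f x == v).
Proof.
rewrite -hev_fibre mem_cat; case: x => [x|] /=; last first.
  rewrite hev_x0 expr1n mulr1; have nN (s : seq L) : (None \in map Some s) = false by apply/negP => /mapP [].
  rewrite nN orbF; have := size_fibre v; case: (leqP (size (fibre_poly v)) d) => [le _|gt le].
    by rewrite mem_head [X in X == _]nth_default ?eqxx.
  have sz : size (fibre_poly v) = d.+1 by apply/eqP; rewrite eqn_leq le gt.
  rewrite -[d]/d.+1.-1 -sz -/(lead_coef _) lead_coef_eq0.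
  by rewrite (negPf (fibre_poly_neq0 v)).
rewrite hev_x1 ?size_fibre // -/(root _ _) -mem_roots_seq ?fibre_poly_neq0 //.
rewrite mem_map; last by move=> ? ? [].
by rewrite mem_undup; case: ifP.
Qed.

Lemma uniq_fibre v : uniq (fibre v).
Proof.
rewrite cat_uniq map_inj_uniq ?undup_uniq ?andbT; last by move=> ? ? [].
apply/andP; split; first by case: ifP.
by apply/hasPn => x /mapP [y _ ->]; case: ifP.
Qed.

Lemma fibre_neq0 v : exists x, f x = v.
Proof.
have := size_fibre v; have := size_roots_seq (fibre_poly_neq0 v).
case: (leqP (size (fibre_poly v)) d) => [le _ _|gt e _].
  by exists None; apply/eqP; rewrite -mem_fibre mem_cat le inE.
case er : (roots_seq (fibre_poly v)) => [|x s].
  by move: gt d_gt0; rewrite e er /= => ? ?; lia.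
exists (Some x); apply/eqP; rewrite -mem_fibre mem_cat map_f ?orbT //.
by rewrite mem_undup er mem_head.
Qed.

Lemma size_fibre_lt v : ~~ coprimep (fibre_poly v) (fibre_poly v)^`() ->
  (size (fibre v) < d)%N.
Proof.
have q0 := fibre_poly_neq0 v.
rewrite -separable_roots_seq // -ltn_size_undup size_cat size_map => lt.
have := size_fibre v; rewrite (size_roots_seq q0); move: lt.
move: (size (undup _)) (size (roots_seq _)) => m n lt le.
case: (leqP n.+1 d) => /= le'; first by rewrite add1n (leq_ltn_trans lt le').
by rewrite add0n; exact: leq_trans lt _.
Qed.

Lemma size_fibre_eq v : size (fibre_poly v) = d.+1 ->
  coprimep (fibre_poly v) (fibre_poly v)^`() -> size (fibre v) = d.
Proof.
have q0 := fibre_poly_neq0 v; move=> sz.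
rewrite -separable_roots_seq // size_cat size_map sz ltnn /= => un.
by apply/eqP; rewrite undup_id // -eqSS -size_roots_seq // sz.
Qed.

(** The numerator of the derivative of a/b. It vanishes identically when the map is inseparable;
    otherwise its roots are the finite ramification points, finite poles included. *)
Definition wronskian : {poly L} := a^`() * b - a * b^`().

Hypothesis wronskian_neq0 : wronskian != 0.

(** The list of candidates makes the set finite, and [mem_branch] shows that it misses no value with
    a short fibre. The value at infinity is always a candidate because the Wronskian only sees
    finite points. Counting points, rather than ramification indices, is insensitive to wild
    ramification. *)
Definition branch : seq (option L) :=
  [seq v <- f None :: map (fun c => f (Some c)) (roots_seq wronskian) |
     (size (fibre v) < d)%N].

Lemma mem_branch v : (v \in branch) = (size (fibre v) < d)%N.
Proof.
rewrite mem_filter andb_idr // => lt; rewrite inE.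
case: (eqVneq v (f None)) => //= nv; apply: contraTT lt => nr; rewrite -leqNgt.
have sz : size (fibre_poly v) = d.+1.
  apply/eqP; rewrite eqn_leq size_fibre ltnNge; apply: contra nv => le.
  by rewrite eq_sym -mem_fibre mem_cat le inE.
rewrite size_fibre_eq //; apply/negPn/negP => ncop; case/negP: nr.
have [x] : exists x, root (gcdp (fibre_poly v) (fibre_poly v)^`()) x.
  apply/closed_rootP; exact: ncop.
rewrite root_gcd => /andP [r1 r2].
have fx : f (Some x) = v.
  by apply/eqP; rewrite -hev_fibre /= hev_x1 ?size_fibre.
apply/mapP; exists x => //; rewrite mem_roots_seq //.
have [sa sb _] := hab.
move: r1 r2; rewrite /root /fibre_poly derivB !derivZ !hornerE -fx /f /pmap /=.
have := hcop_pt (x := Some x) hab; rewrite /= !hev_x1 // => nz.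
have [c c0] := pt_tp nz; move: (tp _ _) => w [ea eb] _ /eqP e2.
rewrite ea eb -[X in _ == X](mulr0 c); apply/eqP.
rewrite -[in RHS]e2; ring.
Qed.

End Fibres.

Section Branch.
Variable L : closedFieldType.
Implicit Types (a b : {poly L}).

Lemma coefM_second (A : nzRingType) m n (u v : {poly A}) :
  (size u <= m.+2)%N -> (size v <= n.+2)%N ->
  (u * v)`_(m + n).+1 = u`_m.+1 * v`_n + u`_m * v`_n.+1.
Proof.
move=> su sv; rewrite coefM.
have mlt : (m < (m + n).+2)%N by rewrite ltnS leqW // leq_addr.
have mlt1 : (m.+1 < (m + n).+2)%N by rewrite !ltnS leq_addr.
rewrite (bigD1 (Ordinal mlt1)) //= (bigD1 (Ordinal mlt)) /=; last first.
  by rewrite -val_eqE /= neq_ltn leqnn.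
rewrite !subSS !addKn subSn ?leq_addr // addKn big1 ?addr0 // => i.
rewrite -!val_eqE /= => /andP [n1 n2].
have [lt|ge] := ltnP m.+1 i.
  by rewrite nth_default ?mul0r // (leq_trans su).
rewrite [X in _ * X]nth_default ?mulr0 // (leq_trans sv) //.
have {n1 n2 ge} lt : (i < m)%N.
  by rewrite ltn_neqAle n2 /= -ltnS ltn_neqAle n1.
by rewrite leq_subRL ?(leq_trans (leq_ord i)) // !addnS !ltnS -addSn leq_add2r.
Qed.

(** A finite root of the Wronskian gives a double root of a fibre polynomial. Without such a root
    the Wronskian is constant, so its coefficient in degree 2d - 2 > 0 vanishes; that coefficient
    measures ramification at infinity. *)
Lemma size_branch_gt0 n a b : hcop n.+2 a b -> wronskian a b != 0 ->
  exists v, (size (fibre n.+2 a b v) < n.+2)%N.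
Proof.
move=> hab W0; have [sa sb _] := hab; have d_gt0 : (0 < n.+2)%N by [].
have comm x : exists2 c, c != 0 & fibre_poly a b (pmap n.+2 a b x) =
    c *: (hev n.+2 b (pt x).1 (pt x).2 *: a - hev n.+2 a (pt x).1 (pt x).2 *: b).
  have := pt_tp (hcop_pt (x := x) hab); rewrite -/(pmap n.+2 a b x) => -[c c0].
  move: (pmap n.+2 a b x) => w [-> ->]; exists c^-1; first by rewrite invr_eq0.
  by rewrite /fibre_poly scalerBr !scalerA !mulKf.
case: (leqP (size (wronskian a b)) 1) => sW; last first.
  have [x] := closed_root sW; rewrite /wronskian /root !hornerE => /eqP rx.
  exists (pmap n.+2 a b (Some x)); apply: size_fibre_lt => //.
  have [c c0 ->] := comm (Some x); rewrite /= !hev_x1 // derivZ coprimepZl // coprimepZr //.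
  rewrite coprimep_def neq_ltn; apply/orP; right.
  apply: (@root_size_gt1 _ x).
    rewrite gcdp_eq0; apply/negP => /andP [/eqP z _].
    have := fibre_poly_neq0 d_gt0 hab (pmap n.+2 a b (Some x)).
    by have [c' c'0 ->] := comm (Some x); rewrite /= !hev_x1 // z scaler0 eqxx.
  rewrite root_gcd /root derivB !derivZ !hornerE; apply/andP; split; apply/eqP.
    by ring.
  by rewrite -[RHS]rx; ring.
exists (pmap n.+2 a b None); rewrite /fibre size_cat size_map.
have [c c0] := comm None; rewrite /= !hev_x0 !expr1n !mulr1 => e; rewrite e.
set h := (_ - _ : {poly L}) in e *.
have dsz (u : {poly L}) : (size u <= n.+3)%N -> (size u^`() <= n.+2)%N.
  move=> su; case: (eqVneq u 0) => [->|u0]; first by rewrite deriv0 size_poly0.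
  by rewrite -ltnS; apply: leq_trans su; exact: lt_size_deriv.
have h2 : h`_n.+2 = 0 by rewrite /h coefB !coefZ mulrC subrr.
(* Up to sign this is the coefficient of the Wronskian in degree 2d - 2: the integer factors d and d
   - 1 combine to 1, whatever the characteristic. So infinity counts at least twice in its fibre. *)
have h1 : h`_n.+1 = 0.
  have : (wronskian a b)`_(n + n.+1).+1 = 0.
    by rewrite nth_default // (leq_trans sW).
  rewrite /wronskian coefB (coefM_second (m := n) (n := n.+1)) //; last exact: dsz.
  rewrite addnS -addSn (coefM_second (m := n.+1) (n := n)) //; last exact: dsz.
  rewrite !coef_deriv /h coefB !coefZ => e0.
  apply: oppr_inj; rewrite oppr0 -[RHS]e0.
  rewrite -(mulr_natr a`_n.+2) -(mulr_natr a`_n.+1) -(mulr_natr b`_n.+2).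
  rewrite -(mulr_natr b`_n.+1) (mulrSr 1 n.+1); move: (n.+1%:R) (a`_n.+2) (a`_n.+1) (b`_n.+2) (b`_n.+1).
  by move=> N a2 a1 b2 b1; ring.
have sh : (size h <= n.+1)%N.
  apply/leq_sizeP => j; rewrite leq_eqVlt => /orP [/eqP <- //|].
  rewrite leq_eqVlt => /orP [/eqP <- //|lt]; rewrite nth_default //.
  apply: leq_trans lt; have := size_fibre hab (pmap n.+2 a b None).
  by rewrite e size_scale.
have fp0 := fibre_poly_neq0 (isT : (0 < n.+2)%N) hab (pmap n.+2 a b None).
rewrite size_scale // (leq_trans sh) //= add1n ltnS.
apply: leq_ltn_trans (size_undup _) _; rewrite -ltnS -size_roots_seq; last by rewrite -e.
by rewrite size_scale.
Qed.

Lemma size_fibre_conj d a b a' b' u v w : (0 < d)%N -> hcop d a b -> hcop d a' b' ->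
  injective u -> (forall x, pmap d a b x = w -> pmap d a' b' (u x) = v) ->
  (size (fibre d a b w) <= size (fibre d a' b' v))%N.
Proof.
move=> d0 h h' uI uf; rewrite -(size_map u); apply: uniq_leq_size.
  by rewrite map_inj_uniq // uniq_fibre.
move=> y /mapP [x + ->]; rewrite !mem_fibre // => /eqP /uf ->; exact: eqxx.
Qed.

End Branch.

(** * Rigidity of maps intertwining Frobenius-like bijections *)

Section ClosedSubfield.
Variables (L k : closedFieldType) (kap : {rmorphism k -> L}).

Lemma root_map_const (q : {poly k}) x :
  q != 0 -> root (map_poly kap q) x -> exists z, x = kap z.
Proof.
move=> q0; rewrite (roots_seqE q) map_polyZ rootZ ?fmorph_eq0 ?lead_coef_eq0 //.
rewrite rmorph_prod /=; under eq_bigr do rewrite rmorphB /= map_polyX map_polyC /=.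
rewrite -(big_map kap xpredT (fun z => 'X - z%:P)) root_prod_XsubC.
by move=> /mapP [z _ ->]; exists z.
Qed.

Lemma uniq_seq_closed n : exists s : seq k, uniq s /\ size s = n.
Proof.
elim: n => [|n [s [us ss]]]; first by exists [::].
case: (leqP n 0) => [n0|n_gt0].
  by exists [:: 0]; split=> //; move: n0; rewrite leqn0 => /eqP ->.
have sz : size (\prod_(z <- s) ('X - z%:P)) = n.+1 by rewrite size_prod_XsubC ss.
have [|x rx] := @closed_root k (\prod_(z <- s) ('X - z%:P) + 1).
  by rewrite size_polyDl sz ?size_poly1 ltnS.
exists (x :: s); split; rewrite /= ?ss //; rewrite us andbT.
apply/negP; rewrite -root_prod_XsubC => /eqP r0.
by move: rx; rewrite /root hornerD r0 add0r hornerC oner_eq0.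
Qed.

Lemma poly_vanish_const (q : {poly L}) : (forall z, q.[kap z] = 0) -> q = 0.
Proof.
move=> h; apply/eqP/negPn/negP => q0.
have [s [us ss]] := uniq_seq_closed (size q).
have /(max_poly_roots q0) : all (root q) (map kap s).
  by apply/allP => _ /mapP [z _ ->]; rewrite /root h.
by rewrite map_inj_uniq ?us //; [rewrite size_map ss ltnn => /(_ isT) | exact: fmorph_inj].
Qed.

(* The condition that the translate of kap q by w be defined over k up to an
   additive constant is polynomial in w, so one w outside kap k forces it for
   every w in kap k, making q - q(0) additive. *)
Lemma additive_of_transcendental (q r : {poly k}) w m :
  (forall z, w <> kap z) ->
  (forall x, (map_poly kap q).[x + w] = (map_poly kap r).[x] + m) ->
  forall x y, (map_poly kap q).[x + y] =
    (map_poly kap q).[x] + (map_poly kap q).[y] - (map_poly kap q).[0].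
Proof.
move=> wk h.
have hm0 (u : {poly k}) : (map_poly kap u).[0] = kap u.[0].
  by rewrite -horner_map rmorph0.
have step z y : q.[y + z] = q.[y] + q.[z] - q.[0].
  pose t := q \Po ('X + z%:P) - q - (r.[z] - r.[0])%:P.
  have t0 : t = 0.
    apply/eqP/negPn/negP => t0; suff rt : root (map_poly kap t) w.
      by have [z0 /wk] := root_map_const t0 rt.
    rewrite /root !rmorphB /= map_comp_poly rmorphD /= map_polyX !map_polyC /= !hornerE.
    rewrite horner_comp !hornerE addrC [w + _]addrC h.
    have := h 0; rewrite add0r => ->.
    by rewrite hm0 !horner_map /=; apply/eqP; ring.
  have e u : q.[u + z] - q.[u] = r.[z] - r.[0].
    have : t.[u] = 0 by rewrite t0 horner0.
    by rewrite /t !hornerE horner_comp !hornerE => /eqP; rewrite subr_eq0 => /eqP.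
  have := e 0; rewrite add0r -(e y) => e0.
  by rewrite -addrA e0; ring.
(* A polynomial over L that vanishes on the infinite field k is zero, so the identity extends from k
   to L one variable at a time. *)
move=> x y; have stepL z : (map_poly kap q).[x + kap z] =
    (map_poly kap q).[x] + (map_poly kap q).[kap z] - (map_poly kap q).[0].
  pose t := map_poly kap q \Po ('X + (kap z)%:P) - map_poly kap q -
    ((map_poly kap q).[kap z] - (map_poly kap q).[0])%:P.
  suff t0 : t = 0.
    have : t.[x] = 0 by rewrite t0 horner0.
    rewrite /t !hornerE horner_comp !hornerE => /eqP; rewrite subr_eq0 => /eqP e.
    by rewrite -addrA -e; ring.
  apply: poly_vanish_const => z1; rewrite /t !hornerE horner_comp !hornerE.
  by rewrite hm0 -rmorphD !horner_map step /= rmorphB rmorphD /=; ring.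
pose t := map_poly kap q \Po ('X + x%:P) - map_poly kap q -
    ((map_poly kap q).[x] - (map_poly kap q).[0])%:P.
suff t0 : t = 0.
  have : t.[y] = 0 by rewrite t0 horner0.
  rewrite /t !hornerE horner_comp !hornerE [y + x]addrC => /eqP; rewrite subr_eq0 => /eqP e.
  by rewrite addrAC -e; ring.
apply: poly_vanish_const => z; rewrite /t !hornerE horner_comp !hornerE.
by rewrite [_ + x]addrC stepL; ring.
Qed.

End ClosedSubfield.

(** * Maps conjugate to z^d or z^-d *)

Section Exceptional.
Variables (L k : closedFieldType) (kap : {rmorphism k -> L}).
Implicit Types (a b : {poly L}).

Lemma hev_monomial n c (x y : L) : hev n (c *: 'X^n) x y = c * x ^+ n.
Proof.
rewrite hevZ /hev big_ord_recr /= subnn expr0 mulr1 coefXn eqxx mul1r.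
rewrite big1 ?add0r // => i _; rewrite coefXn.
by rewrite (ltn_eqF (ltn_ord i)) !mul0r.
Qed.

Lemma hev_const n c (x y : L) : hev n c%:P x y = c * y ^+ n.
Proof.
rewrite /hev big_ord_recl /= coefC eqxx expr0 mulr1 subn0 big1 ?addr0 // => i _.
by rewrite coefC /= !mul0r.
Qed.

Lemma hev_one n (x y : L) : hev n 1 x y = y ^+ n.
Proof. by rewrite (_ : 1 = 1%:P) // hev_const mul1r. Qed.

Lemma hev_Xn n (x y : L) : hev n 'X^n x y = x ^+ n.
Proof. by rewrite -['X^n]scale1r hev_monomial mul1r. Qed.

Lemma nth_root n (c : L) : (0 < n)%N -> exists x, x ^+ n = c.
Proof.
move=> n0; have [|x] := @closed_root L ('X^n - c%:P); first by rewrite size_XnsubC.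
by rewrite /root !hornerE subr_eq0 => /eqP; exists x.
Qed.

Lemma scaling (l : L) : l != 0 ->
  [/\ is_rat 1 (mob l 0 0 1), is_rat 1 (mob l^-1 0 0 1),
      cancel (mob l 0 0 1) (mob l^-1 0 0 1) & cancel (mob l^-1 0 0 1) (mob l 0 0 1)].
Proof.
move=> l0; have li : l^-1 != 0 by rewrite invr_eq0.
have r (m : L) : m != 0 -> is_rat 1 (mob m 0 0 1).
  by move=> m0; apply: mob_is_rat; rewrite mulr1 mulr0 subr0.
have K (m : L) : m != 0 -> cancel (mob m 0 0 1) (mob m^-1 0 0 1).
  move=> m0 x; rewrite (mobE m) mob_tp.
    by rewrite !mul0r !add0r !addr0 !mul1r mulKf // tp_pt.
  rewrite !mul0r addr0 add0r mul1r => -[/eqP]; rewrite mulf_eq0 (negPf m0) /=.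
  by move=> /eqP e1 e2; apply: (@pt_neq0 _ x).
split; [exact: r | exact: r | exact: K |].
by have := K _ li; rewrite invrK.
Qed.

Lemma mob_scale (l x y : L) : l != 0 -> ~ (x = 0 /\ y = 0) ->
  mob l 0 0 1 (tp x y) = tp (l * x) y.
Proof. by move=> l0 h; rewrite mob_tp // !mul0r addr0 add0r mul1r. Qed.

Lemma hcop_monomial d : (0 < d)%N ->
  hcop d (map_poly kap 'X^d) (map_poly kap 1) /\
  hcop d (map_poly kap 1) (map_poly kap 'X^d).
Proof.
move=> d0; rewrite map_polyXn rmorph1; split; (apply: coprime_hcop;
  rewrite ?coprimep1 ?coprime1p // size_polyXn size_poly1).
  by apply/maxn_idPl; rewrite ltnS.
by apply/maxn_idPr; rewrite ltnS.
Qed.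

Lemma power_conj d c f : (1 < d)%N -> c != 0 ->
  f =1 pmap d (c *: 'X^d) 1 -> constant_conj kap d f.
Proof.
(* Conjugation by z -> l z changes c z^d into c l^(d-1) z^d. *)
move=> d1 c0 ef; have [l el] : exists l : L, l ^+ d.-1 = c^-1 by apply: nth_root; lia.
have l0 : l != 0.
  apply: contra_eq_neq el => ->; rewrite expr0n eq_sym.
  by case: d d1 {ef} => [|[|d]] //= _; rewrite invr_eq0.
have [ru rv uK vK] := scaling l0; have li : l^-1 != 0 by rewrite invr_eq0.
exists (mob l 0 0 1), (mob l^-1 0 0 1), 'X^d, 1; split=> //.
split=> [|x]; first by have [] := hcop_monomial (ltnW d1).
have nz := @pt_neq0 _ x.
have nz' : ~ (l * (pt x).1 = 0 /\ (pt x).2 = 0).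
  by move=> [/eqP]; rewrite mulf_eq0 (negPf l0) => /eqP ? ?; apply: nz.
rewrite map_polyXn rmorph1 -{1}(tp_pt x) mob_scale // ef pmap_tp //.
rewrite hev_monomial hev_one mob_scale //; last first.
  move=> [/eqP]; rewrite mulf_eq0 (negPf c0) expf_eq0 => /andP [_ /eqP e1] /eqP.
  by rewrite expf_eq0 => /andP [_ /eqP e2]; apply: nz'.
rewrite /pmap hev_one hev_Xn; congr tp.
have -> : d = d.-1.+1 by lia.
by rewrite exprMn !exprS [l ^+ _]el; field; rewrite l0 c0.
Qed.

Lemma power_inv_conj d c f : (1 < d)%N -> c != 0 ->
  f =1 pmap d c%:P 'X^d -> constant_conj kap d f.
Proof.
(* Conjugation by z -> l z changes c z^-d into c l^-(d+1) z^-d. *)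
move=> d1 c0 ef; have [l el] : exists l : L, l ^+ d.+1 = c by apply: nth_root.
have l0 : l != 0.
  by apply: contra_neq c0 => l0; rewrite -el l0 expr0n.
have [ru rv uK vK] := scaling l0; have li : l^-1 != 0 by rewrite invr_eq0.
exists (mob l 0 0 1), (mob l^-1 0 0 1), 1, 'X^d; split=> //.
split=> [|x]; first by have [] := hcop_monomial (ltnW d1).
have nz := @pt_neq0 _ x.
have nz' : ~ (l * (pt x).1 = 0 /\ (pt x).2 = 0).
  by move=> [/eqP]; rewrite mulf_eq0 (negPf l0) => /eqP ? ?; apply: nz.
rewrite map_polyXn rmorph1 -{1}(tp_pt x) mob_scale // ef pmap_tp //.
rewrite hev_Xn hev_const mob_scale //; last first.
  move=> [/eqP]; rewrite mulf_eq0 (negPf c0) expf_eq0 => /andP [_ /eqP e1] /eqP.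
  by rewrite expf_eq0 => /andP [_ /eqP e2]; apply: nz'.
rewrite /pmap hev_one hev_Xn.
rewrite -[RHS](@tp_scale _ (l ^+ d)) ?expf_neq0 // exprMn -el; congr tp.
by rewrite exprS; field.
Qed.

Lemma poly_single_root (q : {poly L}) : q != 0 -> (forall z, root q z -> z = 0) ->
  q = lead_coef q *: 'X^((size q).-1).
Proof.
move=> q0 h; rewrite {1}(roots_seqE q); congr (_ *: _).
have -> : \prod_(z <- roots_seq q) ('X - z%:P) = \prod_(z <- roots_seq q) 'X.
  rewrite big_seq [RHS]big_seq; apply: eq_bigr => z.
  by rewrite mem_roots_seq // => /h ->; rewrite subr0.
by rewrite big_const_seq count_predT (size_roots_seq q0) iter_mulr_1.
Qed.

Lemma third_point (x y : option L) : exists z, z != x /\ z != y.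
Proof.
pose s : seq (option L) := [:: None; Some 0; Some 1].
have us : uniq s by rewrite /= !inE /= andbT; apply/eqP => -[] /eqP; rewrite eq_sym oner_eq0.
case: (boolP (has (fun z => (z != x) && (z != y)) s)) => [/hasP [z _ /andP []]|].
  by exists z.
move=> /hasPn h; have sub : {subset s <= [:: x; y]}.
  by move=> z /h; rewrite !inE; case: eqP => //= _; case: eqP.
by have := uniq_leq_size us sub.
Qed.

(** With [c0] at 0 and [ci] at infinity, the hypothesis confines all zeros of f to one of these
    points and all poles to the other. One of numerator and denominator is then constant and the
    other is a monomial. *)
Lemma two_point_conj d f c0 ci : (1 < d)%N -> is_rat d f -> c0 != ci ->
  (forall x, f x = c0 -> x = c0) /\ (forall x, f x = ci -> x = ci) \/
  (forall x, f x = c0 -> x = ci) /\ (forall x, f x = ci -> x = c0) ->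
  constant_conj kap d f.
Proof.
move=> d1 rf n0i hf; have [c1 [n10 n1i]] := third_point c0 ci.
have n01 : c0 != c1 by rewrite eq_sym.
have [u [ru u0 _ ui]] := mob_three n01 n0i n1i.
have [v [rv uK vK]] := is_rat_inv ru.
apply: (constant_conj_conj ru rv uK vK).
have rf' : is_rat d (v \o f \o u).
  rewrite -[d]mul1n -[(1 * d)%N]muln1.
  by apply: is_rat_comp => //; apply: is_rat_comp.
have [a [b [hab ef]]] := rf'.
have d0 := ltnW d1; have sz := hcop_size hab; have [sa sb _] := hab.
have fE (y z : option L) c c' : (forall x, f x = c -> x = c') -> v c = y -> v c' = z ->
    forall x, pmap d a b x = y -> x = z.
  move=> h ey ez x; rewrite -ef /= -ey -ez => /(can_inj vK) /h <-; by rewrite uK.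
have v0 : v c0 = Some 0 by rewrite -u0 uK.
have vi : v ci = None by rewrite -ui uK.
have cst (q : {poly L}) : q != 0 -> (forall z, ~~ root q z) -> q = (q`_0)%:P.
  move=> q0 h; apply: size1_polyC; rewrite leqNgt; apply/negP => /closed_root [z].
  by apply/negP.
have evb z : root b z -> pmap d a b (Some z) = None.
  by move=> /eqP rb; rewrite /pmap /= !hev_x1 // rb /tp eqxx.
have eva z : root a z -> b.[z] != 0 -> pmap d a b (Some z) = Some 0.
  by move=> /eqP ra bz; rewrite /pmap /= !hev_x1 // ra /tp (negPf bz) mul0r.
have a_cop z : root a z -> b.[z] != 0.
  by apply: coprimep_root; exact: hcop_coprime hab.
case: hf => -[h0 hi].
  have H0 := fE _ _ _ _ h0 v0 v0; have Hi := fE _ _ _ _ hi vi vi.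
  have b0 : b != 0 by apply/eqP => b0; have := Hi (Some 0); rewrite evb ?b0 ?root0 // => /(_ erefl).
  have eb := cst b b0 (fun z => introN idP (fun r => ltac:(by have := Hi _ (evb z r)))).
  have bb0 : b`_0 != 0 by apply: contra_neq b0 => z; rewrite eb z.
  have sb1 : size b = 1 by rewrite eb size_polyC bb0.
  have sza : size a = d.+1.
    by move: sz; rewrite sb1; move: (size a) => m; rewrite /maxn; case: ifP; lia.
  have a0 : a != 0 by rewrite -size_poly_eq0 sza.
  have ea : a = lead_coef a *: 'X^d.
    rewrite {1}(poly_single_root a0) ?sza // => z rz.
    by have [] := H0 _ (eva z rz (a_cop z rz)).
  apply: (@power_conj d (lead_coef a / b`_0)) => //.
    by rewrite mulf_neq0 ?invr_eq0 ?lead_coef_eq0.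
  move=> x; rewrite ef {1}ea {1}eb /pmap hev_one hev_const !hev_monomial.
  rewrite -[RHS](@tp_scale _ b`_0) //; congr tp; by field.
have H0 := fE _ _ _ _ h0 v0 vi; have Hi := fE _ _ _ _ hi vi v0.
have a0 : a != 0.
  apply/eqP => a0; have := H0 (Some 0); rewrite eva ?a0 ?root0 // => [/(_ erefl) //|].
  by apply: a_cop; rewrite a0 root0.
have ea := cst a a0 (fun z => introN idP (fun r => ltac:(by have := H0 _ (eva z r (a_cop z r))))).
have aa0 : a`_0 != 0 by apply: contra_neq a0 => z; rewrite ea z.
have sa1 : size a = 1 by rewrite ea size_polyC aa0.
have szb : size b = d.+1.
  by move: sz; rewrite sa1; move: (size b) => m; rewrite /maxn; case: ifP; lia.
have b0 : b != 0 by rewrite -size_poly_eq0 szb.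
have eb : b = lead_coef b *: 'X^d.
  rewrite {1}(poly_single_root b0) ?szb // => z rz.
  by have [] := Hi _ (evb z rz).
have lb : lead_coef b != 0 by rewrite lead_coef_eq0.
apply: (@power_inv_conj d (a`_0 / lead_coef b)) => //.
  by rewrite mulf_neq0 ?invr_eq0.
move=> x; rewrite ef {1}ea {1}eb /pmap hev_Xn !hev_const hev_monomial.
rewrite -[RHS](@tp_scale _ (lead_coef b)) //; congr tp; by field.
Qed.

End Exceptional.

(** * Polynomials with constant nonzero derivative *)

Section Rigidity.
Variables (L k : closedFieldType) (kap : {rmorphism k -> L}).
Variables (p : nat) (pL : p \in [pchar L]).
Hypothesis fixed_const : constants_exhausted pL kap.
Implicit Types (a b : {poly L}).

Lemma is_frob_affine e g : is_frob pL e g -> g None = None ->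
  exists A B, A != 0 /\ forall x, g (Some x) = Some (A * frp e pL x + B).
Proof.
move=> [f /is_ratP [a [b [c [d [d0 ef]]]]] eg].
rewrite eg /= ef mobE /= !mulr1 !mulr0 !addr0 /tp; case: eqP => // c0 _.
rewrite c0 mulr0 subr0 mulf_eq0 negb_or in d0; case/andP: d0 => a0 d0.
exists (a / d), (b / d); split; first by rewrite mulf_neq0 ?invr_eq0.
move=> x; rewrite eg ef mobE /= c0 mul0r add0r !mulr1 /tp (negPf d0).
by rewrite mulrDl mulrAC.
Qed.

(* Lang's theorem for the group of affine maps. *)
Lemma affine_frobenius_normalize e (A B : L) : (0 < e)%N -> A != 0 -> exists l m, l != 0 /\
  forall x, A * frp e pL (l * x + m) + B = l * frp e pL x + m.
Proof.
move=> e0 A0; have p_gt1 := prime_gt1 (pcharf_prime pL).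
have q1 : (1 < p ^ e)%N by rewrite -(expn0 p) ltn_exp2l.
(* The two equations to solve are A l^q = l with l nonzero, and then A m^q + B = m. *)
have [l el] : exists l : L, l ^+ (p ^ e).-1 = A^-1 by apply: nth_root; lia.
have l0 : l != 0.
  apply: contra_eq_neq el => ->; rewrite expr0n eq_sym.
  have -> : ((p ^ e).-1 == 0)%N = false by apply/eqP; lia.
  by rewrite invr_eq0.
have [|m] := @closed_root L (A *: 'X^(p ^ e) - 'X + B%:P).
  have sX : size (A *: 'X^(p ^ e)) = (p ^ e).+1 by rewrite size_scale // size_polyXn.
  rewrite -addrA size_polyDl sX ?ltnS ?(ltnW q1) //.
  apply: leq_trans (size_polyD _ _) _; rewrite size_polyN size_polyX.
  by rewrite geq_max q1 (leq_trans (size_polyC_leq1 _)) // ltnW.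
rewrite /root !hornerE => /eqP em; exists l, m; split=> // x.
have el' : A * frp e pL l = l.
  rewrite /frp; have -> : (p ^ e = (p ^ e).-1.+1)%N by lia.
  by rewrite exprS el mulrCA divff ?mulr1.
rewrite rmorphD rmorphM /= mulrDr mulrA el' -[RHS]addr0 -[in RHS]em /frp.
by ring.
Qed.

(** Read in the coordinate (l1, m1) at the source and (l2, m2) at the target, both Frobenius-like
    maps become Frobenius, so P commutes with it and has fixed coefficients. *)
Lemma frobenius_semiconj_const e (P : {poly L}) A1 B1 A2 B2 l1 m1 l2 m2 : (0 < e)%N -> l2 != 0 ->
  (forall x, A1 * frp e pL (l1 * x + m1) + B1 = l1 * frp e pL x + m1) ->
  (forall x, A2 * frp e pL (l2 * x + m2) + B2 = l2 * frp e pL x + m2) ->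
  (forall x, P.[A1 * frp e pL x + B1] = A2 * frp e pL P.[x] + B2) ->
  exists q, P \Po (l1 *: 'X + m1%:P) = l2 *: map_poly kap q + m2%:P.
Proof.
move=> e0 l20 h1 h2 hP.
pose psi := l2^-1 *: (P \Po (l1 *: 'X + m1%:P) - m2%:P).
have psiE x : P.[l1 * x + m1] = l2 * psi.[x] + m2.
  rewrite /psi hornerZ hornerD hornerN hornerC horner_comp mulVKf // subrK.
  by rewrite !hornerE.
have psi_frp x : psi.[frp e pL x] = frp e pL psi.[x].
  have := psiE (frp e pL x); rewrite -h1 hP psiE h2 => /addIr /(mulfI l20) ->.
  by [].
have [q eq] : exists q, psi = map_poly kap q.
  suff E : map_poly (frp e pL) psi = psi.
    by apply: poly_const => i; apply: (fixed_const e0); rewrite -coef_map E.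
  apply/eqP; rewrite -subr_eq0; apply/eqP/poly_vanish => y.
  have [[x|]] // := Fr_surj pL e (Some y); case=> ->.
  by rewrite hornerD hornerN horner_map psi_frp subrr.
exists q; rewrite -eq /psi scalerA divff // scale1r subrK //.
Qed.

Lemma is_rat_affine (l m : L) : l != 0 -> exists u v,
  [/\ is_rat 1 u, is_rat 1 v, cancel u v, cancel v u &
      u None = None /\ forall x, u (Some x) = Some (l * x + m)].
Proof.
move=> l0; have ru : is_rat 1 (mob l m 0 1).
  by apply: mob_is_rat; rewrite mulr1 mulr0 subr0.
have [v [rv uK vK]] := is_rat_inv ru; exists (mob l m 0 1), v; split=> //.
by split=> [|x]; rewrite mobE /= ?mulr1 ?mulr0 ?mul0r ?add0r ?addr0 /tp ?eqxx ?oner_eq0 ?divr1.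
Qed.

Lemma pmap_poly d (P : {poly L}) : (0 < d)%N -> size P = d.+1 ->
  pmap d P 1 None = None /\ forall x, pmap d P 1 (Some x) = Some P.[x].
Proof.
move=> d0 sP; rewrite /pmap /=; split=> [|x].
  by rewrite !hev_x0 coef1 gtn_eqF // mul0r /tp eqxx.
by rewrite !hev_x1 ?sP ?size_poly1 // hornerC /tp oner_eq0 divr1.
Qed.

Lemma hcop_poly d (P : {poly L}) : size P = d.+1 -> hcop d P 1.
Proof.
move=> sP; apply: coprime_hcop; first exact: coprimep1.
by rewrite sP size_poly1; apply/maxn_idPl.
Qed.

Lemma size_addC (a : {poly L}) c n :
  size (a + c%:P) = n.+1 -> (0 < n)%N -> size a = n.+1.
Proof.
move=> sa n0; have -> : a = (a + c%:P) + (- c)%:P by rewrite polyCN addrK.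
by rewrite size_polyDl sa // ltnS (leq_trans (size_polyC_leq1 _)).
Qed.

Lemma affine_conj d (P : {poly L}) (l m : L) (q : {poly k}) : (0 < d)%N ->
  size P = d.+1 -> l != 0 ->
  (forall x, P.[l * x + m] = l * (map_poly kap q).[x] + m) ->
  constant_conj kap d (pmap d P 1).
Proof.
move=> d0 sP l0 h; have [u [v [ru rv uK vK [ui us]]]] := is_rat_affine m l0.
have [fi fs] := pmap_poly d0 sP.
have eP : P \Po (l *: 'X + m%:P) = l *: map_poly kap q + m%:P.
  apply/eqP; rewrite -subr_eq0; apply/eqP/poly_vanish => x.
  by rewrite !hornerE horner_comp !hornerE h subrr.
have slin : size (l *: 'X + m%:P) = 2.
  rewrite size_polyDl size_scale // size_polyX // ltnS.
  exact: size_polyC_leq1.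
have sq : size (map_poly kap q) = d.+1.
  have : size (P \Po (l *: 'X + m%:P)) = d.+1 by rewrite size_comp_poly2.
  by rewrite eP => /size_addC; rewrite size_scale // => ->.
have [gi gs] := pmap_poly d0 sq.
exists u, v, q, 1; rewrite rmorph1; split=> //; split; first exact: hcop_poly.
case=> [x|]; last by rewrite ui fi gi -ui uK.
by rewrite us fs gs h -us uK.
Qed.

(** Because the derivative of P is constant, the linear coefficient of P(l X + m) is independent of
    the translation [m]; the leading one always is. *)
Lemma coef_comp_affine (P Q : {poly L}) (l m c : L) l' m' : l != 0 -> l' != 0 ->
  (1 < size P)%N -> P^`() = c%:P ->
  P \Po (l *: 'X + m%:P) = l' *: Q + m'%:P ->
  c * l = l' * Q`_1 /\ lead_coef P * l ^+ (size P).-1 = l' * lead_coef Q.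
Proof.
move=> l0 l0' sP dP E.
have slin : size (l *: 'X + m%:P) = 2.
  rewrite size_polyDl size_scale // size_polyX // ltnS.
  exact: size_polyC_leq1.
split.
  have := congr1 (fun u => u^`().[0]) E.
  rewrite deriv_comp dP comp_polyC derivD derivC addr0 derivD derivC addr0 !derivZ derivX.
  by rewrite hornerM !hornerZ !hornerC mulr1 => ->; rewrite horner_coef0 coef_deriv.
have := congr1 lead_coef E; rewrite lead_coef_comp ?slin //.
have -> : lead_coef (l *: 'X + m%:P) = l.
  by rewrite lead_coefE slin coefD coefZ coefX coefC mulr1 addr0.
move=> ->; have sQ : (1 < size Q)%N.
  rewrite ltnNge; apply/negP => sQ.
  have := congr1 (fun u : {poly L} => size u) E; rewrite size_comp_poly2 // => e.
  have := size_polyD (l' *: Q) m'%:P; rewrite -e size_scale // leqNgt gtn_max.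
  by rewrite (leq_ltn_trans sQ sP) (leq_ltn_trans (size_polyC_leq1 _) sP).
rewrite lead_coefDl ?lead_coefZ // size_scale //.
exact: leq_ltn_trans (size_polyC_leq1 _) sQ.
Qed.

(* Lang's theorem gives affine coordinates (l_i, m_i) in which g_i is Frobenius, and
   P is defined over k from each coordinate to the next. Comparing linear and leading
   coefficients shows that l_2 / l_1 lies in k. If (m_2 - m_1) / l_1 does too, then the
   first coordinate already works; otherwise q1 is additive up to a constant, and a
   fixed point of P can be moved to 0. *)
Lemma poly_rigidity d e (P : {poly L}) c g1 g2 g3 : (0 < e)%N -> (1 < d)%N ->
  size P = d.+1 -> P^`() = c%:P -> c != 0 ->
  is_frob pL e g1 -> is_frob pL e g2 -> is_frob pL e g3 ->
  g1 None = None -> g2 None = None -> g3 None = None ->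
  (forall x, pmap d P 1 (g1 x) = g2 (pmap d P 1 x)) ->
  (forall x, pmap d P 1 (g2 x) = g3 (pmap d P 1 x)) ->
  constant_conj kap d (pmap d P 1).
Proof.
move=> e0 d1 sP dP c0 F1 F2 F3 i1 i2 i3 com1 com2; have d0 := ltnW d1.
have [fi fs] := pmap_poly d0 sP.
have [A1 [B1 [A10 h1]]] := is_frob_affine F1 i1.
have [A2 [B2 [A20 h2]]] := is_frob_affine F2 i2.
have [A3 [B3 [A30 h3]]] := is_frob_affine F3 i3.
have [l1 [m1 [l10 lang1]]] := affine_frobenius_normalize B1 e0 A10.
have [l2 [m2 [l20 lang2]]] := affine_frobenius_normalize B2 e0 A20.
have [l3 [m3 [l30 lang3]]] := affine_frobenius_normalize B3 e0 A30.
have [|q1 E1] := frobenius_semiconj_const e0 l20 lang1 lang2 (P := P).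
  by move=> x; have := com1 (Some x); rewrite h1 !fs h2 => -[].
have [|q2 E2] := frobenius_semiconj_const e0 l30 lang2 lang3 (P := P).
  by move=> x; have := com2 (Some x); rewrite h2 !fs h3 => -[].
have sP1 : (1 < size P)%N by rewrite sP ltnS.
have [D1 T1] := coef_comp_affine l10 l20 sP1 dP E1.
have [D2 T2] := coef_comp_affine l20 l30 sP1 dP E2.
rewrite !coef_map !lead_coef_map sP /= in D1 T1 D2 T2.
have lP0 : lead_coef P != 0 by rewrite lead_coef_eq0 -size_poly_eq0 sP.
set u1 := kap q1`_1 in D1; set t1 := kap (lead_coef q1) in T1.
set u2 := kap q2`_1 in D2; set t2 := kap (lead_coef q2) in T2.
have dd : d = d.-1.+1 by rewrite prednK.
have u10 : u1 != 0.
  by apply: contraNneq (mulf_neq0 c0 l10) => z; rewrite D1 z mulr0.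
have u20 : u2 != 0.
  by apply: contraNneq (mulf_neq0 c0 l20) => z; rewrite D2 z mulr0.
have t10 : t1 != 0.
  by apply: contraNneq (mulf_neq0 lP0 (expf_neq0 d l10)) => z; rewrite T1 z mulr0.
have t20 : t2 != 0.
  by apply: contraNneq (mulf_neq0 lP0 (expf_neq0 d l20)) => z; rewrite T2 z mulr0.
(* Dividing [T1] by [D1] eliminates l2. Together with [K2] this makes (l2/l1)^(d-1) an element of k,
   hence l2/l1 as well. *)
have K1 : lead_coef P * l1 ^+ d.-1 * u1 = c * t1.
  apply: (mulfI (mulf_neq0 l10 l20)); have := congr1 ( *%R (l2 * u1)) T1.
  rewrite {1}dd exprS => e1.
  have -> : l1 * l2 * (c * t1) = (c * l1) * (l2 * t1) by ring.
  by rewrite D1 -e1; ring.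
have K2 : lead_coef P * l2 ^+ d.-1 * u2 = c * t2.
  apply: (mulfI (mulf_neq0 l20 l30)); have := congr1 ( *%R (l3 * u2)) T2.
  rewrite {1}dd exprS => e1.
  have -> : l2 * l3 * (c * t2) = (c * l2) * (l3 * t2) by ring.
  by rewrite D2 -e1; ring.
have [z ez] : exists z, l2 / l1 = kap z.
  pose y := lead_coef q2 / lead_coef q1 * (q1`_1 / q2`_1).
  have d1' : (0 < d.-1)%N by rewrite -ltnS -dd.
  have y0 : 'X^(d.-1) - y%:P != 0 by rewrite -size_poly_gt0 size_XnsubC.
  apply: (@root_map_const L k kap _ (l2 / l1) y0).
  have ky : kap y = t2 / t1 * (u1 / u2) by rewrite /y !(rmorphM, fmorphV).
  rewrite rmorphB /= map_polyXn map_polyC /root !hornerE subr_eq0.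
  apply/eqP; apply: (etrans _ (esym ky)); rewrite expr_div_n.
  have lq0 : l1 ^+ d.-1 != 0 by rewrite expf_neq0.
  apply: (mulfI (mulf_neq0 (mulf_neq0 lP0 c0) (mulf_neq0 (mulf_neq0 lq0 t10) u20))).
  transitivity (lead_coef P * l2 ^+ d.-1 * u2 * (c * t1)); first by field.
  by rewrite K2 -K1; field; rewrite u20 t10.
have l2E : l2 = l1 * kap z by rewrite -ez mulrC divfK.
have z0 : kap z != 0 by rewrite -ez mulf_neq0 ?invr_eq0.
have P1 x : P.[l1 * x + m1] = l2 * (map_poly kap q1).[x] + m2.
  by have := congr1 (horner^~ x) E1; rewrite horner_comp !hornerE.
have P2 x : P.[l2 * x + m2] = l3 * (map_poly kap q2).[x] + m3.
  by have := congr1 (horner^~ x) E2; rewrite horner_comp !hornerE.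
pose dl := (m2 - m1) / l1.
have m2E : m2 = l1 * dl + m1 by rewrite /dl mulrC divfK // subrK.
case: (EM (exists y, dl = kap y)) => [[y ey]|ny].
  apply: (@affine_conj _ _ l1 m1 (z *: q1 + y%:P)) => // x.
  rewrite P1 rmorphD /= map_polyZ map_polyC !hornerE l2E m2E ey /=; ring.
(* The point l1 (x + dl) + m1 is also l2 (x/z) + m2, where z stands for l2/l1. Evaluating P there in
   both coordinates expresses a translate of q1 through q2. *)
have [q1' E1'] : exists r, forall x,
    (map_poly kap q1).[x + dl] = (map_poly kap r).[x] + (m3 - m2) / l2.
  have [w ew] : exists w, l3 / l2 = kap w.
    have kw : kap (q1`_1 * z / q2`_1) = u1 * kap z / u2 by rewrite !(rmorphM, fmorphV).
    exists (q1`_1 * z / q2`_1); apply: (etrans _ (esym kw)).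
    apply: (mulfI (mulf_neq0 l20 u20)).
    transitivity (l3 * u2); first by field.
    rewrite -D2; transitivity (l2 * u1 * kap z); last by field.
    by rewrite -D1 {1}l2E; ring.
  exists (w *: (q2 \Po (z^-1 *: 'X))) => x.
  rewrite map_polyZ map_comp_poly map_polyZ map_polyX !hornerE horner_comp !hornerE /=.
  rewrite fmorphV -ew; have := P2 ((kap z)^-1 * x).
  have -> : l2 * ((kap z)^-1 * x) + m2 = l1 * (x + dl) + m1.
    by rewrite m2E l2E; field.
  rewrite P1 => e1; apply: (mulfI l20); apply: (addIr m2); rewrite e1; field.
  by [].
have add x y : (map_poly kap q1).[x + y] =
    (map_poly kap q1).[x] + (map_poly kap q1).[y] - (map_poly kap q1).[0].
  by apply: (additive_of_transcendental _ E1') => y' ey; apply: ny; exists y'.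
have sq1 : size (map_poly kap q1) = d.+1.
  have : size (P \Po (l1 *: 'X + m1%:P)) = d.+1.
    rewrite size_comp_poly2 // size_polyDl size_scale // size_polyX // ltnS.
    exact: size_polyC_leq1.
  by rewrite E1 => /size_addC; rewrite size_scale // => ->.
(* A root y of h gives the fixed point l1 y + m1 of P. Once it is taken as origin, additivity leaves
   only q1 - q1(0), with coefficients in k. *)
pose h := l2 *: map_poly kap q1 - l1 *: 'X + (m2 - m1)%:P.
have [y ry] : exists y, root h y.
  have sh : size (l2 *: map_poly kap q1) = d.+1 by rewrite size_scale.
  have sr : (size (- (l1 *: 'X) + (m2 - m1)%:P)%R <= 2)%N.
    apply: leq_trans (size_polyD _ _) _; rewrite size_polyN size_scale // size_polyX.
    by rewrite geq_max leqnn (leq_trans (size_polyC_leq1 _)).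
  apply: closed_root; rewrite /h -addrA size_polyDl sh ltnS //.
  exact: leq_trans sr d1.
have ey : l1 * y + m1 = l2 * (map_poly kap q1).[y] + m2.
  have := eqP ry; rewrite /h !(hornerD, hornerN, hornerZ, hornerX, hornerC) => e1.
  apply/eqP; rewrite -subr_eq0; apply/eqP; rewrite -[RHS]oppr0 -[in RHS]e1; ring.
apply: (@affine_conj _ _ l1 (l1 * y + m1) (z *: (q1 - (q1`_0)%:P))) => // x.
have -> : l1 * x + (l1 * y + m1) = l1 * (x + y) + m1 by ring.
have -> : l1 * y + m1 = l2 * (map_poly kap q1).[y] + m2 by [].
rewrite P1 add -!horner_coef0 map_polyZ rmorphB /= map_polyC /=.
rewrite !(hornerD, hornerN, hornerZ, hornerC) -horner_map rmorph0 l2E; ring.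
Qed.

End Rigidity.

(** * Rigidity for a chain of intertwined bijections *)

Section RigidChain.
Variables (L k : closedFieldType) (kap : {rmorphism k -> L}).
Variables (p : nat) (pL : p \in [pchar L]).
Hypothesis fixed_const : constants_exhausted pL kap.
Implicit Types (a b : {poly L}).

Lemma constant_conj_ext d f g : f =1 g -> constant_conj kap d g -> constant_conj kap d f.
Proof.
move=> E [u [v [a [b [ru rv uK vK [h e]]]]]]; exists u, v, a, b; split=> //.
by split=> // x; rewrite E.
Qed.

(* With v at infinity, f becomes a polynomial without finite branch points, so its
   derivative is a nonzero constant. *)
Lemma total_branch_rigidity d e a b g v : (1 < d)%N -> hcop d a b -> (0 < e)%N ->
  (forall i, (0 < i <= 3)%N -> is_frob pL e (g i)) ->
  (forall i x, (0 < i < 3)%N -> pmap d a b (g i x) = g i.+1 (pmap d a b x)) ->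
  (forall i, (0 < i <= 3)%N -> g i v = v) ->
  (forall x, pmap d a b x = v -> x = v) ->
  (forall w, w != v -> (d <= size (fibre d a b w))%N) ->
  constant_conj kap d (pmap d a b).
Proof.
move=> d1 hab e0 Fg com gv fv full; have d0 := ltnW d1; pose f := pmap d a b.
have [x0 [n0 _]] := third_point v v; have [x1 [n1 n1v]] := third_point x0 v.
have n01 : x0 != x1 by rewrite eq_sym.
have [u [ru _ _ ui]] := mob_three n01 n0 n1v.
have [v' [rv uK vK]] := is_rat_inv ru.
apply: (constant_conj_conj ru rv uK vK).
have rf' : is_rat d (v' \o f \o u).
  rewrite -[d]mul1n -[(1 * d)%N]muln1; apply: is_rat_comp => //.
  by apply: is_rat_comp => //; exists a, b.
have [P [Q [hPQ ef]]] := rf'; have [sP sQ _] := hPQ; have sz := hcop_size hPQ.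
have toN x : pmap d P Q x = None -> x = None.
  rewrite -ef /= => e1; have : f (u x) = v by rewrite -ui -e1 vK.
  by move/fv; rewrite -ui => /(can_inj uK).
have nrQ z : ~~ root Q z.
  apply/negP => /eqP rz; have := toN (Some z).
  by rewrite /pmap /= !hev_x1 // rz /tp eqxx => /(_ erefl).
have sQ1 : (size Q <= 1)%N.
  by rewrite leqNgt; apply/negP => /closed_root [z]; apply/negP.
have eQ := size1_polyC sQ1; set q0 := Q`_0 in eQ.
have q00 : q0 != 0 by have := nrQ 0; rewrite /root eQ hornerC.
pose P1 := q0^-1 *: P.
have sP1 : size P1 = d.+1.
  rewrite size_scale ?invr_eq0 //; move: sz; rewrite eQ size_polyC q00 /=.
  by rewrite /maxn; case: ifP => // lt [e1]; rewrite -e1 in d0.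
have fE : v' \o f \o u =1 pmap d P1 1.
  move=> x; rewrite ef /pmap hevZ hev_one eQ hev_const.
  by rewrite -[RHS](@tp_scale _ q0) // mulVKf.
have hP1 := hcop_poly sP1.
(* A zero c of the derivative would be a double root of P1 - P1(c), so the fibre over a value other
   than infinity would be short. *)
have nr c : ~~ root P1^`() c.
  apply/negP => rc; pose w := P1.[c].
  have lt : (size (fibre d P1 1 (Some w)) < d)%N.
    apply: size_fibre_lt => //; rewrite coprimep_def neq_ltn; apply/orP; right.
    apply: (@root_size_gt1 _ c).
      by rewrite gcdp_eq0 negb_and (fibre_poly_neq0 d0 hP1).
    rewrite root_gcd /fibre_poly /= scale1r alg_polyC derivB derivC subr0 rc.
    by rewrite /root hornerD hornerN hornerC subrr eqxx.
  have wv : u (Some w) != v by rewrite -ui (inj_eq (can_inj uK)).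
  have := full _ wv; rewrite leqNgt; apply/negP; rewrite negbK.
  apply: leq_ltn_trans lt; apply: (size_fibre_conj d0 hab hP1 (can_inj vK)) => x e1.
  by rewrite -fE /= vK /f e1 uK.
have sD : size P1^`() = 1.
  apply/eqP; rewrite eqn_leq leqNgt size_poly_gt0; apply/andP; split.
    by apply/negP => /closed_root [c]; apply/negP.
  by apply: contraNneq (nr 0) => ->; rewrite root0.
have eD := size1_polyC (eq_leq sD).
have c0 : (P1^`())`_0 != 0 by apply: contra_eq_neq sD => z; rewrite eD z size_poly0.
apply: (constant_conj_ext fE).
pose h i := v' \o g i \o u.
have hF i : (0 < i <= 3)%N -> is_frob pL e (h i).
  by move=> /Fg; apply: is_frob_conj.
have hi i : (0 < i <= 3)%N -> h i None = None.
  by move=> /gv e1; rewrite /h /= ui e1 -ui uK.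
have hc i x : (0 < i < 3)%N -> pmap d P1 1 (h i x) = h i.+1 (pmap d P1 1 x).
  by move=> lt; rewrite -!fE /h /= !vK /f com.
by apply: (@poly_rigidity _ _ kap _ pL fixed_const d e P1 _ (h 1) (h 2) (h 3)
  e0 d1 sP1 eD c0) => [||||||x|x];
  [exact: hF|exact: hF|exact: hF|exact: hi|exact: hi|exact: hi|exact: hc|exact: hc].
Qed.

(** Each pullback along f costs one index: the branch set V is stable under g_1, ..., g_4, its
    preimage under g_0, ..., g_3, the second preimage under g_0, g_1, g_2. Their union B is stable
    under both g_1 and g_2, the pair that the three-point argument compares. The case of a single
    branch point uses g_1, g_2, g_3. *)
Theorem rigid_chain n e a b g : hcop n.+2 a b -> wronskian a b != 0 -> (0 < e)%N ->
  (forall i, (i <= 4)%N -> is_frob pL e (g i)) ->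
  (forall i x, (i < 4)%N -> pmap n.+2 a b (g i x) = g i.+1 (pmap n.+2 a b x)) ->
  constant_conj kap n.+2 (pmap n.+2 a b).
Proof.
move=> hab W0 e0 Fg com; set d := n.+2 in hab com *.
have d0 : (0 < d)%N by []; pose f := pmap d a b; have rf : is_rat d f by exists a, b.
pose V := branch d a b.
have memV v : (v \in V) = (size (fibre d a b v) < d)%N by exact: mem_branch.
pose pre S := flatten (map (fibre d a b) S).
have mem_pre S x : (x \in pre S) = (f x \in S).
  apply/flatten_mapP/idP => [[v vS]|fS].
    by rewrite mem_fibre // => /eqP e1; rewrite /f e1.
  by exists (f x) => //; rewrite mem_fibre.
(* The relation f o g_i = g_(i+1) o f and the bijectivity of both maps carry the fibre of v onto
   that of g_(i+1) v, so shortness is preserved. *)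
have gV i v : (0 < i <= 4)%N -> v \in V -> g i v \in V.
  case: i => // i /= i4; rewrite !memV; apply: leq_ltn_trans.
  have Fi := Fg i (ltnW i4); rewrite -(size_map (g i) (fibre d a b v)).
  apply: uniq_leq_size; first exact: uniq_fibre.
  move=> y; rewrite mem_fibre // => /eqP; have [x ->] := is_frob_surj y Fi.
  rewrite com // => /(is_frob_inj (Fg _ i4)) e1.
  by apply: map_f; rewrite mem_fibre // e1.
have gP i x : (i <= 3)%N -> x \in pre V -> g i x \in pre V.
  by move=> i3; rewrite !mem_pre /f com // => /gV; apply; rewrite ltnS.
have gPP i x : (i <= 2)%N -> x \in pre (pre V) -> g i x \in pre (pre V).
  by move=> i2; rewrite !(mem_pre (pre V)) /f com 1?ltnW // => /gP; apply.
pose B := undup (V ++ pre V ++ pre (pre V)).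
have memB x : (x \in B) = [|| x \in V, x \in pre V | x \in pre (pre V)].
  by rewrite mem_undup !mem_cat.
have gB i : (0 < i <= 2)%N -> forall x, x \in B -> g i x \in B.
  move=> /andP [i0 i2] x; rewrite !memB => /or3P [h|h|h].
  - by rewrite gV // i0 (leq_trans i2).
  - by rewrite (gP i) ?orbT // (leq_trans i2).
  - by rewrite (gPP i) ?orbT.
have uB : uniq B by exact: undup_uniq.
case: (leqP 3 (size B)) => [|szB].
  case eB : B => [|c0 [|c1 [|ci s]]] // _.
  move: uB; rewrite eB /= !inE !negb_or -!andbA => /and5P [n01 n0i _ n1i _].
  apply: (@three_point_rigidity _ _ pL _ kap fixed_const d f (g 1) (g 2) e B c0 c1 ci) => //;
    rewrite ?eB ?inE ?eqxx ?orbT //.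
  - by apply: Fg.
  - by apply: Fg.
  - by move=> x; apply: com.
  - by rewrite -eB; apply: gB.
  - by rewrite -eB; apply: gB.
have two x y z : x \in B -> y \in B -> z \in B -> x != y -> z = x \/ z = y.
  move=> xB yB zB nxy; case: (eqVneq z x) => [|nzx]; first by left.
  case: (eqVneq z y) => [|nzy]; first by right.
  have us : uniq [:: x; y; z].
    by rewrite /= !inE negb_or nxy (eq_sym x) nzx (eq_sym y) nzy.
  have sub : {subset [:: x; y; z] <= B} by move=> w; rewrite !inE => /or3P [] /eqP ->.
  by have := uniq_leq_size us sub; rewrite /= leqNgt szB.
have [v vV0] := size_branch_gt0 hab W0.
have vV : v \in V by rewrite memV.
have vB : v \in B by rewrite memB vV.
have preB x w : w \in V -> f x = w -> x \in B.
  by move=> wV e1; rewrite memB mem_pre e1 wV orbT.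
(* Now B has at most two points. If v is its only preimage, either V = {v} or a second branch point
   is totally invariant too. If v has another preimage c, then f exchanges v and c; it is here that
   second preimages of V are needed in B. *)
case: (boolP (all (pred1 v) (fibre d a b v))) => [/allP tv|/allPn [c]].
  have fv x : f x = v -> x = v.
    by move=> e1; apply/eqP/tv; rewrite mem_fibre //; apply/eqP.
  case: (boolP (all (pred1 v) V)) => [/allP aV|/allPn [c cV ncv]].
    have gv i : (0 < i <= 4)%N -> g i v = v.
      by move=> hi; apply/eqP/aV; apply: gV.
    apply: (@total_branch_rigidity d e a b g v) => //.
    - by move=> i /andP [_ i3]; apply: Fg; rewrite (leq_trans i3).
    - by move=> i x /andP [_ i3]; apply: com; rewrite (leq_trans i3).
    - by move=> i /andP [i0 i3]; rewrite gv // i0 (leq_trans i3).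
    - by move=> w; apply: contraR; rewrite -ltnNge -memV => /aV.
  have fvv : f v = v by have [x e1] := fibre_neq0 d0 hab v; rewrite -{1}(fv x).
  apply: (@two_point_conj _ _ kap d f v c) => //; first by rewrite eq_sym.
  left; split=> // x e1; have cB : c \in B by rewrite memB cV.
  have nvc : v != c by rewrite eq_sym.
  have [xv|//] := two v c x vB cB (preB _ _ cV e1) nvc.
  by move: ncv; rewrite /= -e1 xv fvv eqxx.
rewrite mem_fibre // => /eqP fc ncv.
have cB : c \in B by apply: (preB c v).
have nvc : v != c by rewrite eq_sym.
have h2 x : f x = c -> x = v.
  move=> e1; have xB : x \in B.
    by rewrite memB !mem_pre e1 /f fc vV !orbT.
  have [//|xc] := two v c x vB cB xB nvc.
  by rewrite xc /f fc in e1; rewrite e1 /= eqxx in ncv.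
have fvc : f v = c by have [x e1] := fibre_neq0 d0 hab c; rewrite -(h2 x).
apply: (@two_point_conj _ _ kap d f v c) => //; right; split=> // x e1.
have [xv|//] := two v c x vB cB (preB _ _ vV e1) nvc.
by rewrite xv fvc in e1; rewrite e1 /= eqxx in ncv.
Qed.

End RigidChain.

(** * Degrees along an orbit *)

Section Degree.

Lemma irreducible_root_dvdp (K M : fieldType) (f : {rmorphism K -> M}) (g q : {poly K}) x :
  irreducible_poly g -> root (map_poly f g) x -> root (map_poly f q) x -> g %| q.
Proof.
move=> [_ irr] rg rq; have := dvdp_gcdl g q.
case: (ltnP (size (gcdp g q)) 2) => [sz _|sz dv].
  have g0 : gcdp g q != 0.
    rewrite gcdp_eq0; apply/negP => /andP [/eqP g0 _]; move: irr rg; rewrite g0.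
    move=> /(_ 'X); rewrite size_polyX dvdp0 => /(_ isT isT) /eqp_size.
    by rewrite size_polyX size_poly0.
  have cop : coprimep g q by rewrite /coprimep eqn_leq -ltnS sz size_poly_gt0.
  by rewrite -(coprimep_map f) in cop; have := coprimep_root cop rg; rewrite (eqP rq) eqxx.
have /eqp_dvdl <- : gcdp g q %= g by apply: irr => //; rewrite neq_ltn sz orbT.
exact: dvdp_gcdr.
Qed.

Variables (K : fieldType) (L : fieldType) (iota : {rmorphism K -> L}).

Definition has_degree (x : L) n : Prop := exists g : {poly K},
  [/\ irreducible_poly g, size g = n.+1 & root (map_poly iota g) x].

Lemma has_degree_exists x : algebraicOver iota x -> exists n, has_degree x n.
Proof.
move=> alg; pose P n := `[< exists q : {poly K}, [/\ q != 0, size q = n & root (map_poly iota q) x] >].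
have exP : exists n, P n by case: alg => q q0 rq; exists (size q); apply/asboolP; exists q.
case: (ex_minnP exP) => n /asboolP [g [g0 sg rg]] nmin.
have n1 : (1 < n)%N.
  rewrite -sg ltnNge; apply/negP => s1; move: g0 rg; rewrite (size1_polyC s1) polyC_eq0.
  by rewrite map_polyC /root hornerC /= fmorph_eq0 => /negPf ->.
exists n.-1, g; rewrite prednK ?(ltnW n1) //; split=> //; split; first by rewrite sg.
move=> q sq dv; have [h eh] := dvdpP _ _ dv.
have h0 : h != 0 by apply: contraNneq g0 => h0; rewrite eh h0 mul0r.
have q0 : q != 0 by apply: contraNneq g0 => q0; rewrite eh q0 mulr0.
rewrite -dvdp_size_eqp // sg; apply/eqP/anti_leq; rewrite -{1}sg dvdp_leq //=.
move: rg; rewrite eh rmorphM rootM => /orP [rh|rq]; last first.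
  by apply: nmin; apply/asboolP; exists q.
exfalso; have : (n <= size h)%N by apply: nmin; apply/asboolP; exists h.
have q1 : (1 < size q)%N.
  by rewrite ltn_neqAle eq_sym sq size_poly_gt0.
have := size_mul h0 q0; rewrite -eh sg => ->; move: (size q) (size h) q1 => u v *; lia.
Qed.

Lemma has_degree_small x n (q : {poly K}) : has_degree x n ->
  root (map_poly iota q) x -> (size q <= n)%N -> q = 0.
Proof.
move=> [g [irr sg rg]] rq sq; apply/eqP/negPn/negP => q0.
have := dvdp_leq q0 (irreducible_root_dvdp irr rg rq).
by rewrite sg ltnNge sq.
Qed.

Lemma has_degree_gt0 x n : has_degree x n -> (0 < n)%N.
Proof. by case=> g [[+ _] sg _]; rewrite sg. Qed.

Lemma coprime_not_proportional d (a b : {poly K}) c : (0 < d)%N -> coprimep a b ->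
  maxn (size a) (size b) = d.+1 -> a != c *: b.
Proof.
move=> d0 cop sz; apply/eqP => ea; move: cop sz; rewrite ea.
case: (eqVneq c 0) => [->|c0].
  rewrite scale0r coprime0p -size_poly_eq1 => /eqP ->; rewrite size_poly0 max0n.
  by case=> e; rewrite -e in d0.
rewrite coprimepZl // coprimepp size_scale // => /eqP ->; rewrite maxnn => -[e].
by rewrite -e in d0.
Qed.

(** Degrees multiply in K, K(y), K(x), and x is a root of a - y b, of degree at most d over K(y).
    The tower is built in an abstract finite extension generated by a root z of the minimal
    polynomial of x; statements pass between z and x through divisibility by that polynomial. *)
Lemma tower_degree d (a b : {poly K}) x n : (0 < d)%N -> coprimep a b ->
  maxn (size a) (size b) = d.+1 -> has_degree x n ->
  (map_poly iota b).[x] != 0 ->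
  exists n1 e, [/\ has_degree ((map_poly iota a).[x] / (map_poly iota b).[x]) n1,
    (e <= d)%N & n = (e * n1)%N].
Proof.
move=> d0 cop sz [g [irr sg rg]] bx.
have [E dimE [z rz fz]] := irredp_FAdjoin irr.
pose phi : {rmorphism K -> E} := in_alg E; have {}rz : root (map_poly phi g) z := rz.
have bz : (map_poly phi b).[z] != 0.
  apply: contraNneq bx => /eqP /(irreducible_root_dvdp irr rz) /dvdpP [h ->].
  by rewrite rmorphM hornerM (eqP rg) mulr0.
pose y := (map_poly phi a).[z] / (map_poly phi b).[z].
pose F0 := <<1; y>>%AS.
have /polyOver1P [g1 eg1] := minPolyOver 1%AS y.
have sg1 : size g1 = (adjoin_degree 1%AS y).+1.
  by rewrite -(size_map_poly phi) -eg1 size_minPoly.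
have ry : root (map_poly phi g1) y by rewrite -eg1 root_minPoly.
exists (adjoin_degree 1%AS y), (adjoin_degree F0 z); split.
- exists g1; split=> //.
    split; first by rewrite sg1 /adjoin_degree.
    move=> q sq dv; rewrite -(eqp_map phi).
    have /minPoly_irr : map_poly phi q \is a polyOver 1%AS by apply/polyOver1P; exists q.
    move=> /(_ y); rewrite eg1 dvdp_map => /(_ dv) /orP [//|].
    by move=> /eqp_size; rewrite size_map_poly size_poly1 => e1; rewrite e1 in sq.
  set m := adjoin_degree _ _ in sg1; have sm : (size g1 <= m.+1)%N by rewrite sg1.
  have rh : root (map_poly phi (hcomp m g1 a b)) z.
    rewrite /root map_hcomp hcomp_horner_frac ?size_map_poly //.
    by rewrite (eqP ry) mulr0.
  have := irreducible_root_dvdp irr rz rh => /dvdpP [h eh].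
  have : root (map_poly iota (hcomp m g1 a b)) x by rewrite eh rmorphM rootM rg orbT.
  rewrite /root map_hcomp hcomp_horner_frac ?size_map_poly // mulf_eq0 expf_eq0.
  by rewrite (negPf bx) andbF.
- have yF0 : y \in F0 by exact: memv_adjoin.
  pose q := map_poly phi a - y *: map_poly phi b.
  have sF (u : {poly K}) : map_poly phi u \is a polyOver F0.
    by apply: (polyOverS (subvP (sub1v F0))); apply/polyOver1P; exists u.
  have qF : q \is a polyOver F0.
    by rewrite rpredB ?polyOverZ.
  have rq : root q z by rewrite /root /q !hornerE /y divfK // subrr.
  have q0 : q != 0.
    rewrite subr_eq0; apply/eqP => eab.
    have b0 : b != 0 by apply: contraNneq bz => ->; rewrite rmorph0 horner0.
    have : y = phi (lead_coef a / lead_coef b).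
      rewrite (fmorph_div phi) -!(lead_coef_map phi) eab lead_coefZ mulfK //.
      by rewrite lead_coef_eq0 map_poly_eq0.
    move=> ey; move: eab; rewrite ey -map_polyZ => /map_poly_inj /eqP.
    by rewrite (negPf (coprime_not_proportional _ d0 cop sz)).
  rewrite -ltnS -size_minPoly; apply: leq_trans (dvdp_leq q0 (minPoly_dvdp qF rq)) _.
  rewrite -sz /q -scaleNr; apply: leq_trans (size_polyD _ _) _.
  rewrite geq_max size_map_poly leq_maxl; apply: leq_trans (size_scale_leq _ _) _.
  by rewrite size_map_poly leq_maxr.
- have -> : n = \dim {:E} by rewrite dimE sg.
  have <- : <<F0; z>>%VS = fullv.
    apply/eqP; rewrite eqEsubv subvf -fz; apply/FadjoinP; split.
      exact: subv_trans (sub1v _) _.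
    exact: memv_adjoin.
  by rewrite dim_Fadjoin dim_Fadjoin dimv1 muln1.
Qed.

Lemma pole_degree d (b : {poly K}) x n : b != 0 -> (size b <= d.+1)%N ->
  has_degree x n -> root (map_poly iota b) x -> (n <= d)%N.
Proof.
move=> b0 sb hx rx; rewrite leqNgt; apply/negP => lt; move/negP: b0; apply.
by apply/eqP; apply: (has_degree_small hx rx); apply: leq_trans sb lt.
Qed.

Lemma has_degree_base c n : has_degree (iota c) n -> n = 1%N.
Proof.
move=> h; apply/eqP; rewrite eqn_leq (has_degree_gt0 h) andbT.
apply: (@pole_degree 1 ('X - c%:P) (iota c)) => //.
- by rewrite polyXsubC_eq0.
- by rewrite size_XsubC.
- by rewrite rmorphB /= map_polyX map_polyC root_XsubC.
Qed.

End Degree.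

(** * Transport of the Frobenius relation by one step *)

Section Step.
Variables (K : fieldType) (L : closedFieldType) (iota : {rmorphism K -> L}).
Variables (p : nat) (pL : p \in [pchar L]) (e : nat).
Local Notation mp := (map_poly iota).
Local Notation sg := (frp e pL).

Hypothesis interpolation : forall y n, has_degree iota y n ->
  exists A B : {poly K}, [/\ (size A <= (n./2).+1)%N, (size B <= (n./2).+1)%N,
    ~~ ((A == 0) && (B == 0)) & (mp A).[y] * sg y = (mp B).[y]].

Lemma root_small y n (q : {poly K}) : has_degree iota y n -> (size q <= n)%N ->
  q != 0 -> (mp q).[y] != 0.
Proof. by move=> h sq; apply: contra_neq => /eqP r; apply: (has_degree_small h r). Qed.

Lemma coprime_hcop_map n (a b : {poly K}) : coprimep a b ->
  maxn (size a) (size b) = n.+1 -> hcop n (mp a) (mp b).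
Proof. by move=> cop sz; apply: coprime_hcop; rewrite ?coprimep_map ?size_map_poly. Qed.

Variables (d : nat) (P Q : {poly K}).
Hypotheses (d_gt0 : (0 < d)%N) (copPQ : coprimep P Q)
  (szPQ : maxn (size P) (size Q) = d.+1).
Let f := pmap d (mp P) (mp Q).
Let Ps := map_poly sg (mp P).
Let Qs := map_poly sg (mp Q).

(* Pulled back along f, the interpolating relation at y becomes one at x, of degree
   less than [K(x) : K], and hence an identity of rational functions. *)
Lemma frobenius_step x y n n1 A0 B0 : has_degree iota x n ->
  f (Some x) = Some y -> has_degree iota y n1 -> ((n1./2).+1 * d < n)%N ->
  hcop 1 (mp B0) (mp A0) -> (mp A0).[x] * sg x = (mp B0).[x] ->
  exists A1 B1 : {poly K}, [/\ hcop 1 (mp B1) (mp A1),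
    (mp A1).[y] * sg y = (mp B1).[y] &
    forall w, pmap 1 (mp B1) (mp A1) (f w) = pmap d Ps Qs (pmap 1 (mp B0) (mp A0) w)].
Proof.
move=> hx fx hy lt h0 e0; set a := n1./2 in lt.
have hf := coprime_hcop_map copPQ szPQ; have [sP sQ _] := hf.
have [Qx ey] : (mp Q).[x] != 0 /\ y = (mp P).[x] / (mp Q).[x].
  by move: fx; rewrite /f /pmap /= !hev_x1 // /tp; case: eqP => // _ [].
have [A [B [sA sB nAB eAB]]] := interpolation hy; rewrite -/a in sA sB.
have n1_gt0 := has_degree_gt0 hy.
have a_lt : (a < n1)%N by rewrite /a -divn2 ltn_Pdiv.
have n_gt0 : (0 < n)%N by apply: leq_ltn_trans lt.
have [sB0 sA0 _] := h0; rewrite size_map_poly in sB0; rewrite size_map_poly in sA0.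
have sPK : (size P <= d.+1)%N by rewrite -szPQ leq_maxl.
have sQK : (size Q <= d.+1)%N by rewrite -szPQ leq_maxr.
(* The twisted polynomials live over K: their coefficients are p^e-th powers. *)
have pK : p \in [pchar K] by rewrite -(fmorph_pchar iota).
have twist (u : {poly K}) : map_poly sg (mp u) = mp (map_poly (frp e pK) u).
  rewrite -!map_poly_comp; apply: eq_map_poly => c /=.
  by rewrite /frp rmorphXn.
pose PK := map_poly (frp e pK) P; pose QK := map_poly (frp e pK) Q.
have sPs : size PK = size P by rewrite size_map_poly.
have sQs : size QK = size Q by rewrite size_map_poly.
pose Pc := hcomp d PK B0 A0; pose Qc := hcomp d QK B0 A0.
have tw (u : {poly K}) : (size u <= d.+1)%N ->
    (mp (hcomp d (map_poly (frp e pK) u) B0 A0)).[x] = (mp A0).[x] ^+ d * sg (mp u).[x].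
  move=> su; rewrite map_hcomp hcomp_horner -twist -e0 -[X in hev _ _ _ X]mulr1.
  by rewrite hev_scale -(rmorph1 sg) -hev_map /= hev_x1 // size_map_poly.
(* This is A(f) P^(q)(R_0) - B(f) Q^(q)(R_0) with denominators cleared, of degree at most (a + 1) d
   in the variable. *)
pose F := hcomp a A P Q * Pc - hcomp a B P Q * Qc.
have sF : (size F <= n)%N.
  have s1 (u v : {poly K}) : (size (hcomp a u P Q * hcomp d v B0 A0)%R <= (a.+1 * d).+1)%N.
    apply: leq_trans (size_polyMleq _ _) _.
    have := size_hcomp a u sPK sQK; have := size_hcomp d v sB0 sA0.
    rewrite muln1 mulSn; move: (size _) (size _) (a * d)%N => *; lia.
  apply: leq_trans (size_polyD _ _) _; rewrite size_polyN geq_max.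
  by rewrite !(leq_trans (s1 _ _)).
have F0 : F = 0.
  have hA (u : {poly K}) : (size u <= a.+1)%N ->
      (mp (hcomp a u P Q)).[x] = (mp Q).[x] ^+ a * (mp u).[y].
    by move=> su; rewrite map_hcomp hcomp_horner_frac ?size_map_poly // ey.
  have eF : mp F = mp (hcomp a A P Q) * mp Pc - mp (hcomp a B P Q) * mp Qc.
    by rewrite /F rmorphB !rmorphM.
  apply: (has_degree_small hx _ sF); rewrite /root eF hornerD hornerN.
  rewrite 2!hornerM (tw _ sPK) (tw _ sQK) (hA _ sA) (hA _ sB) -eAB ey fmorph_div /=.
  rewrite subr_eq0; apply/eqP; field; by rewrite fmorph_eq0.
pose G := gcdp A B; have G0 : G != 0 by rewrite gcdp_eq0.
pose A1 := A %/ G; pose B1 := B %/ G.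
have eA : A = G * A1 by rewrite mulrC divpK // dvdp_gcdl.
have eB : B = G * B1 by rewrite mulrC divpK // dvdp_gcdr.
have cop1 : coprimep A1 B1 by apply: coprimep_div_gcd; rewrite -negb_and.
have max_gt0 : (0 < maxn (size A1) (size B1))%N.
  rewrite leq_max !size_poly_gt0 -negb_and; apply: contraNN nAB.
  by rewrite eA eB => /andP [/eqP -> /eqP ->]; rewrite mulr0 eqxx.
pose m := (maxn (size A1) (size B1)).-1.
have sm : maxn (size A1) (size B1) = m.+1 by rewrite prednK.
have [sA1 sB1] : (size A1 <= m.+1)%N /\ (size B1 <= m.+1)%N.
  by rewrite -sm leq_maxl leq_maxr.
have ma : (m <= a)%N /\ (size G <= (a - m).+1)%N.
  have bound (u : {poly K}) : u != 0 -> (size (G * u)%R <= a.+1)%N -> size u = m.+1 ->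
      (m <= a)%N /\ (size G <= (a - m).+1)%N.
    move=> u0; rewrite size_mul // => + eu; rewrite eu addnS /= => le.
    have le_ma : (m <= a)%N.
      by rewrite -ltnS; apply: leq_trans le; rewrite -add1n leq_add2r size_poly_gt0.
    by rewrite -subSn // leq_subRL ?(leq_trans le_ma) // addnC.
  have : (m < size A1)%N || (m < size B1)%N by rewrite -leq_max sm.
  case/orP => lt'.
    apply: (bound A1); rewrite -?eA //; first by rewrite -size_poly_gt0 (leq_ltn_trans _ lt').
    by apply/eqP; rewrite eqn_leq sA1.
  apply: (bound B1); rewrite -?eB //; first by rewrite -size_poly_gt0 (leq_ltn_trans _ lt').
  by apply/eqP; rewrite eqn_leq sB1.
have {ma} [ma sG] := ma; have ea : a = (a - m + m)%N by rewrite subnK.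
have Gy : (mp G).[y] != 0.
  by apply: (root_small hy) => //; apply: leq_trans sG _; rewrite (leq_trans _ a_lt) // ltnS leq_subr.
have id1 : hcomp m A1 P Q * Pc = hcomp m B1 P Q * Qc.
  have hG : hcomp (a - m) G P Q != 0.
    apply/eqP => hG; have := congr1 (fun u => (mp u).[x]) hG.
    rewrite map_hcomp hcomp_horner_frac ?size_map_poly // -ey rmorph0 horner0.
    by move=> /eqP; rewrite mulf_eq0 (negPf Gy) expf_eq0 (negPf Qx) andbF.
  apply: (mulfI hG); apply/eqP; rewrite -subr_eq0 !mulrA -!hcompM // -ea -eA -eB.
  exact/eqP.
have h1 : hcop m (mp A1) (mp B1) by apply: coprime_hcop_map.
have hPs : hcop d Ps Qs by exact: hcop_map_frp.
(* Both sides are composites of reduced fractions, hence reduced, so their degrees agree: m d = d.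
   The relation at y is thus given by a Moebius transformation. *)
have [eh [c c0 [ecA ecB]]] : (m * d = d * 1)%N /\ exists2 c, c != 0 &
    hcomp d Qs (mp B0) (mp A0) = c *: hcomp m (mp A1) (mp P) (mp Q) /\
    hcomp d Ps (mp B0) (mp A0) = c *: hcomp m (mp B1) (mp P) (mp Q).
  have hPs' : hcop d Qs Ps.
    by case: hPs => s1 s2 h; split=> // u v e1 e2; apply: h.
  apply: (hcop_eq (hcop_comp h1 hf) (hcop_comp hPs' h0)).
  have := congr1 (map_poly iota) id1; rewrite !rmorphM /= /Pc /Qc !map_hcomp -!twist => E.
  by rewrite E mulrC.
have m1 : m = 1%N by move: eh; rewrite muln1 => /eqP; rewrite -{2}[d]mul1n eqn_pmul2r // => /eqP.
have h1' : hcop 1 (mp B1) (mp A1).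
  by rewrite m1 in h1; case: h1 => s1 s2 h; split=> // u v E1 E2; apply: h.
exists A1, B1; split=> //.
  apply: (mulfI Gy); rewrite mulrA -!hornerM -!rmorphM /= -eA -eB //.
move=> w; rewrite /f (pmap_comp _ _ _ _ hf) (pmap_comp _ _ _ _ h0).
by rewrite mul1n muln1 ecA ecB m1 /pmap !hevZ tp_scale.
Qed.

End Step.

(** * Transport along the orbit *)

Section Chain.
Variables (K : fieldType) (L : closedFieldType) (iota : {rmorphism K -> L}).
Variables (p : nat) (pL : p \in [pchar L]) (e : nat).
Local Notation mp := (map_poly iota).
Local Notation sg := (frp e pL).

Hypothesis interpolation : forall y n, has_degree iota y n ->
  exists A B : {poly K}, [/\ (size A <= (n./2).+1)%N, (size B <= (n./2).+1)%N,
    ~~ ((A == 0) && (B == 0)) & (mp A).[y] * sg y = (mp B).[y]].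

Variables (d : nat) (P Q : {poly K}) (gamma : option K).
Hypotheses (d_gt1 : (1 < d)%N) (copPQ : coprimep P Q)
  (szPQ : maxn (size P) (size Q) = d.+1).
Let f := pmap d (mp P) (mp Q).
Let fs := pmap d (map_poly sg (mp P)) (map_poly sg (mp Q)).

Lemma image_degree x n : has_degree iota x n ->
  f (Some x) = None /\ (n <= d)%N \/
  exists y n1 e1, [/\ f (Some x) = Some y, has_degree iota y n1, (e1 <= d)%N & n = (e1 * n1)%N].
Proof.
move=> hx; have d_gt0 := ltnW d_gt1; have hf := coprime_hcop_map iota copPQ szPQ.
have [sP sQ _] := hf; rewrite /f /pmap /= !hev_x1 // /tp.
have sQK : (size Q <= d.+1)%N by rewrite -szPQ leq_maxr.
case: eqP => [Qx|/eqP Qx]; [left | right].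
  split=> //; apply: (pole_degree _ sQK hx); last exact/eqP.
  have copQP : coprimep Q P by rewrite coprimep_sym.
  have szQP : maxn (size Q) (size P) = d.+1 by rewrite maxnC.
  by have := coprime_not_proportional 0 d_gt0 copQP szQP; rewrite scale0r.
have [n1 [e1 [h1 h2 h3]]] := tower_degree d_gt0 copPQ szPQ hx Qx.
by exists ((mp P).[x] / (mp Q).[x]), n1, e1.
Qed.

Lemma degree_bound m x n : iter m f (Some x) = omap iota gamma ->
  has_degree iota x n -> (n <= d ^ m)%N.
Proof.
elim: m x n => [|m IH] x n.
  by case: gamma => //= c [->] /has_degree_base ->.
rewrite iterSr => E hx; have [[_ le]|[y [n1 [e1 [fx hy le ->]]]]] := image_degree hx.
  apply: leq_trans le _; rewrite expnS -{1}[d]muln1 leq_mul2l expn_gt0 (ltnW d_gt1).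
  by rewrite !orbT.
by rewrite fx in E; rewrite expnS leq_mul // (IH _ _ E hy).
Qed.

(** Since n1 <= d^m, the lower bound on n forces 2 e1 >= d + 1. Then n1 > 2 d is enough for the
    first conclusion, and it follows from 2 n1 > d^m >= 4 d; this is where m >= 3 enters. *)
Lemma degree_arith m n n1 e1 : (3 <= m)%N -> (e1 <= d)%N -> (n1 <= d ^ m)%N ->
  n = (e1 * n1)%N -> (d ^ m.+1 < 2 * n)%N ->
  ((n1./2).+1 * d < n)%N /\ (d ^ m < 2 * n1)%N.
Proof.
move=> m3 le_e le_n1 -> ; rewrite expnS => lt.
have n1_gt : (d ^ m < 2 * n1)%N.
  rewrite -(ltn_pmul2l (ltnW d_gt1)); apply: leq_trans lt _.
  by rewrite mulnCA leq_mul2r le_e orbT.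
split=> //; have d4 : (4 * d <= d ^ m)%N.
  apply: leq_trans (leq_pexp2l (ltnW d_gt1) m3).
  by rewrite expnSr leq_mul2r (leq_sqr 2 d) d_gt1 orbT.
have e2 : (d < 2 * e1)%N.
  have n1_gt0 : (0 < n1)%N by case: n1 lt {le_n1 n1_gt} => //; rewrite !muln0.
  rewrite -(ltn_pmul2r n1_gt0) -mulnA; apply: leq_ltn_trans lt.
  by rewrite leq_mul2l le_n1 orbT.
have half : (2 * n1./2 <= n1)%N by rewrite mul2n -{2}(odd_double_half n1) leq_addl.
rewrite -(ltn_pmul2l (isT : (0 < 2)%N)) mulnA mulnS mulnA.
apply: (@leq_ltn_trans ((2 + n1) * d)); first by rewrite leq_mul2r leq_add2l half orbT.
apply: (@leq_trans (d.+1 * n1)); last by rewrite leq_mul2r e2 orbT.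
have -> : (d.+1 * n1 = n1 + n1 * d)%N by rewrite mulSn (mulnC d).
rewrite mulnDl ltn_add2r -(ltn_pmul2l (isT : (0 < 2)%N)) mulnA.
exact: leq_ltn_trans d4 n1_gt.
Qed.

Lemma frobenius_chain i m x n A0 B0 : (i + 3 <= m)%N ->
  iter m f (Some x) = omap iota gamma -> has_degree iota x n -> (d ^ m < 2 * n)%N ->
  hcop 1 (mp B0) (mp A0) -> (mp A0).[x] * sg x = (mp B0).[x] ->
  exists R : nat -> option L -> option L,
    [/\ R 0%N = pmap 1 (mp B0) (mp A0), forall l, (l <= i)%N -> is_rat 1 (R l) &
        forall l w, (l < i)%N -> R l.+1 (f w) = fs (R l w)].
Proof.
have d_gt0 := ltnW d_gt1.
elim: i m x n A0 B0 => [|i IH] m x n A0 B0 le_m E hx lt h0 e0.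
  exists (fun _ => pmap 1 (mp B0) (mp A0)); split=> // l _.
  by exists (mp B0), (mp A0).
case: m le_m E lt => // m; rewrite addSn ltnS => le_m; rewrite iterSr => E lt.
have m3 : (3 <= m)%N by apply: leq_trans le_m; rewrite leq_addl.
have [[_ le]|[y [n1 [e1 [fx hy le_e en]]]]] := image_degree hx.
  (* If x were a pole of f its degree over K would be at most d, too small for d^m < 2 n. *)
  have : (2 * d < 2 * n)%N.
    apply: leq_ltn_trans lt; rewrite expnS mulnC leq_mul2l.
    rewrite (leq_trans (_ : 2 <= d ^ 1)%N) ?orbT ?expn1 //.
    by rewrite -{1}[d]expn1 leq_pexp2l // (leq_trans _ m3).
  by rewrite ltn_pmul2l // ltnNge le.
rewrite fx in E; have le_n1 := degree_bound E hy.
have [lt1 lt2] := degree_arith m3 le_e le_n1 en lt.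
have [A1 [B1 [h1 r1 c1]]] := frobenius_step interpolation d_gt0 copPQ szPQ hx fx hy lt1 h0 e0.
have [R [R0 Rrat Rc]] := IH _ _ _ _ _ le_m E hy lt2 h1 r1.
exists (fun l => if l is l'.+1 then R l' else pmap 1 (mp B0) (mp A0)); split=> //.
  by case=> [|l] lel; [exists (mp B0), (mp A0) | apply: Rrat].
by case=> [|l] w // lt3; [rewrite R0; exact: c1 | apply: Rc].
Qed.

Variables (k : closedFieldType) (kap : {rmorphism k -> L}).
Hypothesis fixed_const : constants_exhausted pL kap.

Lemma constant_conj_of_relation m x n A0 B0 : (0 < e)%N ->
  wronskian (mp P) (mp Q) != 0 -> (7 <= m)%N ->
  iter m f (Some x) = omap iota gamma -> has_degree iota x n -> (d ^ m < 2 * n)%N ->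
  hcop 1 (mp B0) (mp A0) -> (mp A0).[x] * sg x = (mp B0).[x] ->
  constant_conj kap d f.
Proof.
move=> e0 W0 m7 E hx lt h0 r0.
have [R [_ Rrat Rc]] := @frobenius_chain 4 m x n A0 B0 m7 E hx lt h0 r0.
have inv l : exists S, (l <= 4)%N -> [/\ is_rat 1 S, cancel (R l) S & cancel S (R l)].
  case: (leqP l 4) => [/Rrat /is_rat_inv [S hS]|_]; first by exists S.
  by exists id.
have [S hS] := choice inv.
pose g l := S l \o Fr pL e.
have hf := coprime_hcop_map iota copPQ szPQ.
have d2 : d = (d - 2).+2 by move: (d) d_gt1 => [|[|d']] // _; rewrite !subSS subn0.
rewrite d2 in hf; rewrite /f d2; apply: (@rigid_chain _ _ kap _ pL fixed_const _ e _ _ g hf W0 e0).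
  by move=> l /hS [rS _ _]; exists (S l).
move=> l w l4; rewrite -d2 -/f.
have [_ _ SK] := hS _ (ltnW l4); have [_ RK _] := hS _ l4.
by rewrite /g /= [in RHS]/f Fr_pmap -/fs -{2}(SK (Fr pL e w)) -Rc // RK.
Qed.

End Chain.

(** * Auxiliary polynomials and heights *)

Section DimensionCount.
Variable k : fieldType.
Local Notation biv := {poly {poly k}}.

Lemma lin_kernel (aT rT : vectType k) (f : {linear aT -> rT}) :
  (dim rT < dim aT)%N -> exists2 u, u != 0 & f u = 0.
Proof.
move=> lt; have := limg_ker_dim (linfun f) fullv; rewrite capfv dimvf => e.
have l1 : (\dim (linfun f @: fullv) <= dim rT)%N by rewrite -dimvf dimvS ?subvf.
exists (vpick (lker (linfun f))).
  rewrite vpick0 -dimv_eq0; apply: contraTneq lt => l0; rewrite -leqNgt -e l0.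
  exact: l1.
by apply/eqP; rewrite -lfunE -memv_ker memv_pick.
Qed.

(** Bounds on sizes, not degrees, so that the box has dimension exactly m T over k. *)
Definition in_box m T (q : biv) : Prop :=
  (size q <= m)%N /\ forall i, (size (q`_i)%R <= T)%N.

Lemma box_kernel (aT : vectType k) (F : aT -> biv) m T :
  (forall u v, F (u + v) = F u + F v) -> (forall c u, F (c *: u) = c%:P%:P * F u) ->
  (forall u, in_box m T (F u)) -> (m * T < dim aT)%N ->
  exists2 u, u != 0 & F u = 0.
Proof.
move=> FD FZ Fb lt; pose Phi u : 'M[k]_(m, T) := \matrix_(i, j) ((F u)`_i)`_j.
have Phi_lin : linear Phi.
  move=> c u v; apply/matrixP => i j; rewrite !mxE FD FZ.
  by rewrite coefD coefCM coefD coefCM.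
pose PhiL : {linear aT -> 'M[k]_(m, T)} := HB.pack Phi
  (GRing.isLinear.Build _ _ _ _ Phi Phi_lin).
have [|u u0 eu] := @lin_kernel _ _ PhiL.
  by rewrite dim_matrix.
exists u => //; have [sz st] := Fb u; apply/polyP => i; rewrite coef0.
case: (ltnP i m) => im; last by rewrite nth_default // (leq_trans sz).
apply/polyP => j; rewrite coef0; case: (ltnP j T) => jT; last first.
  by rewrite nth_default // (leq_trans (st i)).
have : PhiL u (Ordinal im) (Ordinal jT) = 0 by rewrite eu mxE.
by rewrite mxE.
Qed.

Definition box m T (M : 'M[k]_(m, T)) : biv :=
  \sum_(i < m) (rVpoly (row i M))%:P * 'X^i.

Lemma boxD m T (M N : 'M[k]_(m, T)) : box (M + N) = box M + box N.
Proof.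
rewrite -big_split; apply: eq_bigr => i _ /=.
by rewrite raddfD /= raddfD /= rmorphD mulrDl.
Qed.

Lemma boxZ m T c (M : 'M[k]_(m, T)) : box (c *: M) = c%:P%:P * box M.
Proof.
rewrite mulr_sumr; apply: eq_bigr => i _.
by rewrite linearZ /= linearZ /= -mul_polyC polyCM mulrA.
Qed.

Lemma coef_box m T (M : 'M[k]_(m, T)) (i : 'I_m) : (box M)`_i = rVpoly (row i M).
Proof.
rewrite coef_sum (bigD1 i) //= coefCM coefXn eqxx mulr1 big1 ?addr0 // => l nl.
by rewrite coefCM coefXn eq_sym val_eqE (negPf nl) mulr0.
Qed.

Lemma box_in m T (M : 'M[k]_(m, T)) : in_box m T (box M).
Proof.
have sz : (size (box M) <= m)%N.
  apply: leq_trans (size_sum _ _ _) _; apply/bigmax_leqP => i _.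
  apply: leq_trans (size_polyMleq _ _) _; rewrite size_polyXn addnS /=.
  by apply: leq_trans (leq_add (size_polyC_leq1 _) (leqnn _)) _; rewrite add1n.
split=> // i; case: (ltnP i m) => im; last by rewrite nth_default ?size_poly0 // (leq_trans sz).
by rewrite (coef_box M (Ordinal im)) size_poly.
Qed.

Lemma box_eq0 m T (M : 'M[k]_(m, T)) : box M = 0 -> M = 0.
Proof.
move=> e; apply/row_matrixP => i; rewrite row0; apply: (can_inj (@rVpolyK _ T)).
by rewrite linear0 -coef_box e coef0.
Qed.

Lemma in_boxD m T q r : in_box m T q -> in_box m T r -> in_box m T (q + r).
Proof.
move=> [s1 t1] [s2 t2]; split.
  by apply: leq_trans (size_polyD _ _) _; rewrite geq_max s1.
move=> i; rewrite coefD; apply: leq_trans (size_polyD _ _) _.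
by rewrite geq_max t1 t2.
Qed.

Lemma in_boxN m T q : in_box m T q -> in_box m T (- q).
Proof. by move=> [s t]; split=> [|i]; rewrite ?coefN size_polyN //; exact: t. Qed.

Lemma in_boxW m T m' T' q : (m <= m')%N -> (T <= T')%N ->
  in_box m T q -> in_box m' T' q.
Proof.
by move=> lm lT [s t]; split=> [|i]; [apply: leq_trans s lm | apply: leq_trans (t i) lT].
Qed.

Lemma in_boxM m T m' T' q r : in_box m.+1 T.+1 q -> in_box m' T' r ->
  in_box (m + m') (T + T') (q * r).
Proof.
move=> [s1 t1] [s2 t2]; split.
  apply: leq_trans (size_polyMleq _ _) _; move: s1 s2.
  by move: (size q) (size r) => u v s1 s2; lia.
move=> i; rewrite coefM; apply: leq_trans (size_sum _ _ _) _.
apply/bigmax_leqP => l _; apply: leq_trans (size_polyMleq _ _) _.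
have := t1 l; have := t2 (i - l)%N.
by move: (size q`_l) (size r`_(i - l)) => u v ? ?; lia.
Qed.

Lemma in_boxX m T q n : in_box m T q -> in_box (m + n) T (q * 'X^n).
Proof.
move=> [s t]; split.
  apply: leq_trans (size_polyMleq _ _) _; rewrite size_polyXn.
  by rewrite addnS /= leq_add2r.
move=> i; rewrite coefMXn; case: ifP => // _; by rewrite size_poly0.
Qed.

(* A, B and H have more coefficients than A * 'X^s - B - g * H. *)
Lemma siegel (g : biv) D dl a s : size g = D.+1 -> in_box D.+1 dl.+1 g ->
  (D < 2 * a.+1)%N -> exists A B H : biv,
  [/\ in_box a.+1 ((s + a.+1) * dl).+1 A, in_box a.+1 ((s + a.+1) * dl).+1 B,
      ~~ ((A == 0) && (B == 0)) & A * 'X^s - B = g * H].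
Proof.
(* Here n is the size of H in z, truncated to 0 when D > s + a + 1. For n > 0 the unknowns exceed
   the equations by at least T - n dl, which explains T = (s + a + 1) dl + 1. *)
move=> sg bg lt; set T := ((s + a.+1) * dl).+1; pose n := (s + a.+1 - D)%N.
pose aT := ('M[k]_(a.+1, T) * 'M[k]_(a.+1, T) * 'M[k]_(n, T - dl))%type.
pose F (u : aT) := box u.1.1 * 'X^s - box u.1.2 - g * box u.2.
have dlT : (dl <= T)%N by rewrite /T addnS mulSn -addnS leq_addr.
have [||||[[MA MB] MH] u0 eu] := @box_kernel aT F (s + a.+1)%N T.
- by move=> u v; rewrite /F /= !boxD; ring.
- by move=> c u; rewrite /F /= !boxZ; ring.
- move=> u; apply: in_boxD; last apply: in_boxN.
    apply: in_boxD; first by rewrite addnC; apply: in_boxX; exact: box_in.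
    by apply: in_boxN; apply: in_boxW (box_in _) => //; rewrite leq_addl.
  case: (leqP D (s + a.+1)) => le.
    apply: (@in_boxW (D + n) (dl + (T - dl))); [by rewrite subnKC | by rewrite subnKC |].
    by apply: in_boxM => //; exact: box_in.
  have : box u.2 = 0.
    by rewrite /box big1 // => i; have := ltn_ord i; rewrite {2}/n (eqP (ltnW le : _ - _ == 0)%N).
  by move=> ->; rewrite mulr0; split=> [|i]; rewrite ?coef0 size_poly0.
- have -> : dim aT = (a.+1 * T + a.+1 * T + n * (T - dl))%N.
    by rewrite /dim /= !dim_matrix.
  case: (leqP D (s + a.+1)) => le.
    have -> : (s + a.+1 = D + n)%N by rewrite subnKC.
    rewrite mulnBr mulnDl -mulnDl addnn -mul2n.
    have : (n * dl < T)%N by rewrite ltnS leq_mul2r leq_subr orbT.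
    have : (D.+1 * T <= 2 * a.+1 * T)%N by rewrite leq_mul2r lt orbT.
    have : (n * dl <= n * T)%N by rewrite leq_mul2l dlT orbT.
    rewrite mulSn; lia.
  have -> : n = 0%N by apply/eqP; exact: ltnW.
  rewrite mul0n addn0 -mulnDl addnn -mul2n ltn_mul2r.
  by rewrite (leq_trans le) // ltnW.
rewrite /F /= in eu; exists (box MA), (box MB), (box MH); split; try exact: box_in.
  apply: contraNN u0 => /andP [/eqP eA /eqP eB]; move: eu; rewrite eA eB mul0r subr0 sub0r.
  move/eqP; rewrite oppr_eq0 mulf_eq0 -size_poly_eq0 sg /= => /eqP /box_eq0 ->.
  by rewrite (box_eq0 eA) (box_eq0 eB).
by apply/eqP; rewrite -subr_eq0 eu.
Qed.

(** This replaces the resultant of A and B. With Y = 2 e X, unknowns exceed equations by X + 1, and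
    independence of A and B in these degrees makes c nonzero. The exponents used later are j = 0 and
    j = 2 e - 1. *)
Lemma bezout (A B : biv) e X j : in_box e.+1 X.+1 A -> in_box e.+1 X.+1 B ->
  (forall U V : biv, (size U <= e)%N -> (size V <= e)%N -> U * A + V * B = 0 -> U = 0 /\ V = 0) ->
  (j < 2 * e)%N -> exists U V : biv, exists c : {poly k},
  [/\ in_box e (2 * e * X).+1 U, in_box e (2 * e * X).+1 V, c != 0,
      (size c <= (X + 2 * e * X).+1)%N & U * A + V * B = c%:P * 'X^j].
Proof.
move=> bA bB ind lt; set Y := (2 * e * X)%N.
pose aT := ('M[k]_(e, Y.+1) * 'M[k]_(e, Y.+1) * 'M[k]_(1, (X + Y).+1))%type.
pose F (u : aT) := A * box u.1.1 + B * box u.1.2 - box u.2 * 'X^j.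
have [||||[[MU MV] Mc] u0 eu] := @box_kernel aT F (2 * e)%N (X + Y).+1.
- by move=> u v; rewrite /F /= !boxD; ring.
- by move=> c u; rewrite /F /= !boxZ; ring.
- move=> u; rewrite -addnS mul2n -addnn; apply: in_boxD.
    by apply: in_boxD; apply: in_boxM => //; exact: box_in.
  apply: in_boxN; apply: (@in_boxW (1 + j) (X + Y.+1)) => //.
    by rewrite add1n addnn -mul2n.
  by apply: in_boxX; rewrite addnS; exact: box_in.
- have -> : dim aT = (e * Y.+1 + e * Y.+1 + 1 * (X + Y).+1)%N.
    by rewrite /dim /= !dim_matrix.
  rewrite mul1n -mulnDl addnn -mul2n -addnS mulnDr addnC ltn_add2l -/Y.
  by rewrite addnS ltnS leq_addl.
rewrite /F /= in eu.
have ec : box Mc = (rVpoly (row ord0 Mc))%:P by rewrite /box big_ord1 expr0 mulr1.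
have [sU tU] := box_in MU; have [sV tV] := box_in MV; have [_ tc] := box_in Mc.
exists (box MU), (box MV), (rVpoly (row ord0 Mc)); split; try exact: box_in.
- apply: contraNneq u0 => c0; rewrite ec c0 mul0r subr0 in eu.
  have eUV : box MU * A + box MV * B = 0 by rewrite ![box _ * _]mulrC.
  have [eU eV] := ind _ _ sU sV eUV.
  have eC : box Mc = 0 by rewrite ec c0.
  by rewrite (box_eq0 eU) (box_eq0 eV) (box_eq0 eC).
- by rewrite -(coef_box Mc ord0); apply: tc.
- by apply/eqP; rewrite -subr_eq0 -ec ![box _ * _]mulrC -[X in _ == X]eu; apply/eqP; ring.
Qed.

End DimensionCount.

(** * Clearing denominators and Gauss's lemma for k[t][z] *)

Section ClearDenominators.
Variables (A : idomainType) (K : fieldType) (f : {rmorphism A -> K}).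
Hypothesis f_inj : injective f.
Hypothesis f_frac : forall x, exists u v, v != 0 /\ x = f u / f v.

Lemma inj_rmorph_eq0 u : (f u == 0) = (u == 0).
Proof. by rewrite -(rmorph0 f) (inj_eq f_inj). Qed.

Lemma clear_denominators (q : {poly K}) :
  exists c q0, c != 0 /\ map_poly f q0 = f c *: q.
Proof.
elim/poly_ind: q => [|q x [c [q0 [c0 e]]]].
  by exists 1, 0; rewrite ?oner_neq0 // rmorph0 scaler0.
have [u [v [v0 ex]]] := f_frac x.
exists (c * v), (v *: (q0 * 'X) + (c * u)%:P); split; first by rewrite mulf_neq0.
have e1 : map_poly f (q0 * 'X) = (f c *: q) * 'X by rewrite rmorphM /= map_polyX e.
rewrite rmorphD /= map_polyZ e1 map_polyC /= ex scalerDr.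
rewrite -scalerAl scalerA !rmorphM /=; congr (_ + _); first by rewrite mulrC.
rewrite -[RHS]mul_polyC -!polyCM; congr (_%:P); field.
by rewrite inj_rmorph_eq0.
Qed.

Lemma gauss_coprime (a b : {poly A}) : ~~ ((a == 0) && (b == 0)) ->
  exists c g a0 b0, [/\ c != 0, c%:P * a = g * a0, c%:P * b = g * b0 &
    coprimep (map_poly f a0) (map_poly f b0)].
Proof.
have mp_eq0 (u : {poly A}) : (map_poly f u == 0) = (u == 0).
  by rewrite -(rmorph0 (map_poly f)) (inj_eq (map_inj_poly f_inj _)) ?rmorph0.
move=> nz; pose G := gcdp (map_poly f a) (map_poly f b).
have nz' : (map_poly f a != 0) || (map_poly f b != 0) by rewrite -negb_and !mp_eq0.
have G0 : G != 0 by rewrite gcdp_eq0 negb_and.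
have cop := coprimep_div_gcd nz'.
have [c1 [g [c10 eg]]] := clear_denominators G.
have [c2 [a1 [c20 ea]]] := clear_denominators (map_poly f a %/ G).
have [c3 [b1 [c30 eb]]] := clear_denominators (map_poly f b %/ G).
have mp_inj : injective (map_poly f) by apply: map_inj_poly => //; rewrite rmorph0.
exists (c1 * c2 * c3), g, (c3%:P * a1), (c2%:P * b1); split.
- by rewrite !mulf_neq0.
- apply: mp_inj; rewrite !rmorphM /= !map_polyC /= ea eg -{1}(divpK (dvdp_gcdl (map_poly f a) (map_poly f b))).
  rewrite -!mul_polyC -/G; ring.
- apply: mp_inj; rewrite !rmorphM /= !map_polyC /= eb eg -{1}(divpK (dvdp_gcdr (map_poly f a) (map_poly f b))).
  rewrite -!mul_polyC -/G; ring.
rewrite !rmorphM /= !map_polyC ea eb !mul_polyC !scalerA.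
by rewrite coprimepZl ?coprimepZr // mulf_neq0 ?inj_rmorph_eq0.
Qed.

End ClearDenominators.

Section GaussLemma.
Variables (k : closedFieldType).
Local Notation biv := {poly {poly k}}.

Lemma eval_coef_eq0 t (q : biv) : map_poly (horner_eval t) q = 0 ->
  exists q1, q = ('X - t%:P)%:P * q1.
Proof.
move=> e; exists (\poly_(i < size q) (q`_i %/ ('X - t%:P))).
apply/polyP => i; rewrite coefCM coef_poly; case: ltnP => lt; last first.
  by rewrite nth_default // mulr0.
rewrite mulrC divpK // dvdp_XsubCl /root; apply/eqP.
by have := congr1 (fun u : {poly k} => u`_i) e; rewrite coef0 coef_map.
Qed.

(* Gauss's lemma for k[t][z]: a root of c makes G vanish or A1 and B1 vanish
   simultaneously, hence the corresponding linear factor can be cancelled. *)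
Lemma gauss_reduce (c : {poly k}) (G A1 B1 A B : biv) : c != 0 ->
  c%:P * A = G * A1 -> c%:P * B = G * B1 ->
  exists G' A' B' (w : {poly k}), [/\ w != 0, A = G' * A', B = G' * B',
    A1 = w%:P * A' & B1 = w%:P * B'].
Proof.
have [n le_n] := ubnP (size c); elim: n c G A1 B1 le_n => // n IH c G A1 B1 le_n c0 eA eB.
case: (leqP (size c) 1) => sc.
  have ec := size1_polyC sc; have c00 : c`_0 != 0 by apply: contraNneq c0 => z; rewrite ec z.
  move: (c`_0) ec c00 => u ec c00.
  exists ((u^-1)%:P%:P * G), A1, B1, 1; rewrite oner_neq0 !mul1r; split=> //.
    by rewrite -mulrA -eA ec mulrA -!polyCM mulVf // mul1r.
  by rewrite -mulrA -eB ec mulrA -!polyCM mulVf // mul1r.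
have [t /factor_theorem [c1 ec]] := closed_root sc.
have X0 : ('X - t%:P : {poly k}) != 0 by rewrite polyXsubC_eq0.
have XP0 : ('X - t%:P)%:P != 0 :> biv by rewrite polyC_eq0.
have c10 : c1 != 0 by apply: contraNneq c0 => z; rewrite ec z mul0r.
have sc1 : (size c1 < n)%N.
  by move: le_n; rewrite ec size_Mmonic ?monicXsubC // size_XsubC addn2 /= ltnS.
have ev0 (u : biv) : map_poly (horner_eval t) (c%:P * u) = 0.
  rewrite rmorphM /= map_polyC /= /horner_eval ec hornerM hornerXsubC subrr mulr0.
  by rewrite polyC0 mul0r.
have eA' := ev0 A; have eB' := ev0 B.
rewrite eA rmorphM /= in eA'; rewrite eB rmorphM /= in eB'.
case: (eqVneq (map_poly (horner_eval t) G) 0) => [/eval_coef_eq0 [G1 eG]|nG].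
  apply: (IH c1 G1 A1 B1) => //; apply: (mulfI XP0).
    by rewrite mulrA -polyCM [('X - _) * _]mulrC -ec eA eG mulrA.
  by rewrite mulrA -polyCM [('X - _) * _]mulrC -ec eB eG mulrA.
have [A2 eA2] : exists q, A1 = ('X - t%:P)%:P * q.
  by apply: eval_coef_eq0; move/eqP: eA'; rewrite mulf_eq0 (negPf nG) => /eqP.
have [B2 eB2] : exists q, B1 = ('X - t%:P)%:P * q.
  by apply: eval_coef_eq0; move/eqP: eB'; rewrite mulf_eq0 (negPf nG) => /eqP.
have [||G' [A' [B' [w [w0 h1 h2 h3 h4]]]]] := IH c1 G A2 B2 sc1 c10.
- by apply: (mulfI XP0); rewrite mulrA -polyCM [('X - _) * _]mulrC -ec eA eA2; ring.
- by apply: (mulfI XP0); rewrite mulrA -polyCM [('X - _) * _]mulrC -ec eB eB2; ring.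
exists G', A', B', (('X - t%:P) * w); split=> //; first by rewrite mulf_neq0.
  by rewrite eA2 h3 polyCM mulrA.
by rewrite eB2 h4 polyCM mulrA.
Qed.

(** Degrees in z and in t both add under multiplication; [swapXY] reduces the second case to the
    first. *)
Lemma in_box_factor m T (G q : biv) : G != 0 -> in_box m T (G * q) -> in_box m T q.
Proof.
move=> G0 [s t]; case: (eqVneq q 0) => [->|q0].
  by split=> [|i]; rewrite ?coef0 size_poly0.
have mulsize (A : idomainType) (u v : {poly A}) : u != 0 -> v != 0 ->
    (size v <= size (u * v)%R)%N.
  move=> u0 v0; rewrite size_mul //; move: u0; rewrite -size_poly_gt0.
  by case: (size u) => // l _; rewrite addSn leq_addl.
split; first exact: leq_trans (mulsize _ _ _ G0 q0) s.
move=> i; apply: leq_trans (max_size_coefXY _ _) _; rewrite sizeYE.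
apply: (leq_trans (mulsize _ (swapXY G) _ _ _)); rewrite ?swapXY_eq0 //.
rewrite -rmorphM -sizeYE; apply/bigmax_leqP => l _; exact: t.
Qed.

(** Dividing by a gcd over K would lose control of the degrees in t. With a common factor G over
    k[t], the quotients stay in the box of A and B and become coprime over K. *)
Lemma coprime_pair (K : fieldType) (f : {rmorphism {poly k} -> K}) m T (A B : biv) :
  injective f -> (forall x, exists u v, v != 0 /\ x = f u / f v) ->
  ~~ ((A == 0) && (B == 0)) -> in_box m T A -> in_box m T B ->
  exists G A1 B1 : biv, [/\ A = G * A1, B = G * B1, in_box m T A1, in_box m T B1 &
    coprimep (map_poly f A1) (map_poly f B1)].
Proof.
move=> f_inj f_frac nz bA bB.
have [c [g [a0 [b0 [c0 ea eb cop]]]]] := gauss_coprime f_inj f_frac nz.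
have [G [A1 [B1 [w [w0 eA eB ea0 eb0]]]]] := gauss_reduce c0 ea eb.
have G0 : G != 0.
  by apply: contraNneq nz => G0; rewrite eA eB G0 !mul0r eqxx.
exists G, A1, B1; split=> //.
- by apply: (in_box_factor G0); rewrite -eA.
- by apply: (in_box_factor G0); rewrite -eB.
move: cop; rewrite ea0 eb0 !rmorphM /= !map_polyC /= !mul_polyC.
have fw : f w != 0 by rewrite (inj_rmorph_eq0 f_inj).
by rewrite coprimepZl // coprimepZr.
Qed.

End GaussLemma.

(** * Heights of values of rational maps over k(t) *)

Section HeightBounds.
Variables (k : fieldType).
Local Notation biv := {poly {poly k}}.
Implicit Types (A B U V : biv) (p q u v c : {poly k}).

Lemma size_mul_bound u v m n : (size u <= m.+1)%N -> (size v <= n.+1)%N ->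
  (size (u * v)%R <= (m + n).+1)%N.
Proof.
move=> su sv; apply: leq_trans (size_polyMleq _ _) _; move: su sv.
by move: (size u) (size v) => a b ? ?; lia.
Qed.

Lemma size_hev n A m T p q h : in_box m T.+1 A -> (size p <= h.+1)%N ->
  (size q <= h.+1)%N -> (size (hev n A p q) <= (T + n * h).+1)%N.
Proof.
move=> [_ t] sp sq; apply: leq_trans (size_sum _ _ _) _; apply/bigmax_leqP => i _.
have -> : (n * h = i * h + (n - i) * h)%N by rewrite -mulnDl subnKC ?leq_ord.
rewrite -mulrA.
apply: size_mul_bound (t i) _; apply: size_mul_bound; exact: size_exp_bound.
Qed.

Lemma hev_mono n j c p q : (j <= n)%N ->
  hev n (c%:P * 'X^j) p q = c * p ^+ j * q ^+ (n - j).
Proof.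
move=> le; have lt : (j < n.+1)%N by [].
rewrite /hev (bigD1 (Ordinal lt)) //= coefCM coefXn eqxx mulr1 big1 ?addr0 // => i.
by rewrite -val_eqE /= => ne; rewrite coefCM coefXn (negPf ne) !(mulr0, mul0r).
Qed.

Lemma hev_lead n A p q : size A = n.+1 -> exists r,
  hev n A p q = lead_coef A * p ^+ n + q * r.
Proof.
move=> sA; exists (\sum_(i < n) A`_i * p ^+ i * q ^+ (n - i).-1).
rewrite /hev big_ord_recr /= subnn expr0 mulr1 lead_coefE sA addrC; congr (_ + _).
rewrite mulr_sumr; apply: eq_bigr => i _; rewrite mulrCA -exprS prednK //.
by rewrite subn_gt0.
Qed.

(** The rational root theorem over k[t]: q divides the leading coefficient and p the lowest nonzero
    one. The induction strips factors 'X until the constant term is nonzero. *)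
Lemma root_height A X m p q : A != 0 -> in_box m X.+1 A -> coprimep p q ->
  hev (size A).-1 A p q = 0 -> (size p <= X.+1)%N /\ (size q <= X.+1)%N.
Proof.
move=> A0 bA cop e; split; last first.
  have [|r er] := @hev_lead (size A).-1 A p q.
    by rewrite prednK // size_poly_gt0.
  have : q %| lead_coef A * p ^+ (size A).-1.
    have -> : lead_coef A * p ^+ (size A).-1 = q * - r.
      by apply/eqP; rewrite mulrN -addr_eq0 -er e.
    exact: dvdp_mulr.
  rewrite Gauss_dvdpl ?coprimep_expr // 1?coprimep_sym //.
  move/dvdp_leq; rewrite lead_coef_eq0 => /(_ A0) /leq_trans; apply.
  by have [_] := bA; apply.
have [n le_n] := ubnP (size A); elim: n A le_n A0 bA e => // n IH A le_n A0 bA e.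
case: (eqVneq p 0) => [->|p0]; first by rewrite size_poly0.
have [r er] : exists r, hev (size A).-1 A p q = A`_0 * q ^+ (size A).-1 + p * r.
  rewrite /hev big_ord_recl /= expr0 mulr1 subn0.
  exists (\sum_(i < (size A).-1) A`_i.+1 * p ^+ i * q ^+ ((size A).-1 - i.+1)).
  congr (_ + _); rewrite mulr_sumr; apply: eq_bigr => i _ /=.
  by rewrite exprS; ring.
case: (eqVneq A`_0 0) => [a0|a0]; last first.
  have : p %| A`_0 * q ^+ (size A).-1.
    have -> : A`_0 * q ^+ (size A).-1 = p * - r.
      by apply/eqP; rewrite mulrN -addr_eq0 -er e.
    exact: dvdp_mulr.
  rewrite Gauss_dvdpl ?coprimep_expr //.
  by move/dvdp_leq => /(_ a0) /leq_trans; apply; have [_] := bA; apply.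
have [A' eA] : exists A', A = A' * 'X.
  have : root A 0 by rewrite /root horner_coef0 a0.
  by case/factor_theorem => A'; rewrite subr0; exists A'.
have A'0 : A' != 0 by apply: contraNneq A0 => z; rewrite eA z mul0r.
have sA : size A = (size A').+1 by rewrite eA size_mulX.
apply: (IH A') => //.
- by move: le_n; rewrite sA.
- have [s t] := bA; split=> [|i]; first by rewrite sA in s; exact: ltnW.
  by have := t i.+1; rewrite eA coefMX.
apply: (mulfI p0); rewrite mulr0 -e sA /= {1}eA.
have [l el] : exists l, size A' = l.+1 by exists (size A').-1; rewrite prednK // size_poly_gt0.
have hX : hev 1 'X p q = p.
  by rewrite /hev big_ord_recl big_ord1 /= !coefX /= !mul0r add0r mul1r expr1 expr0 mulr1.
by rewrite el /= -[l.+1]addn1 hevM ?el ?size_polyX // hX mulrC.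
Qed.

(** A map of degree e multiplies heights by e up to a bounded error. With N = 2 e - 1, the common
    factor E of the values of A and B at (p, q) divides c0 q^N and c1 p^N, hence c0 c1, so its
    degree is bounded. Whichever of p and q has degree h, the corresponding Bezout identity bounds N
    h by (e - 1) h + h1 plus a multiple of X. *)
Lemma height_bound (K : fieldType) (f : {rmorphism {poly k} -> K}) A B e X p q h u v h1 :
  injective f -> (0 < e)%N -> in_box e.+1 X.+1 A -> in_box e.+1 X.+1 B ->
  coprimep (map_poly f A) (map_poly f B) -> maxn (size A) (size B) = e.+1 ->
  coprimep p q -> maxn (size p) (size q) = h.+1 ->
  coprimep u v -> (size u <= h1.+1)%N -> (size v <= h1.+1)%N ->
  hev e A p q * u = hev e B p q * v ->
  (e * h <= h1 + (2 * X + 3 * (2 * e * X)))%N.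
Proof.
move=> f_inj e0 bA bB cop sz cpq sh cuv su sv E0; set Y := (2 * e * X)%N.
have mp_inj : injective (map_poly f) by apply: map_inj_poly => //; rewrite rmorph0.
have smp (w : biv) : size (map_poly f w) = size w by rewrite size_map_inj_poly ?rmorph0.
have ind U V : (size U <= e)%N -> (size V <= e)%N -> U * A + V * B = 0 -> U = 0 /\ V = 0.
  move=> sU sV Ez.
  have fE : map_poly f U * map_poly f A = - (map_poly f V * map_poly f B).
    by apply/eqP; rewrite -addr_eq0 -!rmorphM -rmorphD Ez rmorph0.
  have big (W C D : biv) : (size W <= e)%N -> size C = e.+1 ->
      coprimep (map_poly f D) (map_poly f C) ->
      map_poly f C %| map_poly f W * map_poly f D -> W = 0.
    move=> sW sC cDC; rewrite Gauss_dvdpl 1?coprimep_sym // => dv.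
    apply/eqP/negPn/negP => W0; have fW0 : map_poly f W != 0 by rewrite -size_poly_eq0 smp size_poly_eq0.
    by have := dvdp_leq fW0 dv; rewrite !smp sC leqNgt ltnS sW.
  have : (e < size A)%N || (e < size B)%N by rewrite -leq_max sz.
  have [sA _] := bA; have [sB _] := bB.
  case/orP => lt.
    have sAe : size A = e.+1 by apply/eqP; rewrite eqn_leq sA.
    have V0 : V = 0.
      apply: (big V A B) => //; first by rewrite coprimep_sym.
      by rewrite -(opprK (_ * _)) -fE dvdpNr dvdp_mull.
    split=> //; move: Ez; rewrite V0 mul0r addr0 => /eqP; rewrite mulf_eq0 => /orP [/eqP //|].
    by rewrite -size_poly_eq0 sAe.
  have sBe : size B = e.+1 by apply/eqP; rewrite eqn_leq sB.
  have U0 : U = 0 by apply: (big U B A) => //; rewrite fE dvdpNr dvdp_mull.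
  split=> //; move: Ez; rewrite U0 mul0r add0r => /eqP; rewrite mulf_eq0 => /orP [/eqP //|].
  by rewrite -size_poly_eq0 sBe.
pose N := (2 * e).-1; have eN : N.+1 = (2 * e)%N by rewrite prednK // muln_gt0.
have eN' : N = (e.-1 + e)%N.
  by apply: succn_inj; rewrite eN -addSn prednK // addnn mul2n.
have lt0 : (0 < 2 * e)%N by rewrite -eN.
have [U0 [V0 [c0 [bU0 bV0 c00 sc0 E1]]]] := @bezout _ A B e X 0 bA bB ind lt0.
have ltN : (N < 2 * e)%N by rewrite -eN.
have [U1 [V1 [c1 [bU1 bV1 c10 sc1 E2]]]] := @bezout _ A B e X N bA bB ind ltN.
have [[s t] /= st] := Bezout_eq1_coprimepP _ _ cuv.
pose a := hev e A p q; pose b := hev e B p q; pose E := s * b + t * a.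
have eab : a * u = b * v by [].
have Ev : a = E * v.
  have -> : E * v = (s * u + t * v) * a.
    transitivity (s * (b * v) + t * a * v); first by rewrite /E; ring.
    by rewrite -eab; ring.
  by rewrite st mul1r.
have Eu : b = E * u.
  have -> : E * u = (s * u + t * v) * b.
    transitivity (s * b * u + t * (a * u)); first by rewrite /E; ring.
    by rewrite eab; ring.
  by rewrite st mul1r.
have evalUV U V c j : (size U <= e)%N -> (size V <= e)%N -> (j <= N)%N ->
    U * A + V * B = c%:P * 'X^j ->
    c * p ^+ j * q ^+ (N - j) = E * (hev e.-1 U p q * v + hev e.-1 V p q * u).
  move=> sU sV le; have [sA _] := bA; have [sB _] := bB.
  move/(congr1 (fun w => hev N w p q)); rewrite hev_mono // => <-.
  rewrite hevD eN' !hevM ?prednK //; rewrite -/a -/b.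
  by rewrite {1}Ev {1}Eu; ring.
have [sU0 tU0] := bU0; have [sV0 tV0] := bV0; have [sU1 tU1] := bU1; have [sV1 tV1] := bV1.
have Q1 := evalUV _ _ _ _ sU0 sV0 (leq0n _) E1.
have Q2 := evalUV _ _ _ _ sU1 sV1 (leqnn _) E2.
rewrite expr0 mulr1 subn0 in Q1; rewrite subnn expr0 mulr1 in Q2.
have dvE : E %| c0 * c1.
  have cN : coprimep (p ^+ N) (q ^+ N) by rewrite coprimep_expl ?coprimep_expr.
  have [[x y] /= xy] := Bezout_eq1_coprimepP _ _ cN.
  have -> : c0 * c1 = (x * c0) * (c1 * p ^+ N) + (y * c1) * (c0 * q ^+ N).
    by rewrite -[LHS]mulr1 -xy; ring.
  by rewrite Q1 Q2; apply: dvdp_add; rewrite mulrCA dvdp_mulr.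
have c01 : c0 * c1 != 0 by rewrite mulf_neq0.
have sE : (size E <= (2 * (X + Y)).+1)%N.
  apply: leq_trans (dvdp_leq c01 dvE) _.
  by rewrite mul2n -addnn; apply: size_mul_bound.
have sp : (size p <= h.+1)%N by rewrite -sh leq_maxl.
have sq : (size q <= h.+1)%N by rewrite -sh leq_maxr.
have degb U V c w : in_box e Y.+1 U -> in_box e Y.+1 V -> c != 0 -> w != 0 ->
    c * w ^+ N = E * (hev e.-1 U p q * v + hev e.-1 V p q * u) ->
    (N * (size w).-1 <= 2 * (X + Y) + (Y + e.-1 * h + h1))%N.
  move=> bU bV cc0 w0 Ew; have sw : (size (c * w ^+ N)%R <= (2 * (X + Y) + (Y + e.-1 * h + h1)).+1)%N.
    rewrite Ew; apply: size_mul_bound sE _.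
    apply: leq_trans (size_polyD _ _) _; rewrite geq_max.
    by rewrite !size_mul_bound // (size_hev _ bU, size_hev _ bV).
  rewrite -ltnS; apply: leq_trans sw; rewrite size_mul ?expf_neq0 //.
  have -> : size (w ^+ N) = ((size w).-1 * N).+1.
    by rewrite -[LHS]prednK ?size_poly_gt0 ?expf_neq0 // size_exp.
  rewrite addnS /= mulnC -[X in (X < _)%N]add0n ltn_add2r size_poly_gt0 //.
have fin : (N * h <= 2 * (X + Y) + (Y + e.-1 * h + h1))%N.
  have : (h < size p)%N || (h < size q)%N by rewrite -leq_max sh.
  case/orP => lt.
    have p0 : p != 0 by rewrite -size_poly_gt0 (leq_ltn_trans _ lt).
    by apply: leq_trans (degb _ _ _ _ bU1 bV1 c10 p0 Q2); rewrite leq_mul2l -ltnS prednK ?size_poly_gt0 // lt orbT.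
  have q0 : q != 0 by rewrite -size_poly_gt0 (leq_ltn_trans _ lt).
  by apply: leq_trans (degb _ _ _ _ bU0 bV0 c00 q0 Q1); rewrite leq_mul2l -ltnS prednK ?size_poly_gt0 // lt orbT.
move: fin; rewrite eN' mulnDl -/Y; move: (e.-1 * h)%N (e * h)%N => ? ?; lia.
Qed.

End HeightBounds.

(** * Approximation by rational functions *)

Section Valuation.
Variables (R : realFieldType) (k : closedFieldType) (K L : fieldType).
Variables (f : {rmorphism {poly k} -> K}) (iota : {rmorphism K -> L}).
Variables (al : L) (w : L -> R).
Local Notation biv := {poly {poly k}}.
Local Notation fp := (iota \o f).
Local Notation ev A x := (map_poly fp A).[x].

(** The ring K[al], stable under the sums and products below and contained in the domain K(al) of
    the valuation ([adjoin_in_adjoin]). *)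
Definition in_adjoin (y : L) : Prop := exists P : {poly K}, y = (map_poly iota P).[al].

Hypothesis f_inj : injective f.
Hypothesis wM : forall x y, in_adjoin x -> in_adjoin y -> x != 0 -> y != 0 ->
  w (x * y) = w x + w y.
Hypothesis wD : forall x y, in_adjoin x -> in_adjoin y -> x != 0 -> y != 0 ->
  x + y != 0 -> Num.min (w x) (w y) <= w (x + y).
Hypothesis wK : forall u v, u != 0 -> v != 0 ->
  w (iota (f u / f v)) = (size v)%:R - (size u)%:R.

(** The value of w at 0 is junk, and 0 is treated as having infinite valuation. Membership in K[al]
    is carried along because the axioms on w are restricted to it. *)
Definition val_ge c y : Prop := in_adjoin y /\ (y != 0 -> c <= w y).

Lemma in_adjoinD x y : in_adjoin x -> in_adjoin y -> in_adjoin (x + y).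
Proof. by move=> [P ->] [Q ->]; exists (P + Q); rewrite rmorphD hornerD. Qed.

Lemma in_adjoinM x y : in_adjoin x -> in_adjoin y -> in_adjoin (x * y).
Proof. by move=> [P ->] [Q ->]; exists (P * Q); rewrite rmorphM hornerM. Qed.

Lemma in_adjoin_base r : in_adjoin (iota r).
Proof. by exists r%:P; rewrite map_polyC hornerC. Qed.

Lemma in_adjoin_gen : in_adjoin al.
Proof. by exists 'X; rewrite map_polyX hornerX. Qed.

Lemma val_geD c x y : val_ge c x -> val_ge c y -> val_ge c (x + y).
Proof.
move=> [ax hx] [ay hy]; split; first exact: in_adjoinD.
case: (eqVneq x 0) => [->|x0]; first by rewrite add0r.
case: (eqVneq y 0) => [->|y0]; first by rewrite addr0.
move=> xy0; apply: le_trans (wD ax ay x0 y0 xy0).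
by rewrite le_min hx // hy.
Qed.

Lemma val_geM c d x y : val_ge c x -> val_ge d y -> val_ge (c + d) (x * y).
Proof.
move=> [ax hx] [ay hy]; split; first exact: in_adjoinM.
by rewrite mulf_eq0 negb_or => /andP [x0 y0]; rewrite wM // lerD ?hx ?hy.
Qed.

Lemma val_geW c d x : d <= c -> val_ge c x -> val_ge d x.
Proof. by move=> le [ax hx]; split=> // /hx; apply: le_trans. Qed.

Lemma val_ge_base m (u : {poly k}) : (size u <= m.+1)%N -> val_ge (- m%:R) (fp u).
Proof.
move=> su; split; first exact: in_adjoin_base.
rewrite fmorph_eq0 (inj_rmorph_eq0 f_inj) => u0.
have := @wK u 1 u0 (oner_neq0 _); rewrite rmorph1 divr1 => ->.
by rewrite size_poly1 lerNl opprB lerBlDr natr1 ler_nat.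
Qed.

Lemma val_ge0 c : val_ge c 0.
Proof. by split; [rewrite -(rmorph0 iota); exact: in_adjoin_base | rewrite eqxx]. Qed.

Lemma val_ge1 : val_ge 0 1.
Proof.
have := @val_ge_base 0 1; rewrite size_poly1 oppr0 /= !rmorph1; exact.
Qed.

Lemma val_geN c x : val_ge c x -> val_ge c (- x).
Proof.
move=> h; rewrite -mulN1r -[c]add0r; apply: val_geM => //.
have := @val_ge_base 0 (-1); rewrite size_polyN size_poly1 oppr0 /= !rmorphN !rmorph1; exact.
Qed.

Lemma val_ge_sum c (I : finType) (F : I -> L) :
  (forall i, val_ge c (F i)) -> val_ge c (\sum_i F i).
Proof. by move=> h; apply: big_ind => // [|x y]; [exact: val_ge0 | exact: val_geD]. Qed.

Lemma val_geX c x n : val_ge c x -> val_ge (n%:R * c) (x ^+ n).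
Proof.
move=> h; elim: n => [|n IH]; first by rewrite mul0r; exact: val_ge1.
by rewrite exprS -natr1 mulrDl mul1r addrC; apply: val_geM.
Qed.

Lemma val_geXW c x n m : 0 <= c -> (n <= m)%N -> val_ge (- c) x ->
  val_ge (- (m%:R * c)) (x ^+ n).
Proof.
move=> c0 le /(val_geX n); apply: val_geW.
by rewrite mulrN lerN2 ler_wpM2r // ler_nat.
Qed.

Variables (p : nat) (pL : p \in [pchar L]) (e : nat).
Local Notation s := (p ^ e)%N.

Lemma frobenius_sub (x y : L) : (x - y) ^+ s = x ^+ s - y ^+ s.
Proof. exact: (rmorphB (frp e pL)). Qed.

Lemma ev_coef (A : biv) m x : (size A <= m.+1)%N ->
  ev A x = \sum_(i < m.+1) fp A`_i * x ^+ i.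
Proof.
move=> sA; rewrite (@horner_coef_wide _ m.+1); last exact: leq_trans (size_poly _ _) sA.
by apply: eq_bigr => i _; rewrite coef_map.
Qed.

(** Split the value into - A(r2) (al - r1)^s, where Frobenius multiplies the quality of r1 by s, and
    A(r2) al^s - B(r2), which would vanish at r2 = al and so contains the factor al - r2. The terms
    in [rho] pay for a possible pole of al. *)
Lemma near_vanish a X (A B : biv) (rho t1 t2 : R) (r1 r2 : K) :
  in_box a.+1 X.+1 A -> in_box a.+1 X.+1 B ->
  ev A al * al ^+ s = ev B al -> 0 <= rho -> val_ge (- rho) al ->
  0 <= t2 -> val_ge t1 (al - iota r1) -> val_ge t2 (al - iota r2) ->
  val_ge (Num.min (s%:R * t1) t2 - X%:R - (s + a)%:R * rho)
    (ev A (iota r2) * iota r1 ^+ s - ev B (iota r2)).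
Proof.
move=> [sA tA] [sB tB] rel rho0 hal t20 h1 h2.
set x2 := iota r2 in h2 *; set x1 := iota r1 in h1 *.
have hx2 : val_ge (- rho) x2.
  have -> : x2 = al + - (al - x2) by ring.
  apply: val_geD => //; apply: val_geN; apply: val_geW h2.
  by apply: le_trans t20; rewrite oppr_le0.
have hA : val_ge (- X%:R + - (a%:R * rho)) (ev A x2).
  rewrite (ev_coef _ sA); apply: val_ge_sum => i; apply: val_geM.
    exact: val_ge_base.
  by apply: val_geXW => //; exact: leq_ord.
have hdiff : val_ge (t2 + (- X%:R - s%:R * rho - a%:R * rho))
    (ev A x2 * al ^+ s - ev B x2).
  have -> : ev A x2 * al ^+ s - ev B x2 =
      \sum_(i < a.+1) (- (al - x2)) * ((fp A`_i * al ^+ s - fp B`_i) *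
        \sum_(j < i) x2 ^+ (i.-1 - j) * al ^+ j).
    transitivity (ev A x2 * al ^+ s - ev B x2 - (ev A al * al ^+ s - ev B al)).
      by rewrite rel subrr subr0.
    rewrite !(ev_coef _ sA) !(ev_coef _ sB) !mulr_suml -!sumrB; apply: eq_bigr => i _.
    move: (al ^+ s) => u.
    transitivity ((fp A`_i * u - fp B`_i) * (x2 ^+ i - al ^+ i)); first by ring.
    by rewrite subrXX; ring.
  apply: val_ge_sum => i; apply: val_geM; first exact: val_geN.
  apply: val_geM.
    apply: val_geD.
      apply: val_geM; first exact: val_ge_base.
      by have := val_geX s hal; rewrite mulrN.
    apply: val_geN; apply: val_geW (val_ge_base (tB i)).
    by rewrite lerBlDr lerDl mulr_ge0.
  apply: val_ge_sum => j.
  have le_j : (j <= i.-1)%N by rewrite -ltnS (ltn_predK (ltn_ord j)).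
  apply: val_geW (val_geM (val_geX (i.-1 - j) hx2) (val_geX j hal)).
  rewrite -mulrDl -natrD subnK // mulrN lerN2 ler_wpM2r // ler_nat.
  by rewrite (leq_trans (leq_pred _)) // leq_ord.
have -> : ev A x2 * x1 ^+ s - ev B x2 =
    ev A x2 * - (al - x1) ^+ s + (ev A x2 * al ^+ s - ev B x2).
  by rewrite frobenius_sub; move: (al ^+ s) (x1 ^+ s) => u v; ring.
have sr : (s + a)%:R * rho = s%:R * rho + a%:R * rho :> R by rewrite natrD mulrDl.
have s_rho : 0 <= s%:R * rho by rewrite mulr_ge0.
apply: val_geD.
  apply: val_geW (val_geM hA (val_geN (val_geX s h1))).
  rewrite sr; have : Num.min (s%:R * t1) t2 <= s%:R * t1 by rewrite ge_min lexx.
  move: (Num.min (s%:R * t1) t2) (s%:R * t1) (s%:R * rho) (a%:R * rho) s_rho => *; lra.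
apply: val_geW hdiff.
rewrite sr; have : Num.min (s%:R * t1) t2 <= t2 by rewrite ge_min lexx orbT.
move: (Num.min (s%:R * t1) t2) (s%:R * rho) (a%:R * rho) => *; lra.
Qed.

(** The valuation of a nonzero N/M is deg M - deg N, at most the degree of the denominator M = q2^a
    q1^s. *)
Lemma vanish_or_large a (A B : biv) n0 n1 (p1 q1 p2 q2 : {poly k}) c :
  (size A <= a.+1)%N -> (size B <= a.+1)%N -> q1 != 0 -> q2 != 0 ->
  (size q1 <= n0.+1)%N -> (size q2 <= n1.+1)%N ->
  val_ge c (ev A (iota (f p2 / f q2)) * iota (f p1 / f q1) ^+ s -
    ev B (iota (f p2 / f q2))) ->
  hev a A p2 q2 * p1 ^+ s = hev a B p2 q2 * q1 ^+ s \/ c <= (a * n1 + s * n0)%:R.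
Proof.
move=> sA sB q10 q20 s1 s2 [_]; set Z := _ - _.
pose N := hev a A p2 q2 * p1 ^+ s - hev a B p2 q2 * q1 ^+ s.
pose M := q2 ^+ a * q1 ^+ s; have M0 : M != 0 by rewrite mulf_neq0 ?expf_neq0.
case: (eqVneq N 0) => [/eqP|N0]; first by rewrite subr_eq0 => /eqP; left.
have ev_hev (C : biv) : (size C <= a.+1)%N ->
    ev C (iota (f p2 / f q2)) = fp (hev a C p2 q2) / fp q2 ^+ a.
  move=> sC; have q2' : fp q2 != 0 by rewrite /= fmorph_eq0 (inj_rmorph_eq0 f_inj).
  rewrite (hev_map fp) hev_frac ?(leq_trans (size_poly _ _)) // [RHS]mulrAC.
  by rewrite divff ?expf_neq0 // mul1r /= fmorph_div.
have eZ : Z = iota (f N / f M).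
  rewrite /Z !ev_hev // /N /M !(rmorphB, rmorphM, rmorphXn, fmorphV) /=.
  rewrite expr_div_n; field.
  by rewrite !expf_neq0 // fmorph_eq0 (inj_rmorph_eq0 f_inj).
rewrite eZ fmorph_eq0 mulf_eq0 invr_eq0 !(inj_rmorph_eq0 f_inj) negb_or N0 M0 wK // => le.
right; apply: le_trans (le _) _ => //; rewrite lerBlDr -natrD ler_nat.
have sM : (size M <= (a * n1 + s * n0).+1)%N.
  by apply: size_mul_bound; apply: size_exp_bound.
apply: leq_trans sM _; rewrite -addn1 leq_add2l size_poly_gt0 //.
Qed.

End Valuation.

(** * From a vanishing value to a Moebius relation *)

Section MoebiusExtraction.
Variables (k : closedFieldType) (K L : fieldType).
Variables (f : {rmorphism {poly k} -> K}) (iota : {rmorphism K -> L}).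
Local Notation biv := {poly {poly k}}.
Hypothesis f_inj : injective f.
Hypothesis f_frac : forall x, exists u v, v != 0 /\ x = f u / f v.

Lemma hev_pad n m (C : biv) p q : (size C <= n.+1)%N ->
  hev (n + m) C p q = hev n C p q * q ^+ m.
Proof.
move=> sC; rewrite -[C in LHS]mulr1 hevM ?size_poly1 //; congr (_ * _).
by have := @hev_mono k m 0 1 p q (leq0n _); rewrite mul1r expr0 mulr1 subn0 mul1r.
Qed.

(** The inequalities exclude everything else: X < h2 keeps r2 from being a root of the common factor
    G; X < s h1 rules out m = 0, where r1^s would have height at most X; the last one rules out m >=
    2 by [height_bound], whose error (2 + 6 m) X is at most (2 + 6 a) X. *)
Lemma moebius_of_vanish al D a X s (A B : biv) (p1 q1 p2 q2 : {poly k}) h1 h2 :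
  has_degree iota al D -> (a < D)%N -> (0 < s)%N ->
  in_box a.+1 X.+1 A -> in_box a.+1 X.+1 B -> ~~ ((A == 0) && (B == 0)) ->
  (map_poly (iota \o f) A).[al] * al ^+ s = (map_poly (iota \o f) B).[al] ->
  coprimep p1 q1 -> maxn (size p1) (size q1) = h1.+1 ->
  coprimep p2 q2 -> maxn (size p2) (size q2) = h2.+1 -> q1 != 0 -> q2 != 0 ->
  (0 < h1)%N -> (X < h2)%N -> (X < s * h1)%N -> (s * h1 + (2 + 6 * a) * X < 2 * h2)%N ->
  hev a A p2 q2 * p1 ^+ s = hev a B p2 q2 * q1 ^+ s ->
  exists A1 B1 : {poly K}, [/\ coprimep A1 B1, maxn (size A1) (size B1) = 2 &
    (map_poly iota A1).[al] * al ^+ s = (map_poly iota B1).[al]].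
Proof.
move=> hal aD s0 bA bB nz rel cop1 sz1 cop2 sz2 q10 q20 h1_gt0 Xh2 Xh1 lt van.
have [G [A1 [B1 [eA eB bA1 bB1 cop]]]] := coprime_pair f_inj f_frac nz bA bB.
have G0 : G != 0 by apply: contraNneq nz => G0; rewrite eA eB G0 !mul0r eqxx.
have nz1 : ~~ ((A1 == 0) && (B1 == 0)).
  by apply: contraNN nz => /andP [/eqP z1 /eqP z2]; rewrite eA eB z1 z2 !mulr0 eqxx.
have max_gt0 : (0 < maxn (size A1) (size B1))%N.
  by rewrite leq_max !size_poly_gt0 -negb_and.
pose m := (maxn (size A1) (size B1)).-1.
have sm : maxn (size A1) (size B1) = m.+1 by rewrite prednK.
have [sA1 sB1] : (size A1 <= m.+1)%N /\ (size B1 <= m.+1)%N.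
  by rewrite -sm leq_maxl leq_maxr.
have [ma sG] : (m <= a)%N /\ (size G <= (a - m).+1)%N.
  have bound (u : biv) : u != 0 -> (size (G * u)%R <= a.+1)%N -> size u = m.+1 ->
      (m <= a)%N /\ (size G <= (a - m).+1)%N.
    move=> u0; rewrite size_mul // => + eu; rewrite eu addnS /= => le.
    have le_ma : (m <= a)%N.
      by rewrite -ltnS; apply: leq_trans le; rewrite -add1n leq_add2r size_poly_gt0.
    by rewrite -subSn // leq_subRL ?(leq_trans le_ma) // addnC.
  have : (m < size A1)%N || (m < size B1)%N by rewrite -leq_max sm.
  case/orP => lt'.
    apply: (bound A1); rewrite -?eA //; first by rewrite -size_poly_gt0 (leq_ltn_trans _ lt').
      by case: bA.
    by apply/eqP; rewrite eqn_leq sA1.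
  apply: (bound B1); rewrite -?eB //; first by rewrite -size_poly_gt0 (leq_ltn_trans _ lt').
    by case: bB.
  by apply/eqP; rewrite eqn_leq sB1.
have ea : a = (a - m + m)%N by rewrite subnK.
have bG : in_box a.+1 X.+1 G.
  have bound (u : biv) : u != 0 -> in_box a.+1 X.+1 (G * u) -> in_box a.+1 X.+1 G.
    by move=> u0; rewrite mulrC; exact: in_box_factor.
  case: (eqVneq A1 0) nz1 => [_ /=|A10 _]; last by apply: (bound A1); rewrite -?eA.
  by move=> B10; apply: (bound B1); rewrite -?eB.
have hG : hev (a - m) G p2 q2 != 0.
  have -> : (a - m = (size G).-1 + (a - m - (size G).-1))%N.
    by rewrite subnKC // -ltnS prednK ?size_poly_gt0.
  rewrite hev_pad ?prednK ?size_poly_gt0 // mulf_neq0 ?expf_neq0 //.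
  apply/eqP => /(root_height G0 bG cop2) [l1 l2].
  by move: Xh2; rewrite -ltnS -sz2 ltnNge geq_max l1 l2.
have van1 : hev m A1 p2 q2 * p1 ^+ s = hev m B1 p2 q2 * q1 ^+ s.
  by apply: (mulfI hG); rewrite !mulrA -!hevM // -ea -eA -eB.
have sp1 : (size p1 <= h1.+1)%N by rewrite -sz1 leq_maxl.
have sq1 : (size q1 <= h1.+1)%N by rewrite -sz1 leq_maxr.
have cop1s : coprimep (p1 ^+ s) (q1 ^+ s) by rewrite coprimep_expl ?coprimep_expr.
case: (posnP m) => [m0|m_gt0].
  exfalso; have [sA _] := bA1; have [sB _] := bB1.
  rewrite m0 in van1 sA1 sB1; have eA1 := size1_polyC sA1; have eB1 := size1_polyC sB1.
  rewrite /hev !big_ord1 !expr0 !mulr1 in van1.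
  have p10 : p1 != 0.
    apply: contraTneq h1_gt0 => z; move: cop1 sz1; rewrite z coprime0p -size_poly_eq1.
    by move=> /eqP ->; rewrite size_poly0 max0n => -[<-].
  have A10 : A1`_0 != 0.
    apply/eqP => z; rewrite z mul0r in van1; move/esym/eqP: van1.
    rewrite mulf_eq0 expf_eq0 (negPf q10) andbF orbF => /eqP z'.
    by move: nz1; rewrite eA1 eB1 z z' eqxx.
  have B10 : B1`_0 != 0.
    apply/eqP => z; rewrite z mul0r in van1; move/eqP: van1.
    by rewrite mulf_eq0 expf_eq0 (negPf p10) andbF orbF (negPf A10).
  have d1 : p1 ^+ s %| B1`_0.
    by rewrite -(Gauss_dvdpl _ cop1s) -van1 dvdp_mull.
  have d2 : q1 ^+ s %| A1`_0.
    have cop1s' : coprimep (q1 ^+ s) (p1 ^+ s) by rewrite coprimep_sym.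
    by rewrite -(Gauss_dvdpl _ cop1s') van1 dvdp_mull.
  have b1 := leq_trans (dvdp_leq B10 d1) (proj2 bB1 0%N).
  have b2 := leq_trans (dvdp_leq A10 d2) (proj2 bA1 0%N).
  have szX (u : {poly k}) : u != 0 -> (size (u ^+ s)%R <= X.+1)%N -> ((size u).-1 * s <= X)%N.
    by move=> u0; rewrite -size_exp; case: (size _).
  have : (h1 < size p1)%N || (h1 < size q1)%N by rewrite -leq_max sz1.
  case/orP => lt'.
    have e1 : size p1 = h1.+1 by apply/eqP; rewrite eqn_leq sp1.
    by have := szX _ p10 b1; rewrite e1 /= mulnC leqNgt Xh1.
  have e1 : size q1 = h1.+1 by apply/eqP; rewrite eqn_leq sq1.
  by have := szX _ q10 b2; rewrite e1 /= mulnC leqNgt Xh1.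
have bA1' : in_box m.+1 X.+1 A1 by case: bA1.
have bB1' : in_box m.+1 X.+1 B1 by case: bB1.
have := height_bound f_inj m_gt0 bA1' bB1' cop sm cop2 sz2 cop1s
  (size_exp_bound s sp1) (size_exp_bound s sq1) van1.
move=> le; have m1 : m = 1%N.
  apply/eqP; rewrite eqn_leq m_gt0 andbT leqNgt; apply/negP => m2.
  have : (2 * h2 <= s * h1 + (2 + 6 * a) * X)%N.
    apply: (@leq_trans (m * h2)); first by rewrite leq_mul2r m2 orbT.
    apply: leq_trans le _; rewrite leq_add2l mulnDl leq_add2l !mulnA leq_mul2r.
    by rewrite leq_mul2l ma !orbT.
  by rewrite leqNgt lt.
exists (map_poly f A1), (map_poly f B1); split=> //.
  by rewrite !size_map_inj_poly ?rmorph0 // sm m1.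
have Gal : (map_poly iota (map_poly f G)).[al] != 0.
  apply/eqP => rG; have : map_poly f G = 0.
    apply: (has_degree_small hal); first exact/eqP.
    rewrite size_map_inj_poly ?rmorph0 //; apply: leq_trans sG _.
    by apply: leq_ltn_trans aD; rewrite leq_subr.
  by move/eqP; rewrite -size_poly_eq0 size_map_inj_poly ?rmorph0 // size_poly_eq0 (negPf G0).
have eAm : map_poly (iota \o f) A = map_poly iota (map_poly f G) * map_poly iota (map_poly f A1).
  by rewrite eA map_poly_comp !rmorphM.
have eBm : map_poly (iota \o f) B = map_poly iota (map_poly f G) * map_poly iota (map_poly f B1).
  by rewrite eB map_poly_comp !rmorphM.
by apply: (mulfI Gal); rewrite mulrA -!hornerM -eAm -eBm.
Qed.

End MoebiusExtraction.

(* Two heights h with the same trunc_log-normalized value n * h %/ p ^ trunc_log p h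
   have a ratio close to a power of p. *)
Lemma height_pigeonhole (P : nat -> Prop) p n H0 : (1 < p)%N -> (0 < n)%N ->
  (forall H, exists2 h, (H <= h)%N & P h) ->
  exists h1 h2 e, [/\ P h1 /\ P h2, (H0 <= h1)%N, (0 < e)%N,
    (n * (p ^ e * h1) < n.+1 * h2)%N & (n * h2 < n.+1 * (p ^ e * h1))%N].
Proof.
move=> p1 n0 unb; have p0 := ltnW p1.
have [nx nxP] : exists nx : nat -> nat, forall H, (H <= nx H)%N /\ P (nx H).
  have ex H : exists h, (H <= h)%N /\ P h by have [h] := unb H; exists h.
  have [nx nxP] := choice ex; by exists nx.
(* Consecutive heights grow at least by the factor p, so their logarithms [t i] strictly increase
   and the final exponent e is positive. *)
pose h i := iter i (fun x => nx (p * x)%N) (nx (maxn H0 1)).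
have hP i : P (h i) by case: i => [|i]; exact: (nxP _).2.
have hS i : (p * h i <= h i.+1)%N by exact: (nxP _).1.
have h0 : (maxn H0 1 <= h 0)%N by exact: (nxP _).1.
have hmono i j : (h i <= h (j + i))%N.
  elim: j => // j; rewrite addSn => /leq_trans; apply; apply: leq_trans (hS _).
  by rewrite leq_pmull.
have h_gt0 i : (0 < h i)%N.
  by apply: leq_trans (_ : h 0 <= _)%N; [rewrite (leq_trans _ h0) // leq_maxr | rewrite -[i]addn0 hmono].
have hH0 i : (H0 <= h i)%N.
  by apply: leq_trans (_ : h 0 <= _)%N; [rewrite (leq_trans _ h0) // leq_maxl | rewrite -[i]addn0 hmono].
pose t i := trunc_log p (h i).
have tb i : (p ^ t i <= h i < p ^ (t i).+1)%N by exact: trunc_log_bounds.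
pose c i := (n * h i %/ p ^ t i)%N.
have pt_gt0 i : (0 < p ^ t i)%N by rewrite expn_gt0 p0.
have c_lt i : (c i < n * p)%N.
  rewrite ltn_divLR // -mulnA -expnS ltn_pmul2l //; by case/andP: (tb i).
have [i [j [ltij eqc]]] : exists i j, (i < j)%N /\ c i = c j.
  pose F (i : 'I_(n * p).+1) : 'I_(n * p) := Ordinal (c_lt i).
  have : ~ injective F.
    by move=> /leq_card; rewrite !card_ord ltnn.
  move=> ninj.
  have : ~~ injectiveb F by apply/negP => /injectiveP.
  case/injectivePn => x [y nxy /(congr1 val) /= e].
  case: (ltngtP x y) => [lt|lt|/val_inj exy]; last by rewrite exy eqxx in nxy.
    by exists x, y.
  by exists y, x.
have lt_t : (t i < t j)%N.
  have hij : (p * h i <= h j)%N.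
    by apply: leq_trans (hS i) _; rewrite -(subnK ltij) hmono.
  have /andP [l1 _] := tb i; have /andP [_ l2] := tb j.
  rewrite -ltnS -(ltn_exp2l _ _ p1); apply: leq_ltn_trans l2.
  by apply: leq_trans hij; rewrite expnS leq_mul2l l1 orbT.
pose e := (t j - t i)%N; have te : (t j = e + t i)%N by rewrite subnK // ltnW.
exists (h i), (h j), e; split=> //; first by rewrite subn_gt0.
- have : (n * (p ^ e * h i) < (c i).+1 * p ^ t j)%N.
    rewrite te expnD mulnCA [X in (_ < X)%N]mulnCA ltn_pmul2l ?expn_gt0 ?p0 //.
    by rewrite -ltn_divLR.
  move/leq_trans; apply; rewrite eqc mulSn [X in (_ <= X)%N]mulSn.
  have /andP [l2 _] := tb j; apply: leq_add => //; exact: leq_divM.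
have : (n * h j < (c j).+1 * p ^ t j)%N by rewrite -ltn_divLR.
move/leq_trans; apply; rewrite -eqc mulSn [X in (_ <= X)%N]mulSn te expnD.
have /andP [l1 _] := tb i; apply: leq_add; first by rewrite leq_mul2l l1 orbT.
by rewrite mulnCA [X in (_ <= X)%N]mulnCA leq_mul2l leq_divM orbT.
Qed.

(** Applied with x = q h1, y = X, z = (2 + 6 a) X and h = h2: x < 5h/4 and z <= x/4 give x + z <
    25h/16 < 2h. *)
Lemma window_nat x h y z : (4 * x < 5 * h)%N -> (2 * y <= x)%N -> (4 * z <= x)%N ->
  (0 < x)%N -> [/\ (y < h)%N, (x + z < 2 * h)%N & (y < x)%N].
Proof. by move=> *; split; lia. Qed.

(** * Liouville's and Thue's inequalities *)

Section Thue.
Variables (R : archiRealFieldType) (k : closedFieldType) (K L : fieldType).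
Variables (f : {rmorphism {poly k} -> K}) (iota : {rmorphism K -> L}).
Variables (al : L) (w : L -> R).
Local Notation biv := {poly {poly k}}.
Local Notation fp := (iota \o f).
Local Notation ev A x := (map_poly fp A).[x].

Hypothesis f_inj : injective f.
Hypothesis f_frac : forall x, exists u v, v != 0 /\ x = f u / f v.
Hypothesis wM : forall x y, in_adjoin iota al x -> in_adjoin iota al y ->
  x != 0 -> y != 0 -> w (x * y) = w x + w y.
Hypothesis wD : forall x y, in_adjoin iota al x -> in_adjoin iota al y ->
  x != 0 -> y != 0 -> x + y != 0 -> Num.min (w x) (w y) <= w (x + y).
Hypothesis wK : forall u v, u != 0 -> v != 0 ->
  w (iota (f u / f v)) = (size v)%:R - (size u)%:R.
Hypothesis al_irr : ~ exists r, al = iota r.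
Variables (p : nat) (pL : p \in [pchar L]).

Definition good_height (kappa : R) (h : nat) : Prop := exists u v : {poly k},
  [/\ coprimep u v, v != 0, maxn (size u) (size v) = h.+1 &
      kappa * h%:R <= w (al - iota (f u / f v))].

Lemma integral_minpoly D : has_degree iota al D ->
  exists (g : biv) dl, [/\ size g = D.+1, in_box D.+1 dl.+1 g & ev g al = 0].
Proof.
move=> [g0 [_ sg rg]]; have [c [g [c0 eg]]] := clear_denominators f_inj f_frac g0.
have sgg : size g = D.+1.
  have := congr1 (fun q : {poly K} => size q) eg.
  by rewrite size_map_inj_poly ?rmorph0 // size_scale ?(inj_rmorph_eq0 f_inj) // sg.
exists g, (sizeY g); split=> //.
  by split=> [|i]; [rewrite sgg | apply: leq_trans (max_size_coefXY _ _) _].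
rewrite map_poly_comp eg map_polyZ hornerZ.
by move/eqP: rg => ->; rewrite mulr0.
Qed.

Let rho : R := Num.max 0 (- w al).

Lemma rho_ge0 : 0 <= rho. Proof. by rewrite le_max lexx. Qed.

Lemma val_ge_gen : val_ge iota al w (- rho) al.
Proof.
split; first exact: in_adjoin_gen.
by move=> _; rewrite lerNl le_max lexx orbT.
Qed.

Lemma val_ge_near kappa h (u v : {poly k}) :
  kappa * h%:R <= w (al - iota (f u / f v)) ->
  val_ge iota al w (kappa * h%:R) (al - iota (f u / f v)).
Proof.
move=> le; split; last by [].
by exists ('X - (f u / f v)%:P); rewrite rmorphB /= map_polyX map_polyC hornerXsubC.
Qed.

Lemma near_vanish_good a X e (A B : biv) kappa h1 h2 (u1 v1 u2 v2 : {poly k}) :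
  0 <= kappa -> in_box a.+1 X.+1 A -> in_box a.+1 X.+1 B ->
  ev A al * al ^+ (p ^ e) = ev B al ->
  maxn (size u1) (size v1) = h1.+1 -> maxn (size u2) (size v2) = h2.+1 ->
  v1 != 0 -> v2 != 0 -> kappa * h1%:R <= w (al - iota (f u1 / f v1)) ->
  kappa * h2%:R <= w (al - iota (f u2 / f v2)) ->
  hev a A u2 v2 * u1 ^+ (p ^ e) = hev a B u2 v2 * v1 ^+ (p ^ e) \/
  Num.min ((p ^ e)%:R * (kappa * h1%:R)) (kappa * h2%:R) - X%:R -
    (p ^ e + a)%:R * rho <= (a * h2 + p ^ e * h1)%:R.
Proof.
move=> k0 bA bB rel s1 s2 v10 v20 g1 g2; have [sA _] := bA; have [sB _] := bB.
have sv1 : (size v1 <= h1.+1)%N by rewrite -s1 leq_maxr.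
have sv2 : (size v2 <= h2.+1)%N by rewrite -s2 leq_maxr.
apply: (vanish_or_large f_inj wK sA sB v10 v20 sv1 sv2).
apply: (near_vanish f_inj wM wD wK pL bA bB rel rho_ge0 val_ge_gen).
- by rewrite mulr_ge0.
- exact: val_ge_near.
- exact: val_ge_near.
Qed.

(** The dichotomy with A = 0, B = g, e = 0 and r1 = r2. The denominator v^D v gives D + 1 in place
    of the classical D, which still suffices against an exponent exceeding ceil(d^m/2) + 1. *)
Lemma liouville D kappa : has_degree iota al D -> 0 <= kappa ->
  (forall H, exists2 h, (H <= h)%N & good_height kappa h) -> kappa <= D.+1%:R.
Proof.
move=> hal k0 unb; rewrite leNgt; apply/negP => lt.
have [g [dl [sg bg eg]]] := integral_minpoly hal.
pose C := dl%:R + (1 + D)%:R * rho.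
have C0 : 0 <= C by rewrite addr_ge0 // mulr_ge0 // rho_ge0.
pose H := Num.bound (C / (kappa - D.+1%:R)).
have [h le_h [u [v [cop v0 sz near]]]] := unb H.+1.
have b0 : in_box D.+1 dl.+1 (0 : biv).
  by split=> [|i]; rewrite ?coef0 size_poly0.
have rel : ev (0 : biv) al * al ^+ (p ^ 0) = ev g al by rewrite rmorph0 horner0 mul0r eg.
have [van|le] := near_vanish_good k0 b0 bg rel sz sz v0 v0 near near.
  have {}van : hev D g u v = 0.
    by move/esym/eqP: van; rewrite hev0 mul0r mulf_eq0 expf_eq0 (negPf v0) andbF orbF => /eqP.
  have v0' : fp v != 0 by rewrite /= fmorph_eq0 (inj_rmorph_eq0 f_inj).
  have rr : root (map_poly iota (map_poly f g)) (iota (f u / f v)).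
    have e1 : fp (hev D g u v) = 0 by rewrite van rmorph0.
    rewrite (hev_map fp) hev_frac ?(leq_trans (size_poly _ _)) ?sg // in e1.
    move/eqP: e1; rewrite mulf_eq0 expf_eq0 (negPf v0') andbF /= -fmorph_div map_poly_comp.
    done.
  rewrite -map_poly_comp in rr.
  have rK : root (map_poly f g) (f u / f v) by rewrite -(fmorph_root iota) -map_poly_comp.
  have [r er] := factor_theorem _ _ rK.
  have := eg; rewrite map_poly_comp er rmorphM hornerM /= rmorphB /= map_polyX map_polyC hornerXsubC.
  move/eqP; rewrite mulf_eq0 subr_eq0 => /orP [rr0|/eqP e1]; last by apply: al_irr; exists (f u / f v).
  have smg : size (map_poly f g) = D.+1 by rewrite size_map_inj_poly ?rmorph0.
  have r0 : r = 0.
    apply: (has_degree_small hal rr0).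
    case: (eqVneq r 0) => [->|r0]; first by rewrite size_poly0.
    rewrite -ltnS -smg er; by rewrite size_Mmonic ?monicXsubC // size_XsubC addn2.
  by move: smg; rewrite er r0 mul0r size_poly0.
rewrite expn0 mul1r minxx mul1n [(D * h + h)%N]addnC -mulSn natrM in le.
have kD : 0 < kappa - D.+1%:R by rewrite subr_gt0.
have : C < (kappa - D.+1%:R) * h%:R.
  rewrite mulrC -ltr_pdivrMr //.
  apply: lt_le_trans (archi_boundP _) _; first by rewrite divr_ge0 // ltW.
  by rewrite ler_nat ltnW.
have : kappa * h%:R - C <= D.+1%:R * h%:R by apply: le_trans le; rewrite /C opprD addrA.
by rewrite mulrBl ltrBrDr lerBlDr addrC => /le_lt_trans h1 /h1; rewrite ltxx.
Qed.

(** Replacing s h1 by h2 or conversely costs a relative error of order (1 + a)/n, at most eps/4 by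
    the choice of n; the term s C is at most (eps/8) s h1. The margin eps absorbs both. *)
Lemma window_arith (n s h1 h2 : R) a eps C : 0 <= a -> 0 < eps -> 0 <= C -> 1 <= n ->
  0 < h1 -> 0 < s -> 4 * (1 + a) <= eps * n -> 8 * C <= eps * h1 ->
  n * (s * h1) < (n + 1) * h2 -> n * h2 < (n + 1) * (s * h1) ->
  a * h2 + s * h1 + s * C < Num.min (s * ((a + 1 + eps) * h1)) ((a + 1 + eps) * h2).
Proof.
move=> a0 e0 C0 n1 h10 s0 hn hC lt1 lt2.
have n0 : 0 < n by apply: lt_le_trans n1.
have sC : 8 * (s * C) <= eps * (s * h1).
  by rewrite mulrCA [leRHS]mulrCA ler_pM2l.
have -> : s * ((a + 1 + eps) * h1) = (a + 1 + eps) * (s * h1) by ring.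
have x0 : 0 < s * h1 by rewrite mulr_gt0.
move: (s * h1) (s * C) h2 sC x0 lt1 lt2 => x c y sC x0 lt1 lt2.
rewrite lt_min; apply/andP; split.
  rewrite -(ltr_pM2l n0).
  have e1 : a * (n * y) <= a * ((n + 1) * x) by rewrite ler_wpM2l // ltW.
  have e2 : 4 * (1 + a) * x <= eps * n * x by rewrite ler_pM2r.
  have e3 : n * (8 * c) <= n * (eps * x) by rewrite ler_pM2l.
  have e4 : 0 <= a * x by rewrite mulr_ge0 // ltW.
  nra.
have y0 : 0 < y by nra.
rewrite -(ltr_pM2l n0).
have e2 : 4 * (1 + a) * y <= eps * n * y by rewrite ler_pM2r.
have e3 : n * (8 * c) <= eps * (n * x) by rewrite [leRHS]mulrCA ler_pM2l.
have e4 : eps * (n * x) <= eps * ((n + 1) * y) by rewrite ler_pM2l // ltW.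
have e5 : eps * y <= eps * (n * y) by rewrite ler_pM2l // ler_peMl // ltW.
have e6 : 0 <= a * y by rewrite mulr_ge0 // ltW.
nra.
Qed.

Lemma thue D kappa : has_degree iota al D -> (D./2).+1%:R < kappa ->
  (forall H, exists2 h, (H <= h)%N & good_height kappa h) ->
  exists e (A B : {poly K}), [/\ (0 < e)%N, coprimep A B, maxn (size A) (size B) = 2 &
    (map_poly iota A).[al] * al ^+ (p ^ e) = (map_poly iota B).[al]].
Proof.
move=> hal lt unb; set a := D./2 in lt.
have [g [dl [sg bg eg]]] := integral_minpoly hal.
have p_gt1 := prime_gt1 (pcharf_prime pL).
pose eps := kappa - a.+1%:R; have eps0 : 0 < eps by rewrite subr_gt0.
have ek : kappa = a%:R + 1 + eps by rewrite natr1 /eps addrC subrK.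
(* All error terms are linear in q: (q + a + 1) dl <= q X0, and X + (q + a) rho <= q C. Since X0 and
   C are independent of q, they are negligible against h1. *)
pose X0 := (a.+2 * dl)%N; pose C := X0%:R + (1 + a)%:R * rho.
have C0 : 0 <= C by rewrite addr_ge0 // mulr_ge0 // rho_ge0.
(* The 4 ensures 4 q h1 < 5 h2 and the other bound is the one in [window_arith]. The summands of
   [H0] make h1 positive and large enough for the bounds on 2 X, on 4 (2 + 6 a) X and on 8 C. *)
pose n := maxn 4 (Num.bound (4 * (1 + a%:R) / eps)).
pose H0 := (1 + (2 * X0 + 4 * (2 + 6 * a) * X0 + Num.bound (8 * C / eps)))%N.
have n4 : (4 <= n)%N by rewrite leq_maxl.
have [h1 [h2 [e [[P1 P2] hH0 e0 lt1 lt2]]]] :=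
  height_pigeonhole H0 p_gt1 (leq_trans (isT : (0 < 4)%N) n4) unb.
set s := (p ^ e)%N in lt1 lt2.
have s_gt0 : (0 < s)%N by rewrite expn_gt0 prime_gt0 // (pcharf_prime pL).
have h1_gt0 : (0 < h1)%N by apply: leq_trans hH0.
pose X := (s * X0)%N.
have aD : (D < 2 * a.+1)%N.
  by rewrite /a -{1}(odd_double_half D) mul2n doubleS; case: (odd D); rewrite ?ltnS ?leqnn.
have [A [B [H [bA0 bB0 nz rel0]]]] := siegel s sg bg aD.
have leX : (((s + a.+1) * dl).+1 <= X.+1)%N.
  rewrite ltnS /X /X0 mulnA leq_mul2r; apply/orP; right.
  by rewrite mulnS leq_add2l leq_pmull.
have bA := in_boxW (leqnn _) leX bA0; have bB := in_boxW (leqnn _) leX bB0.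
have rel : ev A al * al ^+ s = ev B al.
  have := congr1 (fun q : biv => ev q al) rel0.
  rewrite rmorphB !rmorphM /= map_polyXn hornerD hornerN !hornerM hornerXn eg mul0r.
  by move/eqP; rewrite subr_eq0 => /eqP.
have [u1 [v1 [cop1 v10 sz1 near1]]] := P1; have [u2 [v2 [cop2 v20 sz2 near2]]] := P2.
have k0 : 0 <= kappa by apply: le_trans (ltW lt).
have Xx : (2 * X <= s * h1)%N.
  rewrite /X mulnCA leq_mul2l; apply/orP; right; apply: leq_trans hH0.
  by rewrite /H0 -addnA addnCA leq_addr.
have Xx' : (4 * ((2 + 6 * a) * X) <= s * h1)%N.
  have -> : (4 * ((2 + 6 * a) * X) = s * (4 * (2 + 6 * a) * X0))%N by rewrite /X; ring.
  rewrite leq_mul2l; apply/orP; right; apply: leq_trans hH0.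
  by rewrite /H0 -addnA [(2 * X0 + _)%N]addnCA addnCA leq_addr.
have [van|le] := near_vanish_good k0 bA bB rel sz1 sz2 v10 v20 near1 near2; last first.
  exfalso; have : a%:R * h2%:R + s%:R * h1%:R + s%:R * C <
      Num.min (s%:R * ((a%:R + 1 + eps) * h1%:R)) ((a%:R + 1 + eps) * h2%:R).
    apply: (@window_arith n%:R) => //.
    - by rewrite ler1n (leq_trans _ n4).
    - by rewrite ltr0n.
    - by rewrite ltr0n.
    - rewrite [leRHS]mulrC -ler_pdivrMr //.
      apply: le_trans (ltW (archi_boundP _)) _; first by rewrite divr_ge0 ?(ltW eps0) // mulr_ge0 // addr_ge0.
      by rewrite ler_nat leq_maxr.
    - rewrite [leRHS]mulrC -ler_pdivrMr //.
      apply: le_trans (ltW (archi_boundP _)) _; first by rewrite divr_ge0 ?(ltW eps0) // mulr_ge0.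
      rewrite ler_nat; apply: leq_trans hH0; rewrite /H0 addnA; exact: leq_addl.
    - by rewrite natr1 -!natrM ltr_nat.
    - by rewrite natr1 -!natrM ltr_nat.
  apply/negP; rewrite -leNgt -ek; move: le; rewrite -/s -addrA -opprD lerBlDr => le.
  apply: (le_trans le); rewrite natrD !natrM lerD2l /C mulrDr natrM lerD2l mulrA ler_wpM2r ?rho_ge0 //.
  by rewrite -natrM ler_nat mulnDr muln1 leq_add2l leq_pmull.
have l54 : (4 * (s * h1) < 5 * h2)%N.
  have n_gt0 : (0 < n)%N by apply: leq_trans n4.
  rewrite -(ltn_pmul2l n_gt0) mulnCA; apply: (@leq_trans (4 * (n.+1 * h2))).
    by rewrite ltn_pmul2l.
  rewrite !mulnA leq_mul2r mulnS (mulnC n) (mulSn 4) leq_add2r n4 orbT //.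
have x0 : (0 < s * h1)%N by rewrite muln_gt0 s_gt0.
have [Xh2 lt4 Xh1] := window_nat l54 Xx Xx' x0.
have a_lt : (a < D)%N.
  by rewrite /a -divn2 ltn_Pdiv // (has_degree_gt0 hal).
have [A1 [B1 [c1 c2 c3]]] := moebius_of_vanish f_inj f_frac hal a_lt s_gt0 bA bB nz rel
  cop1 sz1 cop2 sz2 v10 v20 h1_gt0 Xh2 Xh1 lt4 van.
by exists e, A1, B1.
Qed.

End Thue.

(** * Reduced fractions, isotriviality and critical points *)

Lemma fraction_repr (A : idomainType) (x : {fraction A}) :
  x = tofrac (frac (repr x)).1 / tofrac (frac (repr x)).2.
Proof.
have d0 := denom_ratioP (repr x).
apply: (canRL (mulfK _)); first by rewrite tofrac_eq0.
rewrite -{1}[x]reprK; unlock FracField.tofrac; rewrite -[LHS]FracField.pi_mul.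
apply/eqmodP; rewrite /= FracField.equivfE /FracField.mulf.
by rewrite !numden_Ratio ?mulf_neq0 ?oner_neq0 // !mulr1 mulrC.
Qed.

Lemma cross_mul (E : fieldType) (x y z t : E) : y != 0 -> t != 0 ->
  x / y = z / t -> x * t = z * y.
Proof. by move=> y0 t0 /eqP; rewrite eqr_div // => /eqP. Qed.

Lemma cancel_common (E : fieldType) (c t x y : E) N : c != 0 -> t != 0 ->
  c * x / t ^+ N / (c * y / t ^+ N) = x / y.
Proof.
move=> c0 t0; rewrite -mulf_div divff ?invr_eq0 ?expf_neq0 // mulr1.
by rewrite -mulf_div divff ?mul1r.
Qed.

Section RatfunBasics.
Variable F : fieldType.
Implicit Types (phi psi : ratfun F) (a b n m : {poly F}).
Local Notation tf := (@FracField.tofrac {poly F}).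

Lemma ratden_neq0 phi : ratden phi != 0.
Proof.
rewrite /ratden; have d0 := denom_ratioP (repr phi).
by apply: contraNneq d0 => e; rewrite -(divpK (dvdp_gcdr (frac (repr phi)).1 (frac (repr phi)).2)) e mul0r.
Qed.

Lemma coprime_ratnum phi : coprimep (ratnum phi) (ratden phi).
Proof. by apply: coprimep_div_gcd; rewrite denom_ratioP orbT. Qed.

Lemma ratfunE phi : phi = tf (ratnum phi) / tf (ratden phi).
Proof.
rewrite {1}[phi]fraction_repr /ratnum /ratden; have := denom_ratioP (repr phi).
move: (frac (repr phi)).1 (frac (repr phi)).2 => u v v0.
have g0 : gcdp u v != 0 by rewrite gcdp_eq0 negb_and v0 orbT.
transitivity (tf (u %/ gcdp u v * gcdp u v) / tf (v %/ gcdp u v * gcdp u v)).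
  by rewrite !divpK ?dvdp_gcdl ?dvdp_gcdr.
have g0' : tf (gcdp u v) != 0 by rewrite tofrac_eq0.
by rewrite !tofracM -mulf_div divff // mulr1.
Qed.

Lemma ratdegE phi : maxn (size (ratnum phi)) (size (ratden phi)) = (ratdeg phi).+1.
Proof.
by rewrite /ratdeg prednK // leq_max orbC size_poly_gt0 ratden_neq0.
Qed.

Lemma ratfun_cross phi a b : b != 0 -> phi = tf a / tf b ->
  ratnum phi * b = a * ratden phi.
Proof.
move=> b0 e; apply/eqP; rewrite -tofrac_eq !tofracM.
have b0' : tf b != 0 by rewrite tofrac_eq0.
have d0' : tf (ratden phi) != 0 by rewrite tofrac_eq0 ratden_neq0.
have e' := etrans (esym (ratfunE phi)) e.
exact/eqP/(cross_mul d0' b0' e').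
Qed.

Lemma ratfun_coprime phi a b : b != 0 -> coprimep a b -> phi = tf a / tf b ->
  exists2 c, c != 0 & ratnum phi = c *: a /\ ratden phi = c *: b.
Proof.
move=> b0 cop e; have X := ratfun_cross b0 e; have cop' := coprime_ratnum phi.
have : b %= ratden phi.
  rewrite /eqp -(Gauss_dvdpr _ (_ : coprimep b a)) 1?coprimep_sym // -X dvdp_mull //=.
  by rewrite -(Gauss_dvdpr _ (_ : coprimep _ (ratnum phi))) 1?coprimep_sym // X dvdp_mull.
rewrite eqp_sym => /eqpf_eq [c c0 eb]; exists c => //; split=> //.
apply: (mulIf b0); rewrite X eb -scalerAl -scalerAr //.
Qed.

Lemma rateval_pmap phi : rateval phi =1 pmap (ratdeg phi) (ratnum phi) (ratden phi).
Proof.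
have sn : (size (ratnum phi) <= (ratdeg phi).+1)%N by rewrite -ratdegE leq_maxl.
have sd : (size (ratden phi) <= (ratdeg phi).+1)%N by rewrite -ratdegE leq_maxr.
by case=> [u|]; rewrite /rateval /pmap /= ?hev_x1 // !hev_x0 !expr1n !mulr1.
Qed.

Lemma rateval_frac a b x : b.[x] != 0 -> rateval (tf a / tf b) (Some x) = Some (a.[x] / b.[x]).
Proof.
move=> bx; have b0 : b != 0 by apply: contraNneq bx => ->; rewrite horner0.
have X := ratfun_cross (a := a) b0 erefl; set phi := tf a / tf b in X *.
have dx : (ratden phi).[x] != 0.
  apply/negP => rd; have := congr1 (horner^~ x) X; rewrite !hornerM (eqP rd) mulr0.
  move/eqP; rewrite mulf_eq0 (negPf bx) orbF => rn.
  by have := coprimep_root (coprime_ratnum phi) rn; rewrite rd.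
rewrite /rateval (negPf dx); congr Some; apply/eqP; rewrite eqr_div //.
by rewrite -!hornerM X.
Qed.

Local Notation lift q := (map_poly (fun c : F => tf c%:P) q).

Lemma lift_horner N (q n m : {poly F}) : (size q <= N.+1)%N -> m != 0 ->
  (lift q).[tf n / tf m] = tf (hcomp N q n m) / tf m ^+ N.
Proof.
move=> sq m0; have m0' : tf m != 0 by rewrite tofrac_eq0.
rewrite /hcomp hev_map -map_poly_comp /= hev_frac ?(leq_trans (size_poly _ _)) //.
by rewrite mulrAC divff ?expf_neq0 // mul1r.
Qed.

Lemma ratcomp_frac N a b (n m : {poly F}) : (size a <= N.+1)%N -> (size b <= N.+1)%N ->
  b != 0 -> coprimep a b -> m != 0 ->
  ratcomp (tf a / tf b) (tf n / tf m) = tf (hcomp N a n m) / tf (hcomp N b n m).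
Proof.
move=> sa sb b0 cop m0; have m0' : tf m != 0 by rewrite tofrac_eq0.
have [c c0 [en ed]] := ratfun_coprime b0 cop erefl.
rewrite /ratcomp en ed !(lift_horner (N := N)) ?size_scale //.
have sc (q : {poly F}) : hcomp N (c *: q) n m = c%:P * hcomp N q n m.
  rewrite /hcomp -hevZ; congr hev; apply/polyP => i.
  by rewrite coefZ !coef_map_id0 ?polyC0 ?coefZ ?polyCM.
rewrite !sc !tofracM.
have c0' : tf c%:P != 0 by rewrite tofrac_eq0 polyC_eq0.
exact: (cancel_common _ _ _ c0' m0').
Qed.

Lemma ratcomp_frac2 N phi (n m : {poly F}) : ratdeg phi = N -> m != 0 ->
  ratcomp phi (tf n / tf m) = tf (hcomp N (ratnum phi) n m) / tf (hcomp N (ratden phi) n m).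
Proof.
move=> dN m0; rewrite {1}[phi]ratfunE; apply: ratcomp_frac => //.
- by rewrite -dN -ratdegE leq_maxl.
- by rewrite -dN -ratdegE leq_maxr.
- exact: ratden_neq0.
- exact: coprime_ratnum.
Qed.

Lemma ratdeg_frac N a b : coprimep a b -> b != 0 -> maxn (size a) (size b) = N.+1 ->
  ratdeg (tf a / tf b) = N.
Proof.
move=> cop b0 sz; have [c c0 [en ed]] := ratfun_coprime b0 cop erefl.
by rewrite /ratdeg en ed !size_scale // sz.
Qed.

End RatfunBasics.

Section Ratmap.
Variables (K L : fieldType) (iota : {rmorphism K -> L}) (phi : ratfun K).
Local Notation mp := (map_poly iota).

Lemma pmap_scale (F : fieldType) n c (a b : {poly F}) x : c != 0 ->
  pmap n (c *: a) (c *: b) x = pmap n a b x.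
Proof. by move=> c0; rewrite /pmap !hevZ tp_scale. Qed.

Lemma ratmap_num_den : exists2 c, c != 0 &
  ratnum (ratmap iota phi) = c *: mp (ratnum phi) /\
  ratden (ratmap iota phi) = c *: mp (ratden phi).
Proof.
apply: (ratfun_coprime _ _ erefl); first by rewrite map_poly_eq0 ratden_neq0.
by rewrite coprimep_map coprime_ratnum.
Qed.

Lemma ratdeg_ratmap : ratdeg (ratmap iota phi) = ratdeg phi.
Proof.
have [c c0 [en ed]] := ratmap_num_den.
by rewrite /ratdeg en ed !size_scale // !size_map_poly.
Qed.

Lemma rateval_ratmap :
  rateval (ratmap iota phi) =1 pmap (ratdeg phi) (mp (ratnum phi)) (mp (ratden phi)).
Proof.
move=> x; have [c c0 [en ed]] := ratmap_num_den.
by rewrite rateval_pmap ratdeg_ratmap en ed pmap_scale.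
Qed.

End Ratmap.

Section Coordinates.
Variable L : closedFieldType.
Implicit Types (psi : ratfun L) (a b : {poly L}).
Local Notation tf := (@FracField.tofrac {poly L}).

Lemma hcop_ratfun psi : hcop (ratdeg psi) (ratnum psi) (ratden psi).
Proof. by apply: coprime_hcop; [exact: coprime_ratnum|exact: ratdegE]. Qed.

Lemma hcop_den_neq0 n a b : (0 < n)%N -> hcop n a b -> b != 0.
Proof.
move=> n0 h; apply/eqP => b0; have := hcop_size h; have := hcop_coprime h.
by rewrite b0 coprimep0 size_poly0 maxn0 -size_poly_eq1 => /eqP -> [e]; rewrite -e in n0.
Qed.

Lemma pmap_frac n m a b a' b' : (0 < n)%N -> (0 < m)%N -> hcop n a b -> hcop m a' b' ->
  pmap n a b =1 pmap m a' b' -> tf a / tf b = tf a' / tf b'.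
Proof.
move=> n0 m0 h h' /(pmap_eq h h') e; apply/eqP; rewrite eqr_div ?tofrac_eq0 ?(hcop_den_neq0 _ h) ?(hcop_den_neq0 _ h') //.
by rewrite -!tofracM e.
Qed.

Lemma ratcomp_pmap n d a b p q : (0 < n)%N -> (0 < d)%N -> hcop n a b -> hcop d p q ->
  ratcomp (tf a / tf b) (tf p / tf q) = tf (hcomp n a p q) / tf (hcomp n b p q).
Proof.
move=> n0 d0 h h'; have [sa sb _] := h.
by apply: ratcomp_frac; rewrite ?(hcop_coprime h) ?(hcop_den_neq0 _ h) ?(hcop_den_neq0 _ h').
Qed.

Lemma algebraicOver_const (k : fieldType) (kap : {rmorphism k -> L}) c :
  algebraicOver kap (kap c).
Proof.
exists ('X - c%:P); first by rewrite polyXsubC_eq0.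
by rewrite rmorphB /= map_polyX map_polyC root_XsubC.
Qed.

Lemma isotrivial_of_constant_conj (k : closedFieldType) (kap : {rmorphism k -> L}) psi :
  (0 < ratdeg psi)%N -> constant_conj kap (ratdeg psi) (rateval psi) -> isotrivial kap psi.
Proof.
set d := ratdeg psi => d0 [u [v [a [b [[pu [qu [hu eu]]] [pv [qv [hv ev]]] uK vK [h e]]]]]].
have hX : hcop 1 ('X : {poly L}) 1.
  by apply: coprime_hcop; rewrite ?coprimep1 // size_polyX size_poly1.
have h1 := hcop_ratfun psi.
have idX x : pmap 1 'X 1 x = x :> option L.
  by rewrite /pmap /hev !big_ord_recl !big_ord0 /= !coefX !coef1 /= !mul0r !mul1r ?add0r !addr0 !expr1 !mulr1 tp_pt.
exists (tf pv / tf qv), (tf pu / tf qu); split.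
- by apply: ratdeg_frac; rewrite ?(hcop_coprime hv) ?(hcop_size hv) ?(hcop_den_neq0 _ hv).
- rewrite (ratcomp_pmap _ _ hv hu) // -[ratX L]divr1 -tofrac1.
  apply: (pmap_frac _ _ (hcop_comp hv hu) hX) => // x.
  by rewrite -pmap_comp // -eu -ev uK idX.
- rewrite (ratcomp_pmap _ _ hu hv) // -[ratX L]divr1 -tofrac1.
  apply: (pmap_frac _ _ (hcop_comp hu hv) hX) => // x.
  by rewrite -pmap_comp // -ev -eu vK idX.
exists (map_poly kap a), (map_poly kap b); split.
- exact: hcop_den_neq0 h.
- by move=> i; rewrite coef_map; apply: algebraicOver_const.
- by move=> i; rewrite coef_map; apply: algebraicOver_const.
have hn := hcop_comp h1 hu; rewrite -/d in hn.
rewrite (ratcomp_frac2 _ erefl) ?(hcop_den_neq0 _ hu) // -/d.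
rewrite (ratcomp_pmap _ _ hv hn) ?muln1 //.
apply: (pmap_frac _ _ (hcop_comp hv hn) h) => [||x]; rewrite ?muln1 ?mul1n //.
have := pmap_comp 1 pv qv x hn; rewrite !mul1n !muln1 => <-.
have := pmap_comp d (ratnum psi) (ratden psi) x hu; rewrite -/d !muln1 => <-.
by rewrite -eu -rateval_pmap -ev e.
Qed.

End Coordinates.

(** * Critical points and the Wronskian *)

Section Critical.
Variable L : closedFieldType.
Implicit Types (psi : ratfun L) (a b : {poly L}).
Local Notation tf := (@FracField.tofrac {poly L}).

Lemma double_root_factor (S : {poly L}) x : S != 0 -> S.[x] = 0 -> S^`().[x] = 0 ->
  exists m q, [/\ (1 < m)%N, q.[x] != 0 & S = q * ('X - x%:P) ^+ m].
Proof.
move=> S0 Sx S'x; have [[|[|m]] [q /implyP /(_ S0) nr e]] := multiplicity_XsubC S x.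
- by rewrite e mulr1 in Sx; rewrite /root Sx eqxx in nr.
- rewrite e derivM derivXsubC hornerD !hornerM hornerXsubC subrr mulr0 add0r hornerC mulr1 in S'x.
  by rewrite /root S'x eqxx in nr.
by exists m.+2, q.
Qed.

Lemma hcomp1_lin s1 s2 a b : hcomp 1 (lin s1 s2) a b = s1 *: a + s2 *: b.
Proof.
rewrite hcompE big_ord_recl big_ord1 /= !coef_lin !expr0 !expr1 mul1r mulr1.
by rewrite addrC.
Qed.

(** With sigma = (s1 z + s2)/(s3 z + s4) and theta = z + x, the map sigma o psi o theta is S/T at z
    + x. The factor (z - x)^m of S becomes z^m, and T does not vanish there. *)
Lemma critical_of_double_root psi x s1 s2 s3 s4 :
  let S := s1 *: ratnum psi + s2 *: ratden psi in
  let T := s3 *: ratnum psi + s4 *: ratden psi in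
  s1 * s4 - s2 * s3 != 0 -> S != 0 -> S.[x] = 0 -> S^`().[x] = 0 -> T.[x] != 0 ->
  critical_point psi (Some x).
Proof.
move=> S T det S0 Sx S'x Tx; have [m [q [m1 qx eS]]] := double_root_factor S0 Sx S'x.
exists m => //; split; first exact: ltnW.
have hs : hcop 1 (lin s1 s2) (lin s3 s4) by apply/hcop_lin.
pose th : {poly L} := 'X + x%:P.
have sth : size th = 2 by rewrite size_XaddC.
have th0 : th.[0] = x by rewrite /th hornerD hornerX hornerC add0r.
have cth : hcop 1 th 1.
  by apply: coprime_hcop; rewrite ?coprimep1 // sth size_poly1.
have cmp n a : (size a <= n.+1)%N -> hcomp n a th 1 = a \Po th.
  by move=> sa; rewrite /hcomp hev_x1 ?(leq_trans (size_poly _ _)).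
have [sn sd _] := hcop_ratfun psi.
have den0 : ratden psi \Po th != 0 by rewrite comp_poly2_eq0 // ratden_neq0.
have ef : ratcomp (tf (lin s1 s2) / tf (lin s3 s4)) (ratcomp psi (tf th / tf 1)) =
    tf (S \Po th) / tf (T \Po th).
  rewrite (ratcomp_frac2 _ erefl) ?oner_neq0 // !cmp //.
  have [sa sb _] := hs.
  rewrite (ratcomp_frac (N := 1)) ?(hcop_coprime hs) ?(hcop_den_neq0 _ hs) //.
  by rewrite !hcomp1_lin -!comp_polyZ -!comp_polyD.
have T0 : (T \Po th).[0] != 0 by rewrite horner_comp th0.
exists (tf (lin s1 s2) / tf (lin s3 s4)), (tf th / tf 1); split.
- by apply: ratdeg_frac; rewrite ?(hcop_coprime hs) ?(hcop_size hs) ?(hcop_den_neq0 _ hs).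
- by apply: ratdeg_frac; rewrite ?coprimep1 ?oner_neq0 // sth size_poly1.
- by rewrite rateval_frac hornerC ?oner_neq0 // th0 divr1.
- by rewrite ef rateval_frac // horner_comp th0 Sx mul0r.
exists (tf (q \Po th) / tf (T \Po th)); split; last first.
  exists (q.[x] / T.[x]); first by rewrite mulf_neq0 ?invr_eq0.
  by rewrite rateval_frac // !horner_comp th0.
rewrite ef; have -> : S \Po th = 'X ^+ m * (q \Po th).
  rewrite eS comp_polyM mulrC; congr (_ * _).
  by rewrite rmorphXn /= comp_polyB comp_polyX comp_polyC /th addrK.
by rewrite tofracM tofracXn mulrA.
Qed.

(** At a finite value the double root is that of num - psi(x) den, with sigma = z - psi(x); at a
    pole it is that of the denominator, with sigma = 1/z. *)
Lemma critical_of_wronskian psi x : (0 < ratdeg psi)%N ->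
  (wronskian (ratnum psi) (ratden psi)).[x] = 0 -> critical_point psi (Some x).
Proof.
move=> d0; rewrite /wronskian hornerD hornerN !hornerM => W.
have cop := coprime_ratnum psi; have sz := ratdegE psi.
have [bx|bx] := eqVneq (ratden psi).[x] 0; last first.
  pose v := (ratnum psi).[x] / (ratden psi).[x].
  apply: (@critical_of_double_root psi x 1 (- v) 0 1).
  - by rewrite mulr1 mulr0 subr0 oner_neq0.
  - by rewrite scale1r scaleNr subr_eq0 (coprime_not_proportional _ d0 cop sz).
  - by rewrite hornerD !hornerZ mul1r mulNr divfK // subrr.
  - rewrite derivD !derivZ hornerD !hornerZ mul1r /v; apply: (mulIf bx).
    by rewrite mul0r -[RHS]W; field.
  - by rewrite scale0r add0r scale1r.
have ax : (ratnum psi).[x] != 0.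
  by apply/negP => rn; have := coprimep_root cop rn; rewrite bx eqxx.
apply: (@critical_of_double_root psi x 0 1 1 0).
- by rewrite mul0r mulr1 sub0r oppr_eq0 oner_neq0.
- by rewrite scale0r add0r scale1r ratden_neq0.
- by rewrite scale0r add0r scale1r.
- rewrite scale0r add0r scale1r; move: W; rewrite bx mulr0 sub0r => /eqP.
  by rewrite oppr_eq0 mulf_eq0 (negPf ax) => /eqP.
- by rewrite scale0r addr0 scale1r.
Qed.

End Critical.

Section GoodHeights.
Variables (R : realType) (k L : closedFieldType) (iota : {rmorphism ratfun k -> L}).
Local Notation tf := (@FracField.tofrac {poly k}).

Lemma ord_infty_frac (u v : {poly k}) : u != 0 -> v != 0 ->
  ord_infty (tf u / tf v) = (size v)%:Z - (size u)%:Z.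
Proof.
move=> u0 v0; have X := ratfun_cross (a := u) v0 erefl; set r := tf u / tf v in X *.
have d0 := ratden_neq0 r.
have n0 : ratnum r != 0.
  by apply: contraNneq (mulf_neq0 u0 d0) => n0; rewrite -X n0 mul0r.
have := congr1 (fun q : {poly k} => size q) X; rewrite !size_mul // /ord_infty.
move: n0 d0 u0 v0; rewrite -!size_poly_gt0.
move: (size (ratnum r)) (size (ratden r)) (size u) (size v) => x1 x2 x3 x4. lia.
Qed.

Lemma adjoin_in_adjoin al y : in_adjoin iota al y -> adjoin iota al y.
Proof.
move=> [P ->]; exists P, 1; rewrite rmorph1 hornerC oner_neq0; split=> //.
by rewrite divr1.
Qed.

(** Any c' strictly between c and the limit superior is exceeded at arbitrarily large heights. The
    gap c < c' supplies the positive margin required by [thue]. *)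
Lemma good_heights al (w : L -> R) (c : R) :
  (c%:E < height_limsup (fun r : ratfun k => (w (al - iota r) / (ratdeg r)%:R)%:E))%E ->
  exists2 c', c < c' & forall H, exists2 h, (H <= h)%N & good_height tf iota al w c' h.
Proof.
set ls := height_limsup _ => lt.
have [c' cc' c'l] : exists2 c' : R, c < c' & (c'%:E < ls)%E.
  move: lt; case: ls => [r||] //.
    rewrite lte_fin => lt; exists ((c + r) / 2); rewrite ?lte_fin; lra.
  by exists (c + 1); rewrite ?ltry // ltrDl.
exists c' => // H.
(* Heights are taken at least 1 so that the quotient by the height can be cleared. *)
have sup_gt : (c'%:E < ereal_sup ((fun r => (w (al - iota r) / (ratdeg r)%:R)%:E) @`
    [set r : ratfun k | (maxn H 1 <= ratdeg r)%N]))%E.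
  apply: lt_le_trans c'l _; apply: ereal_inf_lbound.
  exists [set r : ratfun k | (maxn H 1 <= ratdeg r)%N] => //.
  by exists (maxn H 1).
have [_ [r /= hr <-]] := ereal_sup_gt sup_gt; rewrite lte_fin => lt'.
exists (ratdeg r); first by apply: leq_trans hr; rewrite leq_maxl.
exists (ratnum r), (ratden r); split.
- exact: coprime_ratnum.
- exact: ratden_neq0.
- exact: ratdegE.
rewrite -(ratfunE r) -ler_pdivlMr ?ltW // ltr0n.
by apply: leq_trans hr; rewrite leq_maxr.
Qed.

End GoodHeights.

(** The dimension count of [siegel] again, with the degrees in t forgotten: along the orbit only
    degrees in z matter. *)
Lemma interpolation_exists (k : closedFieldType) (K L : fieldType)
  (f : {rmorphism {poly k} -> K}) (iota : {rmorphism K -> L}) s y n :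
  injective f -> (forall x, exists u v, v != 0 /\ x = f u / f v) -> has_degree iota y n ->
  exists A B : {poly K}, [/\ (size A <= (n./2).+1)%N, (size B <= (n./2).+1)%N,
    ~~ ((A == 0) && (B == 0)) & (map_poly iota A).[y] * y ^+ s = (map_poly iota B).[y]].
Proof.
move=> f_inj f_frac hy; have [g [dl [sg bg gy]]] := integral_minpoly f_inj f_frac hy.
have lt : (n < 2 * (n./2).+1)%N by lia.
have [A [B [H [[sA _] [sB _] nz e]]]] := siegel s sg bg lt.
have f0 q : (map_poly f q == 0) = (q == 0) by rewrite -!size_poly_eq0 size_map_inj_poly ?rmorph0.
exists (map_poly f A), (map_poly f B); split.
- exact: leq_trans (size_poly _ _) sA.
- exact: leq_trans (size_poly _ _) sB.
- by rewrite !f0.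
apply/eqP; rewrite -subr_eq0 -!map_poly_comp; apply/eqP.
have := congr1 (fun q => (map_poly (iota \o f) q).[y]) e.
by rewrite rmorphB !rmorphM /= map_polyXn hornerD hornerN !hornerM hornerXn gy mul0r.
Qed.

Section Constants.
Variables (k L : closedFieldType) (kap : {rmorphism k -> L}) (p : nat) (pL : p \in [pchar L]).

Lemma constants_exhausted_closed : constants_exhausted pL kap.
Proof.
move=> x n n0 fx; have p1 := prime_gt1 (pcharf_prime pL).
have s1 : (1 < p ^ n)%N by rewrite -(exp1n n) ltn_exp2r.
have sq : size ('X^(p ^ n) - 'X : {poly k}) = (p ^ n).+1.
  by rewrite size_polyDl ?size_polyXn // size_polyN size_polyX ltnS.
apply: (@root_map_const _ _ kap ('X^(p ^ n) - 'X)).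
  by rewrite -size_poly_gt0 sq.
rewrite rmorphB /= map_polyXn map_polyX /root hornerD hornerN hornerXn hornerX subr_eq0.
by apply/eqP.
Qed.

End Constants.

(* k is an algebraic closure of F_p (along j), K = k(t) = ratfun k, and L is an
   algebraic closure of K (along iota). *)
Theorem theorem1p3
  (R : realType) (p : nat) (p_prime : prime p)
  (k : closedFieldType) (j : {rmorphism 'F_p -> k})
  (k_alg : forall x : k, algebraicOver j x)
  (L : closedFieldType) (iota : {rmorphism ratfun k -> L})
  (L_alg : forall x : L, algebraicOver iota x)
  (phi : ratfun (ratfun k)) (d : nat)
  (phi_deg : ratdeg phi = d) (d_ge2 : (2 <= d)%N)
  (phi_nonisotrivial :
     ~ isotrivial (fun c : k => iota (tofrac c%:P)) (ratmap iota phi))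
  (gamma : P1 (ratfun k))
  (gamma_npc : ~ post_critical (ratmap iota phi) (omap iota gamma)) :
  exists M : nat, forall m : nat, (M <= m)%N ->
  forall alpha : L,
    iter m (rateval (ratmap iota phi)) (Some alpha) = omap iota gamma ->
    ~ (exists r : ratfun k, alpha = iota r) ->
    (approx_exponent R iota alpha <= ((uphalf (d ^ m) + 1)%N%:R)%:E)%E.
Proof.
pose tf : {rmorphism {poly k} -> ratfun k} := @FracField.tofrac {poly k}.
pose kap : {rmorphism k -> L} := iota \o tf \o polyC.
have pL : p \in [pchar L].
  by apply: (rmorph_pchar kap); apply: (rmorph_pchar j); exact: pchar_Fp.
have tf_inj : injective tf by move=> x y /eqP; rewrite tofrac_eq => /eqP.
have tf_frac x : exists u v, v != 0 /\ x = tf u / tf v.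
  by exists (ratnum x), (ratden x); rewrite ratden_neq0; split; last exact: ratfunE.
have d_gt0 : (0 < d)%N by exact: ltnW.
have dL : ratdeg (ratmap iota phi) = d by rewrite ratdeg_ratmap.
(* Four transports along the orbit, the last of them needing three further levels. *)
exists 7%N => m m7 alpha orb al_irr; rewrite leNgt; apply/negP => lt.
have [_ [w [wM wD wK] <-] lt_w] := ereal_sup_gt lt.
have [kappa lt_kappa good] := good_heights lt_w.
have wM' x y hx hy := wM x y (adjoin_in_adjoin hx) (adjoin_in_adjoin hy).
have wD' x y hx hy := wD x y (adjoin_in_adjoin hx) (adjoin_in_adjoin hy).
have wK' u v : u != 0 -> v != 0 -> w (iota (tf u / tf v)) = (size v)%:R - (size u)%:R.
  move=> u0 v0; rewrite wK; last by rewrite mulf_neq0 ?invr_eq0 ?tofrac_eq0.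
  by rewrite ord_infty_frac // rmorphB.
have [D hD] := has_degree_exists (L_alg alpha).
set P := ratnum phi; set Q := ratden phi.
have copPQ : coprimep P Q := coprime_ratnum phi.
have szPQ : maxn (size P) (size Q) = d.+1 by rewrite ratdegE phi_deg.
have orb' : iter m (pmap d (map_poly iota P) (map_poly iota Q)) (Some alpha) = omap iota gamma.
  by rewrite -orb; apply: eq_iter => x; rewrite rateval_ratmap phi_deg.
have D_le : (D <= d ^ m)%N := degree_bound d_ge2 copPQ szPQ orb' hD.
(* From D <= d^m, floor(D/2) + 1 <= ceil(d^m/2) + 1 < kappa, as [thue] requires. *)
have [e [A [B [e0 copAB szAB rel]]]] :
    exists e (A B : {poly ratfun k}), [/\ (0 < e)%N, coprimep A B, maxn (size A) (size B) = 2 &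
      (map_poly iota A).[alpha] * alpha ^+ (p ^ e) = (map_poly iota B).[alpha]].
  apply: (thue tf_inj tf_frac wM' wD' wK' pL hD _ good).
  apply: le_lt_trans lt_kappa; rewrite ler_nat; move: (d ^ m)%N D_le => N; clear; lia.
(* Liouville gives ceil(d^m/2) + 1 < kappa <= D + 1. *)
have D_ge : (d ^ m < 2 * D)%N.
  have kappa0 : 0 <= kappa by apply: ltW; apply: le_lt_trans lt_kappa.
  have := lt_le_trans lt_kappa (liouville tf_inj tf_frac wM' wD' wK' al_irr pL hD kappa0 good).
  rewrite ltr_nat => lt_D; move: (d ^ m)%N lt_D => N; clear; lia.
(* If phi is inseparable then alpha itself is critical, so gamma is post-critical. *)
have W0 : wronskian (map_poly iota P) (map_poly iota Q) != 0.
  apply/eqP => W; apply: gamma_npc; exists (Some alpha), m; split=> //; last exact: leq_trans m7.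
  apply: critical_of_wronskian; first by rewrite dL.
  have [c c0 [-> ->]] := ratmap_num_den iota phi.
  have -> : wronskian (c *: map_poly iota P) (c *: map_poly iota Q) =
      c *: (c *: wronskian (map_poly iota P) (map_poly iota Q)).
    by rewrite /wronskian !derivZ -!scalerAl -!scalerAr !scalerBr.
  by rewrite W !scaler0 horner0.
have hB : hcop 1 (map_poly iota B) (map_poly iota A).
  by apply: coprime_hcop_map; rewrite 1?coprimep_sym // maxnC.
have interp y n : has_degree iota y n -> exists A1 B1 : {poly ratfun k},
    [/\ (size A1 <= (n./2).+1)%N, (size B1 <= (n./2).+1)%N, ~~ ((A1 == 0) && (B1 == 0)) &
        (map_poly iota A1).[y] * frp e pL y = (map_poly iota B1).[y]].
  exact: interpolation_exists tf_inj tf_frac.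
have [u [v [a [b [hu hv uK vK [hab E]]]]]] := constant_conj_of_relation interp d_ge2 copPQ szPQ
  (@constants_exhausted_closed k L kap p pL) e0 W0 m7 orb' hD D_ge hB rel.
apply: phi_nonisotrivial; apply: (@isotrivial_of_constant_conj _ _ kap); rewrite dL //.
exists u, v, a, b; split=> //; split=> // x.
by rewrite -E rateval_ratmap phi_deg.
Qed.
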